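(* Let $\mathcal C^{\otimes}$ be a monoidal category which admits a calculus of balanced tensor products. Then the naturally marked monoidal nerve $\mathfrak M^{\natural}(\mathcal C^{\otimes})$, i.e. the $3$-coskeletal marked simplicial set whose $0$-simplices are the monoids in $\mathcal C^\otimes$, whose $1$-simplices are the bimodules, whose $2$-simplices are the bimodule maps out of a balanced tensor product, whose $3$-simplices are the compatible quadruples of such maps, whose marked $1$-simplices are the bimodules that are equivalences, whose marked $2$-simplices are the bimodule isomorphisms, and all of whose simplices of dimension $>2$ are marked, is a $2$-complicial set.
   Context: **Monoids and bimodules.** A monoidal category $\mathcal C^\otimes=(\mathcal C,\otimes,I,\alpha,\lambda,\rho)$ is meant in the usual (non-strict) sense, with associator $\alpha_{X,Y,Z}\colon (X\otimes Y)\otimes Z\to X\otimes(Y\otimes Z)$ and unitors $\lambda_X\colon I\otimes X\to X$, $\rho_X\colon X\otimes I\to X$. Monoids $(A,m_A,e_A)$ are the usual (associative, unital) monoid objects. In tensor products of morphisms, an object stands for its identity. For monoids $A,B$, an $(A,B)$-bimodule is an object $M$ with an associative unital left action $\ell_M\colon A\otimes M\to M$ and an associative unital right action $r_M\colon M\otimes B\to M$ such that $r_M\circ(\ell_M\otimes B)=\ell_M\circ(A\otimes r_M)\circ\alpha_{A,M,B}$. An $(A,B)$-bimodule map is a morphism of $\mathcal C$ commuting with both actions. A monoid $A$ is an $(A,A)$-bimodule via $m_A$. **Balanced tensor products.** For an $(A,B)$-bimodule $M$ and a $(B,C)$-bimodule $N$, $M\otimes_BN$ is the coequalizer of $r_M\otimes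 N$ and $(M\otimes\ell_N)\circ\alpha_{M,B,N}\colon (M\otimes B)\otimes N\rightrightarrows M\otimes N$, with canonical map $\pi_{M,N}\colon M\otimes N\to M\otimes_BN$. We say $\mathcal C^\otimes$ admits a calculus of balanced tensor products if for all monoids $A,B,C,D$, all $(A,B)$-bimodules $M$, $(B,C)$-bimodules $N$, $(C,D)$-bimodules $P$: (0) the coequalizer $M\otimes_BN$ exists; (1') $M\otimes(-)\colon\mathcal C\to\mathcal C$ preserves the coequalizer of $r_N\otimes P,\ (N\otimes\ell_P)\circ\alpha_{N,C,P}\colon (N\otimes C)\otimes P\rightrightarrows N\otimes P$; (2') $(-)\otimes P\colon\mathcal C\to\mathcal C$ preserves the coequalizer of $r_M\otimes N,\ (M\otimes\ell_N)\circ\alpha_{M,B,N}$. Assume this from now on, with balanced tensor products chosen. For bimodule maps $\varphi\colon M\to M'$ and $\psi\colon N\to N'$, $\varphi\otimes_B\psi\colon M\otimes_BN\to M'\otimes_BN'$ is the unique morphism with $(\varphi\otimes_B\psi)\circ\pi_{M,N}=\pi_{M',N'}\circ(\varphi\otimes\psi)$. The object $M\otimes_BN$ is an $(A,C)$-bimodule with actions uniquely determined by $\ell_{M\otimes_BN}\circ(A\otimes\pi_{M,N})=\pi_{M,N}\circ(\ell_M\otimes N)\circ\alpha^{-1}_{A,M,N}$ and $r_{M\otimes_BN}\circ(\pi_{M,N}\otimes C)=\pi_{M,N}\circ(M\otimes r_N)\circ\alpha_{M,N,C}$. There is a unique isomorphism $\overline\alpha_{M|N|P}\colon (M\otimes_BN)\otimes_CP\to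 M\otimes_B(N\otimes_CP)$ with $\overline\alpha_{M|N|P}\circ\pi_{M\otimes_BN,P}\circ(\pi_{M,N}\otimes P)=\pi_{M,N\otimes_CP}\circ(M\otimes\pi_{N,P})\circ\alpha_{M,N,P}$. Let $\overline\ell_M\colon A\otimes_AM\to M$ and $\overline r_M\colon M\otimes_BB\to M$ be the bimodule isomorphisms with $\overline\ell_M\circ\pi_{A,M}=\ell_M$, $\overline r_M\circ\pi_{M,B}=r_M$. An $(A,B)$-bimodule $M$ is an *$(A,B)$-equivalence* if there are a $(B,A)$-bimodule $M'$, an isomorphism of $(A,A)$-bimodules $M\otimes_BM'\cong A$ and an isomorphism of $(B,B)$-bimodules $M'\otimes_AM\cong B$. **The monoidal nerve $\mathfrak M(\mathcal C^\otimes)$.** It is the $3$-coskeletal simplicial set (for every $m\ge4$, every map from $\partial\Delta[m]$ extends uniquely to $\Delta[m]$) determined by the following $3$-truncated simplicial set. - $0$-simplices: monoids in $\mathcal C^\otimes$. - $1$-simplices: triples $(A_0,A_1|M_{01})$ with $A_0,A_1$ monoids and $M_{01}$ an $(A_0,A_1)$-bimodule; $d_0=A_1$, $d_1=A_0$; the degeneracy of $A_0$ is $A_0$ as an $(A_0,A_0)$-bimodule. - $2$-simplices: monoids $A_0,A_1,A_2$, $(A_i,A_j)$-bimodules $M_{ij}$ ($0\le i<j\le2$) and an $(A_0,A_2)$-bimodule map $\varphi\colon M_{01}\otimes_{A_1}M_{12}\to M_{02}$; $d_0,d_1,d_2$ are $M_{12},M_{02},M_{01}$; $s_0$ and $s_1$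 of $M_{01}$ are given by $\overline\ell_{M_{01}}\colon A_0\otimes_{A_0}M_{01}\to M_{01}$ and $\overline r_{M_{01}}\colon M_{01}\otimes_{A_1}A_1\to M_{01}$. - $3$-simplices: monoids $A_i$ ($0\le i\le3$), $(A_i,A_j)$-bimodules $M_{ij}$ ($i<j$), and $(A_i,A_k)$-bimodule maps $\varphi_{ijk}\colon M_{ij}\otimes_{A_j}M_{jk}\to M_{ik}$ ($i<j<k$) such that $\varphi_{023}\circ(\varphi_{012}\otimes_{A_2}M_{23})=\varphi_{013}\circ(M_{01}\otimes_{A_1}\varphi_{123})\circ\overline\alpha_{M_{01}|M_{12}|M_{23}}$; $d_0,d_1,d_2,d_3$ are $\varphi_{123},\varphi_{023},\varphi_{013},\varphi_{012}$. The degeneracies of a $2$-simplex $\varphi\colon M_{01}\otimes_{A_1}M_{12}\to M_{02}$ have $(\varphi_{012},\varphi_{023},\varphi_{013},\varphi_{123})$ equal to $(\overline\ell_{M_{01}},\varphi,\overline\ell_{M_{02}},\varphi)$ for $s_0$, $(\overline r_{M_{01}},\varphi,\varphi,\overline\ell_{M_{12}})$ for $s_1$, and $(\varphi,\overline r_{M_{02}},\varphi,\overline r_{M_{12}})$ for $s_2$. **Marking.** A marked simplicial set (simplicial set with marking) is a simplicial set $X$ with, for each $m>0$, a subset of $X_m$ of marked simplices containing all degenerate ones; maps are simplicial maps preserving marked simplices. $\mathfrak M^\natural(\mathcal C^\otimes)$ is $\mathfrak M(\mathcal C^\otimes)$ in which a $1$-simplex is marked iff $M_{01}$ is an $(A_0,A_1)$-equivalence,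 a $2$-simplex is marked iff $\varphi$ is an isomorphism of $(A_0,A_2)$-bimodules, and all simplices of dimension $>2$ are marked. **$2$-complicial sets.** Notation (degenerate simplices are always marked): - $\Delta^k[m]$, $0\le k\le m$: the standard $m$-simplex, a non-degenerate simplex (of positive dimension) being marked iff it contains the vertices $\{k-1,k,k+1\}\cap[m]$. - $\Delta^k[m]'$: obtained from $\Delta^k[m]$ by also marking the $(k-1)$-st and $(k+1)$-st $(m-1)$-dimensional faces, whenever defined. - $\Delta^k[m]''$: obtained from $\Delta^k[m]'$ by also marking the $k$-th face. - $\Lambda^k[m]$: the usual $k$-horn with marking inherited from $\Delta^k[m]$. - $\Delta[m]_t$: the standard $m$-simplex where only the top simplex and degenerate simplices are marked; $\Delta[m]$ has only degenerate simplices marked. - $\Delta[3]^{\mathrm{eq}}$: the standard $3$-simplex in which the $1$-simplices $[0,2]$, $[1,3]$, the degenerate $1$-simplices, and all simplices of dimension $\ge2$ are marked; $\Delta[3]^\sharp$: the standard $3$-simplex with everything (of positive dimension) marked. - $\Delta[3]^{\mathrm{eq}}\star\Delta[\ell]$ and $\Delta[3]^{\sharp}\star\Delta[\ell]$ ($\ell\ge-1$, $\Delta[-1]=\varnothing$): the join, isomorphic to $\Delta[3+1+\ell]$, in which $\sigma\star\tau$ (with $\sigma$ or $\tau$ possibly empty) is marked iff $\sigma$ is marked in $\Delta[3]^{\mathrm{eq}}$ (resp. $\Delta[3]^\sharp$) or $\tau$ is a degenerate simplex of $\Delta[\ell]$. A marked simplicial set is a *$2$-complicial set* if it has the right lifting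 property, in marked simplicial sets, with respect to: (1) $\Lambda^k[m]\to\Delta^k[m]$ for $m>1$, $0<k<m$; (2) $\Delta^k[m]'\to\Delta^k[m]''$ for $m\ge2$, $0<k<m$; (3) $\Delta[m]\to\Delta[m]_t$ for $m>2$; (4) $\Delta[3]^{\mathrm{eq}}\star\Delta[m]\to\Delta[3]^\sharp\star\Delta[m]$ for $m\ge-1$. *)

(* Defs.v *)
From mathcomp Require Import all_boot boolp.

Set Implicit Arguments.
Unset Strict Implicit.
Unset Printing Implicit Defensive.

Record category := Category {
  ob :> Type;
  hom : ob -> ob -> Type;
  idm : forall X, hom X X;
  comp : forall X Y Z, hom Y Z -> hom X Y -> hom X Z;
  comp_idl : forall X Y (f : hom X Y), comp (idm Y) f = f;
  comp_idr : forall X Y (f : hom X Y), comp f (idm X) = f;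
  compA : forall W X Y Z (h : hom Y Z) (g : hom X Y) (f : hom W X),
    comp h (comp g f) = comp (comp h g) f }.

Arguments hom {c} X Y.
Arguments idm {c} X.
Arguments comp {c X Y Z} g f.
Arguments comp_idl {c X Y} f.
Arguments comp_idr {c X Y} f.
Arguments compA {c W X Y Z} h g f.

Notation "g ∘ f" := (comp g f) (at level 49, right associativity).

Record monoidal_category := MonoidalCategory {
  mcat :> category;
  tens : mcat -> mcat -> mcat;
  tensm : forall X X' Y Y' : mcat,
    hom X X' -> hom Y Y' -> hom (tens X Y) (tens X' Y');
  munit : mcat;
  assoc : forall X Y Z : mcat, hom (tens (tens X Y) Z) (tens X (tens Y Z));
  associ : forall X Y Z : mcat, hom (tens X (tens Y Z)) (tens (tens X Y) Z);
  lunit : forall X : mcat, hom (tens munit X) X;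
  luniti : forall X : mcat, hom X (tens munit X);
  runit : forall X : mcat, hom (tens X munit) X;
  runiti : forall X : mcat, hom X (tens X munit);
  tensm_id : forall X Y : mcat, tensm (idm X) (idm Y) = idm (tens X Y);
  tensm_comp : forall (X X' X'' Y Y' Y'' : mcat)
    (g : hom X' X'') (f : hom X X') (k : hom Y' Y'') (h : hom Y Y'),
    tensm (g ∘ f) (k ∘ h) = tensm g k ∘ tensm f h;
  assocK : forall X Y Z : mcat, associ X Y Z ∘ assoc X Y Z = idm _;
  associK : forall X Y Z : mcat, assoc X Y Z ∘ associ X Y Z = idm _;
  lunitK : forall X : mcat, luniti X ∘ lunit X = idm _;
  lunitiK : forall X : mcat, lunit X ∘ luniti X = idm _;
  runitK : forall X : mcat, runiti X ∘ runit X = idm _;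
  runitiK : forall X : mcat, runit X ∘ runiti X = idm _;
  assoc_nat : forall (X X' Y Y' Z Z' : mcat)
    (f : hom X X') (g : hom Y Y') (h : hom Z Z'),
    assoc X' Y' Z' ∘ tensm (tensm f g) h = tensm f (tensm g h) ∘ assoc X Y Z;
  lunit_nat : forall (X X' : mcat) (f : hom X X'),
    lunit X' ∘ tensm (idm munit) f = f ∘ lunit X;
  runit_nat : forall (X X' : mcat) (f : hom X X'),
    runit X' ∘ tensm f (idm munit) = f ∘ runit X;
  pentagon : forall W X Y Z : mcat,
    tensm (idm W) (assoc X Y Z) ∘ assoc W (tens X Y) Z
      ∘ tensm (assoc W X Y) (idm Z)
    = assoc W X (tens Y Z) ∘ assoc (tens W X) Y Z;
  triangle : forall X Y : mcat,
    tensm (idm X) (lunit Y) ∘ assoc X munit Y = tensm (runit X) (idm Y) }.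

Arguments tens {m} X Y.
Arguments tensm {m X X' Y Y'} f g.
Arguments munit {m}.
Arguments assoc {m} X Y Z.
Arguments associ {m} X Y Z.
Arguments lunit {m} X.
Arguments luniti {m} X.
Arguments runit {m} X.
Arguments runiti {m} X.
Arguments tensm_id {m} X Y.
Arguments tensm_comp {m X X' X'' Y Y' Y''} g f k h.
Arguments assoc_nat {m X X' Y Y' Z Z'} f g h.
Arguments lunit_nat {m X X'} f.
Arguments runit_nat {m X X'} f.
Arguments pentagon {m} W X Y Z.
Arguments triangle {m} X Y.

Notation "X ⊗ Y" := (tens X Y) (at level 44, left associativity).
Notation "f ⊠ g" := (tensm f g) (at level 44, left associativity).
Notation "X ◁ f" := (tensm (idm X) f) (at level 43, right associativity).
Notation "f ▷ X" := (tensm f (idm X)) (at level 42, left associativity).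

Section Calculus.
Context {C : monoidal_category}.
Implicit Types W X Y Z : C.

Lemma precomp W X Y Y' Z (g : hom Y Z) (f : hom X Y)
    (g' : hom Y' Z) (f' : hom X Y') (k : hom W X) :
  g ∘ f = g' ∘ f' -> g ∘ f ∘ k = g' ∘ f' ∘ k.
Proof. by move=> e; rewrite !compA e. Qed.

Lemma precomp1 W X Y Z (g : hom Y Z) (f : hom X Y) (h : hom X Z)
    (k : hom W X) :
  g ∘ f = h -> g ∘ f ∘ k = h ∘ k.
Proof. by move=> e; rewrite compA e. Qed.

Lemma precompK W X Y (g : hom Y X) (f : hom X Y) (k : hom W X) :
  g ∘ f = idm X -> g ∘ f ∘ k = k.
Proof. by move=> e; rewrite compA e comp_idl. Qed.

Lemma precomp3 W X Y Z Y' V (h : hom Z V) (g : hom Y Z) (f : hom X Y)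
    (g' : hom Y' V) (f' : hom X Y') (k : hom W X) :
  h ∘ g ∘ f = g' ∘ f' -> h ∘ g ∘ f ∘ k = g' ∘ f' ∘ k.
Proof. by move=> e; rewrite [RHS]compA -e -!compA. Qed.

Lemma precomp31 W X Y Z V (h : hom Z V) (g : hom Y Z) (f : hom X Y)
    (g' : hom X V) (k : hom W X) :
  h ∘ g ∘ f = g' -> h ∘ g ∘ f ∘ k = g' ∘ k.
Proof. by move=> <-; rewrite -!compA. Qed.

Lemma ltensD X Y Y' Y'' (g : hom Y' Y'') (f : hom Y Y') :
  X ◁ (g ∘ f) = X ◁ g ∘ X ◁ f.
Proof. by rewrite -tensm_comp comp_idl. Qed.

Lemma rtensD X Y Y' Y'' (g : hom Y' Y'') (f : hom Y Y') :
  (g ∘ f) ▷ X = g ▷ X ∘ f ▷ X.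
Proof. by rewrite -tensm_comp comp_idl. Qed.

Lemma ltensDp W X Y Y' Y'' (g : hom Y' Y'') (f : hom Y Y') (k : hom W _) :
  X ◁ g ∘ X ◁ f ∘ k = X ◁ (g ∘ f) ∘ k.
Proof. by rewrite ltensD -compA. Qed.

Lemma rtensDp W X Y Y' Y'' (g : hom Y' Y'') (f : hom Y Y') (k : hom W _) :
  g ▷ X ∘ f ▷ X ∘ k = (g ∘ f) ▷ X ∘ k.
Proof. by rewrite rtensD -compA. Qed.

Lemma tensm_lr X X' Y Y' (f : hom X X') (g : hom Y Y') :
  f ⊠ g = f ▷ Y' ∘ X ◁ g.
Proof. by rewrite -tensm_comp comp_idl comp_idr. Qed.

Lemma tensm_rl X X' Y Y' (f : hom X X') (g : hom Y Y') :
  f ⊠ g = X' ◁ g ∘ f ▷ Y.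
Proof. by rewrite -tensm_comp comp_idl comp_idr. Qed.

Lemma interchange X X' Y Y' (f : hom X X') (g : hom Y Y') :
  f ▷ Y' ∘ X ◁ g = X' ◁ g ∘ f ▷ Y.
Proof. by rewrite -tensm_lr tensm_rl. Qed.

Lemma assoc_natl X X' Y Z (f : hom X X') :
  assoc X' Y Z ∘ f ▷ Y ▷ Z = f ▷ (Y ⊗ Z) ∘ assoc X Y Z.
Proof. by rewrite assoc_nat tensm_id. Qed.

Lemma assoc_natm X Y Y' Z (f : hom Y Y') :
  assoc X Y' Z ∘ (X ◁ f) ▷ Z = X ◁ (f ▷ Z) ∘ assoc X Y Z.
Proof. by rewrite assoc_nat. Qed.

Lemma assoc_natr X Y Z Z' (f : hom Z Z') :
  assoc X Y Z' ∘ (X ⊗ Y) ◁ f = X ◁ (Y ◁ f) ∘ assoc X Y Z.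
Proof. by rewrite -assoc_nat tensm_id. Qed.

Lemma assoc_epi X Y Z V (f g : hom (X ⊗ (Y ⊗ Z)) V) :
  f ∘ assoc X Y Z = g ∘ assoc X Y Z -> f = g.
Proof.
move=> e; rewrite -[f]comp_idr -[g]comp_idr -associK.
by rewrite (compA f) (compA g) e.
Qed.

Lemma assoc_mono X Y Z V (f g : hom V ((X ⊗ Y) ⊗ Z)) :
  assoc X Y Z ∘ f = assoc X Y Z ∘ g -> f = g.
Proof.
move=> e; rewrite -[f]comp_idl -[g]comp_idl -assocK.
by rewrite -!compA e.
Qed.

Lemma assocr_epi W X Y Z V (f g : hom (X ⊗ (Y ⊗ Z) ⊗ W) V) :
  f ∘ assoc X Y Z ▷ W = g ∘ assoc X Y Z ▷ W -> f = g.
Proof.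
move=> e; rewrite -[f]comp_idr -[g]comp_idr -tensm_id -associK.
by rewrite rtensD (compA f) (compA g) e.
Qed.

Lemma ltens_inj X Y (f g : hom X Y) : munit ◁ f = munit ◁ g -> f = g.
Proof.
move=> e; rewrite -[f]comp_idr -[g]comp_idr -(lunitiK X).
by rewrite (compA f) (compA g) -!lunit_nat e.
Qed.

Lemma rtens_inj X Y (f g : hom X Y) : f ▷ munit = g ▷ munit -> f = g.
Proof.
move=> e; rewrite -[f]comp_idr -[g]comp_idr -(runitiK X).
by rewrite (compA f) (compA g) -!runit_nat e.
Qed.

Lemma lunit_tens X Y : lunit (X ⊗ Y) ∘ assoc munit X Y = lunit X ▷ Y.
Proof.
apply: ltens_inj; apply: assoc_epi; apply: assocr_epi.
rewrite ltensD -!compA pentagon (precomp1 _ (triangle _ _)).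
rewrite -tensm_id -assoc_nat -triangle rtensD compA.
by rewrite assoc_natm -!compA.
Qed.

Lemma runit_tens X Y : X ◁ runit Y ∘ assoc X Y munit = runit (X ⊗ Y).
Proof.
apply: rtens_inj; apply: assoc_mono.
rewrite rtensD (precomp _ (assoc_natm _ _ _)).
rewrite -!triangle ltensD -!compA pentagon.
by rewrite (precomp _ (assoc_natr _ _ _)).
Qed.

Lemma lunit_munit : lunit munit = runit munit :> hom _ (@munit C).
Proof.
apply: rtens_inj; rewrite -lunit_tens -triangle; congr (_ ∘ _).
have e := lunit_nat (lunit (@munit C)).
rewrite -[LHS]comp_idl -[RHS]comp_idl -(lunitK munit) -!compA.
by rewrite e.
Qed.

End Calculus.

Record monoid (C : monoidal_category) := Monoid {
  mon :> C;
  mmul : hom (mon ⊗ mon) mon;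
  mone : hom munit mon;
  mmulA : mmul ∘ mmul ▷ mon = mmul ∘ mon ◁ mmul ∘ assoc mon mon mon;
  mmul1l : mmul ∘ mone ▷ mon = lunit mon;
  mmul1r : mmul ∘ mon ◁ mone = runit mon }.

Arguments mmul {C} m.
Arguments mone {C} m.

Record bimodule (C : monoidal_category) (A B : monoid C) := Bimodule {
  bim :> C;
  lact : hom (A ⊗ bim) bim;
  ract : hom (bim ⊗ B) bim;
  lactA : lact ∘ mmul A ▷ bim = lact ∘ A ◁ lact ∘ assoc A A bim;
  lact1 : lact ∘ mone A ▷ bim = lunit bim;
  ractA : ract ∘ ract ▷ B = ract ∘ bim ◁ mmul B ∘ assoc bim B B;
  ract1 : ract ∘ bim ◁ mone B = runit bim;
  lractA : ract ∘ lact ▷ B = lact ∘ A ◁ ract ∘ assoc A bim B }.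

Arguments lact {C A B} b.
Arguments ract {C A B} b.

Record bimodule_map (C : monoidal_category) (A B : monoid C)
    (M N : bimodule A B) := BimoduleMap {
  bmap :> hom M N;
  bmap_lact : bmap ∘ lact M = lact N ∘ A ◁ bmap;
  bmap_ract : bmap ∘ ract M = ract N ∘ bmap ▷ B }.

Definition bimodule_iso (C : monoidal_category) (A B : monoid C)
    (M N : bimodule A B) (f : bimodule_map M N) : Prop :=
  exists g : bimodule_map N M, g ∘ f = idm M /\ f ∘ g = idm N.

Definition bimodule_isomorphic (C : monoidal_category) (A B : monoid C)
    (M N : bimodule A B) : Prop :=
  exists f : bimodule_map M N, bimodule_iso f.

Lemma bimodule_map_eq (C : monoidal_category) (A B : monoid C)
    (M N : bimodule A B) (f g : bimodule_map M N) : bmap f = bmap g -> f = g.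
Proof.
case: f g => [f fl fr] [g gl gr] /= e; rewrite -{}e in gl gr *.
by rewrite (Prop_irrelevance fl gl) (Prop_irrelevance fr gr).
Qed.

Definition bimodule_id (C : monoidal_category) (A B : monoid C)
    (M : bimodule A B) : bimodule_map M M.
Proof.
by exists (idm M); rewrite tensm_id comp_idl comp_idr.
Defined.

Definition monoid_bimodule (C : monoidal_category) (A : monoid C) :
    bimodule A A :=
  Bimodule (mmulA A) (mmul1l A) (mmulA A) (mmul1r A) (mmulA A).

Definition coequalizer (C : category) (X Y Q : C) (f g : hom X Y)
    (q : hom Y Q) : Prop :=
  q ∘ f = q ∘ g /\
  forall (Z : C) (h : hom Y Z), h ∘ f = h ∘ g ->
    exists! k : hom Q Z, k ∘ q = h.

Section Balanced.
Context {C : monoidal_category}.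
Implicit Types A B D : monoid C.

Definition balanced_l A B D (M : bimodule A B) (N : bimodule B D) :
    hom ((M ⊗ B) ⊗ N) (M ⊗ N) := ract M ▷ N.

Definition balanced_r A B D (M : bimodule A B) (N : bimodule B D) :
    hom ((M ⊗ B) ⊗ N) (M ⊗ N) := M ◁ lact N ∘ assoc M B N.

Definition balanced A B D (M : bimodule A B) (N : bimodule B D) (Q : C)
    (q : hom (M ⊗ N) Q) : Prop :=
  coequalizer (balanced_l M N) (balanced_r M N) q.

End Balanced.

Definition balanced_calculus (C : monoidal_category) : Prop :=
  forall (A B D E : monoid C)
         (M : bimodule A B) (N : bimodule B D) (P : bimodule D E),
  [/\ exists (Q : C) (q : hom (M ⊗ N) Q), balanced q,
      forall (Q : C) (q : hom (N ⊗ P) Q), balanced q ->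
        coequalizer (M ◁ balanced_l N P) (M ◁ balanced_r N P) (M ◁ q)
    & forall (Q : C) (q : hom (M ⊗ N) Q), balanced q ->
        coequalizer (balanced_l M N ▷ P) (balanced_r M N ▷ P) (q ▷ P)].

Record balanced_choice (C : monoidal_category) := BalancedChoice {
  btens : forall A B D : monoid C, bimodule A B -> bimodule B D -> C;
  bproj : forall (A B D : monoid C) (M : bimodule A B) (N : bimodule B D),
    hom (M ⊗ N) (btens M N);
  bprojP : forall (A B D : monoid C) (M : bimodule A B) (N : bimodule B D),
    balanced (bproj M N) }.

Section Coequalizer.
Context (C : category) (X Y Q : C) (f g : hom X Y) (q : hom Y Q).
Hypothesis hq : coequalizer f g q.

Lemma coeq_ex Z (h : hom Y Z) : h ∘ f = h ∘ g -> exists k, k ∘ q = h.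
Proof. by move=> /(hq.2 Z h)[k [e _]]; exists k. Qed.

Definition coeq_desc Z (h : hom Y Z) (e : h ∘ f = h ∘ g) : hom Q Z :=
  projT1 (cid (coeq_ex e)).

Lemma coeq_descE Z (h : hom Y Z) (e : h ∘ f = h ∘ g) : coeq_desc e ∘ q = h.
Proof. by rewrite /coeq_desc; case: cid. Qed.

Lemma coeq_epi Z (k k' : hom Q Z) : k ∘ q = k' ∘ q -> k = k'.
Proof.
move=> e; have e' : (k ∘ q) ∘ f = (k ∘ q) ∘ g by rewrite -!compA hq.1.
have [l [_ lP]] := hq.2 Z (k ∘ q) e'.
by rewrite -(lP k erefl) -(lP k' (esym e)).
Qed.
End Coequalizer.

Section Preservation.
Context {C : monoidal_category}.
Implicit Types A B D : monoid C.

Definition unit_monoid : monoid C.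
Proof.
exists munit (lunit munit) (idm munit).
- by rewrite lunit_munit -triangle lunit_munit.
- by rewrite tensm_id comp_idr.
- by rewrite tensm_id comp_idr lunit_munit.
Defined.

Lemma unit_lactA (X : C) :
  lunit X ∘ mmul unit_monoid ▷ X
  = lunit X ∘ unit_monoid ◁ lunit X ∘ assoc unit_monoid unit_monoid X.
Proof. by rewrite /= lunit_munit triangle. Qed.

Lemma unit_ractA (X : C) :
  runit X ∘ runit X ▷ unit_monoid
  = runit X ∘ X ◁ mmul unit_monoid ∘ assoc X unit_monoid unit_monoid.
Proof. by rewrite /= triangle. Qed.

Lemma unit_lact1 (X : C) : lunit X ∘ mone unit_monoid ▷ X = lunit X.
Proof. by rewrite tensm_id comp_idr. Qed.

Lemma unit_ract1 (X : C) : runit X ∘ X ◁ mone unit_monoid = runit X.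
Proof. by rewrite tensm_id comp_idr. Qed.

Lemma unit_lractl (X Y Z : C) (r : hom (X ⊗ Y) Z) :
  r ∘ lunit X ▷ Y = lunit Z ∘ munit ◁ r ∘ assoc munit X Y.
Proof. by rewrite (precomp _ (lunit_nat _)) lunit_tens. Qed.

Lemma unit_lractr (X Y Z : C) (l : hom (X ⊗ Y) Z) :
  runit Z ∘ l ▷ munit = l ∘ X ◁ runit Y ∘ assoc X Y munit.
Proof. by rewrite runit_tens runit_nat. Qed.

(* Any object is a bimodule over the unit monoid, hence tensoring with any
   object preserves the coequalizers which define balanced tensor products. *)
Definition object_bimodule (X : C) : bimodule unit_monoid unit_monoid :=
  @Bimodule C unit_monoid unit_monoid X (lunit X) (runit X)
    (unit_lactA X) (unit_lact1 X) (unit_ractA X) (unit_ract1 X)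
    (unit_lractl (runit X)).

Definition right_bimodule A B (M : bimodule A B) : bimodule unit_monoid B :=
  @Bimodule C unit_monoid B M (lunit M) (ract M)
    (unit_lactA M) (unit_lact1 M) (ractA M) (ract1 M) (unit_lractl (ract M)).

Definition left_bimodule A B (M : bimodule A B) : bimodule A unit_monoid :=
  @Bimodule C A unit_monoid M (lact M) (runit M)
    (lactA M) (lact1 M) (unit_ractA M) (unit_ract1 M) (unit_lractr (lact M)).

Lemma free_lactA A B (N : bimodule A B) (X : C) :
  (lact N ▷ X ∘ associ A N X) ∘ mmul A ▷ (N ⊗ X)
  = (lact N ▷ X ∘ associ A N X) ∘ A ◁ (lact N ▷ X ∘ associ A N X)
    ∘ assoc A A (N ⊗ X).
Proof.
have E : (lact N ▷ X ∘ associ A N X) ∘ assoc A N X = lact N ▷ X.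
  by rewrite -compA assocK comp_idr.
apply: assoc_epi; rewrite -!compA -assoc_natl.
rewrite (precompK _ (assocK _ _ _)) -rtensD lactA !rtensD.
rewrite -pentagon (compA (A ◁ _)) -ltensD E (compA (A ◁ _)) -assoc_natm -!compA.
by rewrite (precompK _ (assocK _ _ _)).
Qed.

Lemma free_lact1 A B (N : bimodule A B) (X : C) :
  (lact N ▷ X ∘ associ A N X) ∘ mone A ▷ (N ⊗ X) = lunit (N ⊗ X).
Proof.
apply: assoc_epi; rewrite lunit_tens -!compA -assoc_natl.
by rewrite (precompK _ (assocK _ _ _)) -rtensD lact1.
Qed.

Definition free_left_bimodule A B (N : bimodule A B) (X : C) :
    bimodule A unit_monoid :=
  @Bimodule C A unit_monoid (N ⊗ X) (lact N ▷ X ∘ associ A N X) (runit _)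
    (free_lactA N X) (free_lact1 N X) (unit_ractA _) (unit_ract1 _)
    (unit_lractr _).

Hypothesis hC : balanced_calculus C.

Lemma ltens_coeq (X : C) A B D (M : bimodule A B) (N : bimodule B D) Q
    (q : hom (M ⊗ N) Q) : balanced q ->
  coequalizer (X ◁ balanced_l M N) (X ◁ balanced_r M N) (X ◁ q).
Proof.
have [_ + _] := hC (object_bimodule X) (right_bimodule M) (left_bimodule N).
exact.
Qed.

Lemma rtens_coeq (X : C) A B D (M : bimodule A B) (N : bimodule B D) Q
    (q : hom (M ⊗ N) Q) : balanced q ->
  coequalizer (balanced_l M N ▷ X) (balanced_r M N ▷ X) (q ▷ X).
Proof.
have [_ _] := hC (right_bimodule M) (left_bimodule N) (object_bimodule X).
exact.
Qed.

Lemma ltens_epi (X : C) A B D (M : bimodule A B) (N : bimodule B D) Q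
    (q : hom (M ⊗ N) Q) Z (f g : hom (X ⊗ Q) Z) : balanced q ->
  f ∘ X ◁ q = g ∘ X ◁ q -> f = g.
Proof. by move=> /(ltens_coeq X) h; apply: (coeq_epi h). Qed.

Lemma rtens_epi (X : C) A B D (M : bimodule A B) (N : bimodule B D) Q
    (q : hom (M ⊗ N) Q) Z (f g : hom (Q ⊗ X) Z) : balanced q ->
  f ∘ q ▷ X = g ∘ q ▷ X -> f = g.
Proof. by move=> /(rtens_coeq X) h; apply: (coeq_epi h). Qed.

Lemma balanced_free (X : C) A B D (M : bimodule A B) (N : bimodule B D) Q
    (q : hom (M ⊗ N) Q) : balanced q ->
  @balanced C A B _ M (free_left_bimodule N X) (Q ⊗ X) (q ▷ X ∘ associ M N X).
Proof.
move=> /(rtens_coeq X); rewrite /balanced /balanced_l /balanced_r /=.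
set f := _ ▷ X; set g := _ ▷ X; set f' := ract M ▷ _; set g' := _ ∘ assoc _ _ _.
have ef : f' ∘ assoc (M ⊗ B) N X = assoc M N X ∘ f.
  by rewrite /f /f' -assoc_natl.
have eg : g' ∘ assoc (M ⊗ B) N X = assoc M N X ∘ g.
  rewrite /g /g' rtensD -!compA -pentagon (compA (M ◁ _)) -ltensD -compA assocK.
  by rewrite comp_idr !compA assoc_natm.
move: f g f' g' ef eg => f g f' g' ef eg.
move=> [e u]; split=> [|Z h eh].
  by apply: assoc_epi; rewrite -!compA ef eg !(precompK _ (assocK _ _ _)).
have eh' : (h ∘ assoc M N X) ∘ f = (h ∘ assoc M N X) ∘ g.
  by rewrite -!compA -ef -eg !compA eh.
have [k [ek uk]] := u Z _ eh'; exists k; split.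
  by apply: assoc_epi; rewrite -!compA assocK comp_idr ek.
by move=> k' ek'; apply: uk; rewrite -ek' -!compA assocK comp_idr.
Qed.

Lemma rrtens_epi (X Y : C) A B D (M : bimodule A B) (N : bimodule B D) Q
    (q : hom (M ⊗ N) Q) Z (f g : hom (Q ⊗ X ⊗ Y) Z) : balanced q ->
  f ∘ q ▷ X ▷ Y = g ∘ q ▷ X ▷ Y -> f = g.
Proof.
move=> hq e; rewrite -[f]comp_idr -[g]comp_idr -assocK (compA f) (compA g).
congr (_ ∘ _); apply: (rtens_epi hq); apply: assoc_epi; rewrite -!compA.
by rewrite -assoc_natl !(precompK _ (assocK _ _ _)).
Qed.

Lemma lrtens_epi (X Y : C) A B D (M : bimodule A B) (N : bimodule B D) Q
    (q : hom (M ⊗ N) Q) Z (f g : hom (X ⊗ Q ⊗ Y) Z) : balanced q ->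
  f ∘ (X ◁ q) ▷ Y = g ∘ (X ◁ q) ▷ Y -> f = g.
Proof.
move=> hq e; rewrite -[f]comp_idr -[g]comp_idr -assocK (compA f) (compA g).
congr (_ ∘ _); apply: (ltens_epi (balanced_free Y hq)).
rewrite ltensD !(compA _ (X ◁ (q ▷ Y))); congr (_ ∘ _).
apply: assoc_epi; rewrite -!compA -assoc_natm.
by rewrite !(precompK _ (assocK _ _ _)).
Qed.

End Preservation.

Section BalancedTensor.
Context {C : monoidal_category} (hC : balanced_calculus C).
Context (T : balanced_choice C).
Implicit Types A B D E : monoid C.

Local Notation bt M N := (btens T M N).
Local Notation pr M N := (bproj T M N).

Lemma bproj_eq A B D (M : bimodule A B) (N : bimodule B D) :
  pr M N ∘ ract M ▷ N = pr M N ∘ M ◁ lact N ∘ assoc M B N.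
Proof. exact: (bprojP T M N).1. Qed.

Lemma btens_lact_eq A B D (M : bimodule A B) (N : bimodule B D) :
  (pr M N ∘ lact M ▷ N ∘ associ A M N) ∘ A ◁ balanced_l M N
  = (pr M N ∘ lact M ▷ N ∘ associ A M N) ∘ A ◁ balanced_r M N.
Proof.
apply: assoc_epi; apply: assocr_epi; rewrite /balanced_l /balanced_r.
rewrite ltensD -!compA pentagon (precomp _ (esym (assoc_natm _ _ _))).
rewrite (precomp _ (esym (assoc_natr _ _ _))) !(precompK _ (assocK _ _ _)).
rewrite -!rtensD -lractA rtensD (precomp _ (interchange _ _)).
by rewrite -assoc_natl (precomp _ (bproj_eq _ _)) -!compA.
Qed.

Definition btens_lact A B D (M : bimodule A B) (N : bimodule B D) :
    hom (A ⊗ bt M N) (bt M N) :=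
  coeq_desc (ltens_coeq hC A (bprojP T M N)) (btens_lact_eq M N).

Lemma btens_lactE A B D (M : bimodule A B) (N : bimodule B D) :
  btens_lact M N ∘ A ◁ pr M N = pr M N ∘ lact M ▷ N ∘ associ A M N.
Proof. exact: coeq_descE. Qed.

Lemma btens_lactE' A B D (M : bimodule A B) (N : bimodule B D) :
  btens_lact M N ∘ A ◁ pr M N ∘ assoc A M N = pr M N ∘ lact M ▷ N.
Proof. by rewrite compA btens_lactE -!compA assocK comp_idr. Qed.

Lemma btens_ract_eq A B D (M : bimodule A B) (N : bimodule B D) :
  (pr M N ∘ M ◁ ract N ∘ assoc M N D) ∘ balanced_l M N ▷ D
  = (pr M N ∘ M ◁ ract N ∘ assoc M N D) ∘ balanced_r M N ▷ D.
Proof.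
rewrite /balanced_l /balanced_r rtensD -!compA assoc_natl.
rewrite -(precomp _ (interchange _ _)) (precomp _ (bproj_eq _ _)) -!compA.
rewrite (precomp _ (assoc_natr _ _ _)) -pentagon (precomp _ (assoc_natm _ _ _)).
by rewrite !ltensDp lractA !ltensD -!compA.
Qed.

Definition btens_ract A B D (M : bimodule A B) (N : bimodule B D) :
    hom (bt M N ⊗ D) (bt M N) :=
  coeq_desc (rtens_coeq hC D (bprojP T M N)) (btens_ract_eq M N).

Lemma btens_ractE A B D (M : bimodule A B) (N : bimodule B D) :
  btens_ract M N ∘ pr M N ▷ D = pr M N ∘ M ◁ ract N ∘ assoc M N D.
Proof. exact: coeq_descE. Qed.

Lemma btens_lactA A B D (M : bimodule A B) (N : bimodule B D) :
  btens_lact M N ∘ mmul A ▷ bt M N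
  = btens_lact M N ∘ A ◁ btens_lact M N ∘ assoc A A (bt M N).
Proof.
apply: (ltens_epi hC (bprojP T M N)); apply: assoc_epi; rewrite -!compA.
rewrite (precomp _ (interchange _ _)) -assoc_natl.
rewrite (precomp31 _ (btens_lactE' _ _)) -!compA -rtensD lactA !rtensD.
rewrite (precomp _ (assoc_natr _ _ _)) -pentagon.
rewrite !ltensDp -?compA btens_lactE'.
rewrite ltensD -!compA -(precomp _ (assoc_natm _ _ _)).
by rewrite (precomp31 _ (btens_lactE' _ _)) -!compA.
Qed.

Lemma btens_lact1 A B D (M : bimodule A B) (N : bimodule B D) :
  btens_lact M N ∘ mone A ▷ bt M N = lunit (bt M N).
Proof.
apply: (ltens_epi hC (bprojP T M N)); apply: assoc_epi; rewrite -!compA.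
rewrite (precomp _ (interchange _ _)) -assoc_natl.
rewrite (precomp31 _ (btens_lactE' _ _)) -!compA -rtensD lact1.
by rewrite (precomp _ (lunit_nat _)) lunit_tens.
Qed.

Lemma btens_ractA A B D (M : bimodule A B) (N : bimodule B D) :
  btens_ract M N ∘ btens_ract M N ▷ D
  = btens_ract M N ∘ bt M N ◁ mmul D ∘ assoc (bt M N) D D.
Proof.
apply: (rrtens_epi hC (bprojP T M N)); rewrite -!compA.
rewrite assoc_natl -(precomp _ (interchange _ _)).
rewrite (precomp _ (btens_ractE _ _)) -!compA -rtensD btens_ractE !rtensD.
rewrite (precomp _ (btens_ractE _ _)) -!compA.
rewrite (precomp _ (assoc_natr _ _ _)) (precomp _ (assoc_natm _ _ _)).
rewrite -pentagon !ltensDp ractA.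
by rewrite !ltensD -!compA.
Qed.

Lemma btens_ract1 A B D (M : bimodule A B) (N : bimodule B D) :
  btens_ract M N ∘ bt M N ◁ mone D = runit (bt M N).
Proof.
apply: (rtens_epi hC (bprojP T M N)); rewrite -!compA.
rewrite -interchange (precomp _ (btens_ractE _ _)) -!compA.
rewrite assoc_natr (compA (M ◁ _)) -ltensD ract1.
by rewrite runit_tens runit_nat.
Qed.

Lemma btens_lractA A B D (M : bimodule A B) (N : bimodule B D) :
  btens_ract M N ∘ btens_lact M N ▷ D
  = btens_lact M N ∘ A ◁ btens_ract M N ∘ assoc A (bt M N) D.
Proof.
apply: (lrtens_epi hC (bprojP T M N)); apply: assocr_epi; rewrite -!compA.
rewrite -!rtensD -?compA btens_lactE' !rtensD.
rewrite (precomp _ (btens_ractE _ _)) -!compA.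
rewrite (precomp _ (assoc_natm _ _ _)) ltensDp.
rewrite btens_ractE !ltensD -!compA pentagon assoc_natl.
rewrite -(precomp _ (assoc_natr _ _ _)) (precomp31 _ (btens_lactE' _ _)).
by rewrite -!compA (precomp _ (interchange _ _)).
Qed.

Definition btens_bimodule A B D (M : bimodule A B) (N : bimodule B D) :
    bimodule A D :=
  @Bimodule C A D (bt M N) (btens_lact M N) (btens_ract M N)
    (btens_lactA M N) (btens_lact1 M N) (btens_ractA M N) (btens_ract1 M N)
    (btens_lractA M N).

Local Notation "M ⊗b N" := (btens_bimodule M N)
  (at level 44, left associativity).

Lemma btens_map_eq A B D (M M' : bimodule A B) (N N' : bimodule B D)
    (f : bimodule_map M M') (g : bimodule_map N N') :
  (pr M' N' ∘ f ⊠ g) ∘ balanced_l M N = (pr M' N' ∘ f ⊠ g) ∘ balanced_r M N.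
Proof.
have e1 : f ⊠ g ∘ ract M ▷ N = ract M' ▷ N' ∘ (f ▷ B) ⊠ g.
  by rewrite -!tensm_comp bmap_ract comp_idl comp_idr.
have e2 : f ⊠ g ∘ M ◁ lact N = M' ◁ lact N' ∘ f ⊠ (B ◁ g).
  by rewrite -!tensm_comp bmap_lact comp_idl comp_idr.
rewrite /balanced_l /balanced_r -!compA e1 (precomp _ e2).
by rewrite (precomp _ (bproj_eq _ _)) -!compA assoc_nat.
Qed.

Definition btens_map A B D (M M' : bimodule A B) (N N' : bimodule B D)
    (f : bimodule_map M M') (g : bimodule_map N N') :
    hom (bt M N) (bt M' N') :=
  coeq_desc (bprojP T M N) (btens_map_eq f g).

Lemma btens_mapE A B D (M M' : bimodule A B) (N N' : bimodule B D)
    (f : bimodule_map M M') (g : bimodule_map N N') :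
  btens_map f g ∘ pr M N = pr M' N' ∘ f ⊠ g.
Proof. exact: coeq_descE. Qed.

Lemma bproj_epi A B D (M : bimodule A B) (N : bimodule B D) Z
    (f g : hom (bt M N) Z) :
  f ∘ pr M N = g ∘ pr M N -> f = g.
Proof. exact: (coeq_epi (bprojP T M N)). Qed.

Section Associator.
Context A B D E (M : bimodule A B) (N : bimodule B D) (P : bimodule D E).

Lemma btens_assoc_eq1 :
  (pr M (N ⊗b P) ∘ M ◁ pr N P ∘ assoc M N P) ∘ balanced_l M N ▷ P
  = (pr M (N ⊗b P) ∘ M ◁ pr N P ∘ assoc M N P) ∘ balanced_r M N ▷ P.
Proof.
rewrite /balanced_l /balanced_r rtensD -!compA assoc_natl.
rewrite -(precomp _ (interchange _ _)) (precomp _ (bproj_eq _ _)) -!compA.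
rewrite (precomp _ (assoc_natr _ _ _)) -pentagon (precomp _ (assoc_natm _ _ _)).
rewrite !ltensDp -?compA.
by rewrite btens_lactE'.
Qed.

Definition btens_assoc1 : hom (bt M N ⊗ P) (bt M (N ⊗b P)) :=
  coeq_desc (rtens_coeq hC P (bprojP T M N)) btens_assoc_eq1.

Lemma btens_assoc1E :
  btens_assoc1 ∘ pr M N ▷ P = pr M (N ⊗b P) ∘ M ◁ pr N P ∘ assoc M N P.
Proof. exact: coeq_descE. Qed.

Lemma btens_assoc_eq :
  btens_assoc1 ∘ balanced_l (M ⊗b N) P = btens_assoc1 ∘ balanced_r (M ⊗b N) P.
Proof.
rewrite /balanced_l /balanced_r.
apply: (rrtens_epi hC (bprojP T M N)); rewrite -!compA.
rewrite assoc_natl -(precomp _ (interchange _ _)).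
rewrite (precomp _ btens_assoc1E) -!compA -rtensD btens_ractE !rtensD.
rewrite (precomp _ btens_assoc1E) -!compA.
rewrite (precomp _ (assoc_natr _ _ _)) (precomp _ (assoc_natm _ _ _)).
rewrite -pentagon !ltensDp bproj_eq.
by rewrite !ltensD -!compA.
Qed.

Definition btens_assoc : hom (bt (M ⊗b N) P) (bt M (N ⊗b P)) :=
  coeq_desc (bprojP T (M ⊗b N) P) btens_assoc_eq.

Lemma btens_assocE :
  btens_assoc ∘ pr (M ⊗b N) P ∘ pr M N ▷ P
  = pr M (N ⊗b P) ∘ M ◁ pr N P ∘ assoc M N P.
Proof. by rewrite compA coeq_descE btens_assoc1E. Qed.

Lemma bproj2_epi Z (f g : hom (bt (M ⊗b N) P) Z) :
  f ∘ pr (M ⊗b N) P ∘ pr M N ▷ P = g ∘ pr (M ⊗b N) P ∘ pr M N ▷ P -> f = g.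
Proof.
move=> e; apply: bproj_epi; apply: (rtens_epi hC (bprojP T M N)).
by rewrite -!compA.
Qed.

End Associator.

Lemma unitor_l_eq A B (M : bimodule A B) :
  lact M ∘ balanced_l (monoid_bimodule A) M
  = lact M ∘ balanced_r (monoid_bimodule A) M.
Proof. exact: lactA. Qed.

Definition unitor_l_hom A B (M : bimodule A B) :
    hom (bt (monoid_bimodule A) M) M :=
  coeq_desc (bprojP T (monoid_bimodule A) M) (unitor_l_eq M).

Lemma unitor_l_homE A B (M : bimodule A B) :
  unitor_l_hom M ∘ pr (monoid_bimodule A) M = lact M.
Proof. exact: coeq_descE. Qed.

Lemma unitor_l_lact A B (M : bimodule A B) :
  unitor_l_hom M ∘ lact (monoid_bimodule A ⊗b M)
  = lact M ∘ A ◁ unitor_l_hom M.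
Proof.
apply: (ltens_epi hC (bprojP T (monoid_bimodule A) M)); apply: assoc_epi.
rewrite -!compA /= (btens_lactE' (monoid_bimodule A) M) (precomp1 _ (unitor_l_homE M)).
by rewrite (compA (A ◁ _)) -ltensD unitor_l_homE lactA.
Qed.

Lemma unitor_l_ract A B (M : bimodule A B) :
  unitor_l_hom M ∘ ract (monoid_bimodule A ⊗b M)
  = ract M ∘ unitor_l_hom M ▷ B.
Proof.
apply: (rtens_epi hC (bprojP T (monoid_bimodule A) M)).
rewrite -!compA /= (btens_ractE (monoid_bimodule A) M) (precomp1 _ (unitor_l_homE M)).
by rewrite -rtensD unitor_l_homE lractA.
Qed.

Definition unitor_l A B (M : bimodule A B) :
    bimodule_map (monoid_bimodule A ⊗b M) M :=
  BimoduleMap (unitor_l_lact M) (unitor_l_ract M).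

Lemma unitor_r_eq A B (M : bimodule A B) :
  ract M ∘ balanced_l M (monoid_bimodule B)
  = ract M ∘ balanced_r M (monoid_bimodule B).
Proof. exact: ractA. Qed.

Definition unitor_r_hom A B (M : bimodule A B) :
    hom (bt M (monoid_bimodule B)) M :=
  coeq_desc (bprojP T M (monoid_bimodule B)) (unitor_r_eq M).

Lemma unitor_r_homE A B (M : bimodule A B) :
  unitor_r_hom M ∘ pr M (monoid_bimodule B) = ract M.
Proof. exact: coeq_descE. Qed.

Lemma unitor_r_lact A B (M : bimodule A B) :
  unitor_r_hom M ∘ lact (M ⊗b monoid_bimodule B)
  = lact M ∘ A ◁ unitor_r_hom M.
Proof.
apply: (ltens_epi hC (bprojP T M (monoid_bimodule B))); apply: assoc_epi.
rewrite -!compA /= (btens_lactE' M (monoid_bimodule B)) (precomp1 _ (unitor_r_homE M)).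
by rewrite (compA (A ◁ _)) -ltensD unitor_r_homE lractA.
Qed.

Lemma unitor_r_ract A B (M : bimodule A B) :
  unitor_r_hom M ∘ ract (M ⊗b monoid_bimodule B)
  = ract M ∘ unitor_r_hom M ▷ B.
Proof.
apply: (rtens_epi hC (bprojP T M (monoid_bimodule B))).
rewrite -!compA /= (btens_ractE M (monoid_bimodule B)) (precomp1 _ (unitor_r_homE M)).
by rewrite -rtensD unitor_r_homE ractA.
Qed.

Definition unitor_r A B (M : bimodule A B) :
    bimodule_map (M ⊗b monoid_bimodule B) M :=
  BimoduleMap (unitor_r_lact M) (unitor_r_ract M).

Lemma unitor_l_bproj A B (M : bimodule A B) :
  unitor_l M ∘ pr (monoid_bimodule A) M = lact M.
Proof. exact: unitor_l_homE. Qed.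

Lemma unitor_r_bproj A B (M : bimodule A B) :
  unitor_r M ∘ pr M (monoid_bimodule B) = ract M.
Proof. exact: unitor_r_homE. Qed.

Lemma bimodule_isoP A B (M N : bimodule A B) (f : bimodule_map M N)
    (g : hom N M) :
  g ∘ f = idm M -> f ∘ g = idm N -> bimodule_iso f.
Proof.
move=> gf fg.
have gl : g ∘ lact N = lact M ∘ A ◁ g.
  rewrite -[LHS]comp_idr -tensm_id -fg ltensD -!compA.
  by rewrite -(precomp _ (bmap_lact f)) (precompK _ gf).
have gr : g ∘ ract N = ract M ∘ g ▷ B.
  rewrite -[LHS]comp_idr -tensm_id -fg rtensD -!compA.
  by rewrite -(precomp _ (bmap_ract f)) (precompK _ gf).
by exists (BimoduleMap gl gr).
Qed.

Lemma unitor_l_iso A B (M : bimodule A B) : bimodule_iso (unitor_l M).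
Proof.
have E : pr (monoid_bimodule A) M ∘ A ◁ lact M ∘ mone A ▷ (A ⊗ M)
    = pr (monoid_bimodule A) M ∘ lunit (A ⊗ M).
  apply: assoc_epi; rewrite -!compA -assoc_natl.
  rewrite (precomp3 _ (esym (bproj_eq (monoid_bimodule A) M))) -rtensD.
  by rewrite mmul1l lunit_tens.
have N : luniti M ∘ lact M = munit ◁ lact M ∘ luniti (A ⊗ M).
  rewrite -[RHS]comp_idl -(lunitK M) -!compA (precomp _ (lunit_nat _)).
  by rewrite lunitiK comp_idr.
apply: (@bimodule_isoP _ _ _ _ (unitor_l M)
  (pr (monoid_bimodule A) M ∘ mone A ▷ M ∘ luniti M)).
  apply: bproj_epi; rewrite -!compA unitor_l_bproj comp_idl N.
  by rewrite (precomp _ (interchange _ _)) (precomp3 _ E) lunitiK comp_idr.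
by rewrite (precomp1 _ (unitor_l_bproj M)) (precomp1 _ (lact1 M)) lunitiK.
Qed.

Lemma unitor_r_iso A B (M : bimodule A B) : bimodule_iso (unitor_r M).
Proof.
have E : pr M (monoid_bimodule B) ∘ ract M ▷ B ∘ (M ⊗ B) ◁ mone B
    = pr M (monoid_bimodule B) ∘ runit (M ⊗ B).
  rewrite (precomp _ (bproj_eq M (monoid_bimodule B))) -!compA assoc_natr.
  by rewrite ltensDp mmul1r runit_tens.
have N : runiti M ∘ ract M = ract M ▷ munit ∘ runiti (M ⊗ B).
  rewrite -[RHS]comp_idl -(runitK M) -!compA (precomp _ (runit_nat _)).
  by rewrite runitiK comp_idr.
apply: (@bimodule_isoP _ _ _ _ (unitor_r M)
  (pr M (monoid_bimodule B) ∘ M ◁ mone B ∘ runiti M)).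
  apply: bproj_epi; rewrite -!compA unitor_r_bproj comp_idl N.
  by rewrite -(precomp _ (interchange _ _)) (precomp3 _ E) runitiK comp_idr.
by rewrite (precomp1 _ (unitor_r_bproj M)) (precomp1 _ (ract1 M)) runitiK.
Qed.

Definition equivalence A B (M : bimodule A B) : Prop :=
  exists M' : bimodule B A,
    bimodule_isomorphic (M ⊗b M') (monoid_bimodule A) /\
    bimodule_isomorphic (M' ⊗b M) (monoid_bimodule B).

Lemma monoid_equivalence A : equivalence (monoid_bimodule A).
Proof.
exists (monoid_bimodule A); split.
  by exists (unitor_l (monoid_bimodule A)); apply: unitor_l_iso.
by exists (unitor_l (monoid_bimodule A)); apply: unitor_l_iso.
Qed.

Definition compatible A0 A1 A2 A3 (M01 : bimodule A0 A1) (M02 : bimodule A0 A2)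
    (M03 : bimodule A0 A3) (M12 : bimodule A1 A2) (M13 : bimodule A1 A3)
    (M23 : bimodule A2 A3)
    (f012 : bimodule_map (M01 ⊗b M12) M02) (f023 : bimodule_map (M02 ⊗b M23) M03)
    (f013 : bimodule_map (M01 ⊗b M13) M03) (f123 : bimodule_map (M12 ⊗b M23) M13)
    : Prop :=
  f023 ∘ btens_map f012 (bimodule_id M23)
  = f013 ∘ btens_map (bimodule_id M01) f123 ∘ btens_assoc M01 M12 M23.

Section Compatibility.
Context A0 A1 A2 (M01 : bimodule A0 A1) (M12 : bimodule A1 A2)
  (M02 : bimodule A0 A2) (f : bimodule_map (M01 ⊗b M12) M02).

Lemma compatible0 :
  compatible (unitor_l M01) f (unitor_l M02) f.
Proof.
apply: bproj2_epi; rewrite -!compA.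
rewrite (precomp _ (btens_mapE _ _)) btens_assocE /=.
rewrite (precomp _ (btens_mapE _ _)) (precomp1 _ (unitor_l_bproj _)).
rewrite -rtensD unitor_l_bproj.
rewrite (precomp _ (esym (bmap_lact f))) /=.
by rewrite (btens_lactE' M01 M12).
Qed.

Lemma compatible1 :
  compatible (unitor_r M01) f f (unitor_l M12).
Proof.
apply: bproj2_epi; rewrite -!compA.
rewrite (precomp _ (btens_mapE _ _)) btens_assocE /=.
rewrite (precomp _ (btens_mapE _ _)) ltensDp -rtensD.
by rewrite unitor_l_bproj unitor_r_bproj bproj_eq.
Qed.

Lemma compatible2 :
  compatible f (unitor_r M02) f (unitor_r M12).
Proof.
apply: bproj2_epi; rewrite -!compA.
rewrite (precomp _ (btens_mapE _ _)) btens_assocE /=.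
rewrite (precomp _ (btens_mapE _ _)) (precomp1 _ (unitor_r_bproj _)).
rewrite ltensDp unitor_r_bproj.
rewrite (precomp _ (esym (bmap_ract f))) /=.
by rewrite (btens_ractE M01 M12).
Qed.

End Compatibility.

End BalancedTensor.

Record ordmap (N M : nat) := Ordmap {
  ordfun :> 'I_N -> 'I_M;
  ordfun_homo : forall i j : 'I_N, i <= j -> ordfun i <= ordfun j }.

Lemma ordmap_eq N M (f g : ordmap N M) : (forall i, f i = g i) -> f = g.
Proof.
case: f g => [f fh] [g gh] /= /funext e; rewrite -{}e in gh *.
by rewrite (Prop_irrelevance fh gh).
Qed.

Definition ordmap_id N : ordmap N N := @Ordmap N N id (fun _ _ h => h).

Definition ordmap_comp N M K (g : ordmap M K) (f : ordmap N M) : ordmap N K :=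
  @Ordmap N K (fun i => g (f i))
    (fun i j h => ordfun_homo g (ordfun_homo f h)).

Lemma coface_homo n (i : 'I_n.+2) (j k : 'I_n.+1) :
  j <= k -> lift i j <= lift i k.
Proof. by rewrite /= leq_bump2. Qed.

Definition coface n (i : 'I_n.+2) : ordmap n.+1 n.+2 :=
  Ordmap (@coface_homo n i).

Lemma codegen_subproof n (i : 'I_n.+1) (j : 'I_n.+2) : unbump i j < n.+1.
Proof.
rewrite /unbump; case: (ltnP i j) => /= h; last by rewrite subn0 (leq_ltn_trans h).
by case: j h => -[|j] //= hj _; rewrite subn1.
Qed.

Lemma codegen_homo n (i : 'I_n.+1) (j k : 'I_n.+2) :
  j <= k -> Ordinal (codegen_subproof i j) <= Ordinal (codegen_subproof i k).
Proof.
rewrite /= /unbump => jk; case: (ltnP i k) => /= ik; last first.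
  by rewrite ltnNge (leq_trans jk ik) !subn0.
case: (ltnP i j) => /= ij; first exact: leq_sub2r.
by rewrite subn0 subn1 -ltnS (leq_ltn_trans ij) // prednK // (leq_ltn_trans _ ik).
Qed.

Definition codegen n (i : 'I_n.+1) : ordmap n.+2 n.+1 :=
  Ordmap (@codegen_homo n i).

(* [sobj X n] is the set of n-simplices; the ordinal [n] is ['I_n.+1]. *)
Record sset := Sset {
  sobj :> nat -> Type;
  sact : forall m n, ordmap m.+1 n.+1 -> sobj n -> sobj m;
  sact_id : forall n (x : sobj n), sact (ordmap_id n.+1) x = x;
  sact_comp : forall m n p (g : ordmap n.+1 p.+1) (f : ordmap m.+1 n.+1)
    (x : sobj p), sact (ordmap_comp g f) x = sact f (sact g x) }.

Arguments sact {s m n} f x.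

Definition degenerate (X : sset) n (x : X n.+1) : Prop :=
  exists (i : 'I_n.+1) (y : X n), x = sact (codegen i) y.

Record smap (X Y : sset) := Smap {
  sfun :> forall n, X n -> Y n;
  sfun_nat : forall m n (f : ordmap m.+1 n.+1) (x : X n),
    sfun (sact f x) = sact f (sfun x) }.

(* The marking is indexed by the dimension minus one: only simplices of
   positive dimension can be marked. *)
Record marked_sset := MarkedSset {
  msset :> sset;
  marked : forall n, msset n.+1 -> Prop;
  marked_degenerate : forall n (x : msset n.+1), degenerate x -> marked x }.

Record mmap (X Y : marked_sset) := Mmap {
  mfun :> smap X Y;
  mfun_marked : forall n (x : X n.+1), marked x -> marked (mfun n.+1 x) }.

Definition right_lifting (A B : marked_sset) (i : mmap A B) (X : marked_sset)
    : Prop :=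
  forall f : mmap A X, exists g : mmap B X,
    forall n (a : A n), g n (i n a) = f n a.

(* The standard simplex on N vertices: Δ[m] is [simplex m.+1], and
   Δ[-1] = ∅ is [simplex 0]. *)
Definition simplex (N : nat) : sset.
Proof.
exists (fun n => ordmap n.+1 N) (fun m n f x => ordmap_comp x f).
- by move=> n x; apply: ordmap_eq.
- by move=> m n p g f x; apply: ordmap_eq.
Defined.

Definition marking (X : sset) := forall n, X n.+1 -> Prop.

(* A marking lists the marked simplices up to degenerate ones, which [mark]
   adds. *)
Definition mark (X : sset) (E : marking X) : marked_sset :=
  @MarkedSset X (fun n x => degenerate x \/ E n x)
    (fun n x d => or_introl d).

Definition submarking (X : sset) (E F : marking X) : Prop :=
  forall n (x : X n.+1), E n x -> F n x.

Lemma mark_sub (X : sset) (E F : marking X) n (x : X n.+1) :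
  submarking E F -> @marked (mark E) n x -> @marked (mark F) n x.
Proof. by move=> EF [d|e]; [left|right; apply: EF]. Qed.

Definition entire_map (X : sset) (E F : marking X) (EF : submarking E F) :
    mmap (mark E) (mark F) :=
  @Mmap (mark E) (mark F) (@Smap X X (fun n x => x) (fun _ _ _ _ => erefl))
    (fun n x => mark_sub EF).

Definition subsset_closed (X : sset) (P : forall n, X n -> Prop) : Prop :=
  forall m n (f : ordmap m.+1 n.+1) (x : X n), P n x -> P m (sact f x).

Section SubSset.
Context (X : marked_sset) (P : forall n, X n -> Prop) (hP : subsset_closed P).

Definition subsset : sset.
Proof.
exists (fun n => {x : X n | @P n x})
  (fun m n f x => exist (@P m) (sact f (sval x)) (hP f (svalP x))).
- by move=> n [x Px]; apply: eq_exist; rewrite /= sact_id.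
- by move=> m n p g f [x Px]; apply: eq_exist; rewrite /= sact_comp.
Defined.

Definition submarked : marked_sset.
Proof.
exists subsset (fun n x => @marked X n (sval x)).
move=> n x [i [y ->]]; apply: marked_degenerate.
by exists i, (sval y).
Defined.

Definition subsset_incl : mmap submarked X.
Proof.
by exists (@Smap submarked X (fun n x => sval x) (fun _ _ _ _ => erefl)).
Defined.
End SubSset.

(* [x] is the j-th face of Δ[m]; the equation n + 1 = m stands for the
   dimension, to avoid a cast between ordinals. *)
Definition is_face m (j : nat) n (x : ordmap n.+1 m.+1) : Prop :=
  n.+1 = m /\ forall i, x i = bump j i :> nat.

Definition Delta_k_marking (k m : nat) : marking (simplex m.+1) :=
  fun n x => forall v : 'I_m.+1, k <= v.+1 -> v <= k.+1 -> exists i, x i = v.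

Definition Delta_k'_marking (k m : nat) : marking (simplex m.+1) :=
  fun n x => Delta_k_marking k x \/
    exists j : 'I_m.+1, (j.+1 = k \/ j = k.+1 :> nat) /\ is_face j x.

Definition Delta_k''_marking (k m : nat) : marking (simplex m.+1) :=
  fun n x => Delta_k'_marking k x \/
    exists j : 'I_m.+1, j = k :> nat /\ is_face j x.

Arguments Delta_k_marking k m [n] x.
Arguments Delta_k'_marking k m [n] x.
Arguments Delta_k''_marking k m [n] x.

Lemma Delta_k'_sub k m :
  submarking (Delta_k'_marking k m) (Delta_k''_marking k m).
Proof. by move=> n x; left. Qed.

Arguments Delta_k'_sub k m [n x] _.

(* The k-th horn consists of the simplices which miss a vertex other than k. *)
Definition in_horn (k m : nat) n (x : mark (Delta_k_marking k m) n) : Prop :=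
  exists j : 'I_m.+1, j <> k :> nat /\ forall i, (x : ordmap _ _) i <> j.

Lemma in_horn_closed k m : subsset_closed (@in_horn k m).
Proof.
by move=> p n f x [j [jk hj]]; exists j; split=> // i; apply: hj.
Qed.

Definition horn_incl (k m : nat) :
    mmap (submarked (@in_horn_closed k m)) (mark (Delta_k_marking k m)) :=
  subsset_incl (@in_horn_closed k m).

Definition empty_marking (X : sset) : marking X := fun _ _ => False.

Definition full_marking (X : sset) : marking X := fun _ _ => True.

Arguments empty_marking X [n] x.
Arguments full_marking X [n] x.

Definition Delta_t_marking (m : nat) : marking (simplex m.+1) :=
  fun n x => n.+1 = m /\ forall i, x i = i :> nat.

Arguments Delta_t_marking m [n] x.

Lemma Delta_t_sub m : submarking (empty_marking (simplex m.+1)) (Delta_t_marking m).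
Proof. by []. Qed.

Arguments Delta_t_sub m [n x] _.

(* n + 1 is the dimension of [x]. *)
Definition Delta3_eq_marking : marking (simplex 4) :=
  fun n x => [\/ 0 < n,
                 x ord0 = 0 :> nat /\ x ord_max = 2 :> nat
               | x ord0 = 1 :> nat /\ x ord_max = 3 :> nat].

(* [x] is the join of the simplex [y] of Δ[N-1] with the simplex [z] of
   Δ[M-1], where [y] has p vertices and [z] has q vertices; [y] or [z] may be
   empty. *)
Definition is_join N M p q n (y : ordmap p N) (z : ordmap q M)
    (x : ordmap n (N + M)) : Prop :=
  [/\ (p + q = n)%N,
      forall (i : 'I_p) (k : 'I_n), k = i :> nat -> x k = y i :> nat
    & forall (j : 'I_q) (k : 'I_n), k = p + j :> nat -> x k = N + z j :> nat].

Definition marked_face N (E : marking (simplex N)) p (y : ordmap p N) : Prop :=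
  match p return ordmap p N -> Prop with
  | n.+2 => fun y => @marked (mark E) n y
  | _ => fun _ => False
  end y.

(* The marking of the join of (Δ[N-1], E) with Δ[M-1]. *)
Definition join_marking N (E : marking (simplex N)) (M : nat) :
    marking (simplex (N + M)) :=
  fun n x => exists (p q : nat) (y : ordmap p N) (z : ordmap q M),
    is_join y z x /\
    (marked_face E y \/ marked_face (empty_marking (simplex M)) z).

Arguments join_marking {N} E M [n] x.

Lemma marked_face_sub N (E F : marking (simplex N)) p (y : ordmap p N) :
  submarking E F -> marked_face E y -> marked_face F y.
Proof.
by case: p y => [|[|n]] //= y EF [d|e]; [left|right; apply: EF].
Qed.

Lemma join_marking_sub N (E F : marking (simplex N)) (M : nat) :
  submarking E F -> submarking (join_marking E M) (join_marking F M).
Proof.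
move=> EF n x [p [q [y [z [yzx h]]]]]; exists p, q, y, z; split=> //.
by case: h => [h|h]; [left; apply: marked_face_sub h|right].
Qed.

Arguments join_marking_sub {N E F} M EF [n x] _.

Lemma Delta3_eq_full_sub : submarking Delta3_eq_marking (full_marking (simplex 4)).
Proof. by []. Qed.

Definition two_complicial (X : marked_sset) : Prop :=
  [/\ forall k m, 1 < m -> 0 < k < m -> right_lifting (horn_incl k m) X,
      forall k m, 2 <= m -> 0 < k < m ->
        right_lifting (entire_map (Delta_k'_sub k m)) X,
      forall m, 2 < m -> right_lifting (entire_map (Delta_t_sub m)) X
    & (* l = m + 1 ranges over the number of vertices of Δ[m], m >= -1 *)
      forall l,
        right_lifting (entire_map (join_marking_sub l Delta3_eq_full_sub)) X].

(* Faces and degeneracies of a 3-truncated simplicial set, subject to the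
   simplicial identities. *)
Record trunc3 := Trunc3 {
  tr0 : Type; tr1 : Type; tr2 : Type; tr3 : Type;
  face1 : 'I_2 -> tr1 -> tr0;
  face2 : 'I_3 -> tr2 -> tr1;
  face3 : 'I_4 -> tr3 -> tr2;
  degen0 : 'I_1 -> tr0 -> tr1;
  degen1 : 'I_2 -> tr1 -> tr2;
  degen2 : 'I_3 -> tr2 -> tr3;
  face_face2 : forall (i : 'I_2) (j : 'I_3) x, i < j ->
    face1 i (face2 j x) = face1 (inord j.-1) (face2 (inord i) x);
  face_face3 : forall (i : 'I_3) (j : 'I_4) x, i < j ->
    face2 i (face3 j x) = face2 (inord j.-1) (face3 (inord i) x);
  face_degen0 : forall (i : 'I_2) (j : 'I_1) x, face1 i (degen0 j x) = x;
  face_degen1_lt : forall (i : 'I_3) (j : 'I_2) x, i < j ->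
    face2 i (degen1 j x) = degen0 (inord j.-1) (face1 (inord i) x);
  face_degen1_eq : forall (i : 'I_3) (j : 'I_2) x, j <= i <= j.+1 ->
    face2 i (degen1 j x) = x;
  face_degen1_gt : forall (i : 'I_3) (j : 'I_2) x, j.+1 < i ->
    face2 i (degen1 j x) = degen0 (inord j) (face1 (inord i.-1) x);
  face_degen2_lt : forall (i : 'I_4) (j : 'I_3) x, i < j ->
    face3 i (degen2 j x) = degen1 (inord j.-1) (face2 (inord i) x);
  face_degen2_eq : forall (i : 'I_4) (j : 'I_3) x, j <= i <= j.+1 ->
    face3 i (degen2 j x) = x;
  face_degen2_gt : forall (i : 'I_4) (j : 'I_3) x, j.+1 < i ->
    face3 i (degen2 j x) = degen1 (inord j) (face2 (inord i.-1) x);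
  degen_degen0 : forall (i j : 'I_1) x, i <= j ->
    degen1 (inord i) (degen0 j x) = degen1 (inord j.+1) (degen0 i x);
  degen_degen1 : forall (i j : 'I_2) x, i <= j ->
    degen2 (inord i) (degen1 j x) = degen2 (inord j.+1) (degen1 i x) }.

(* An m-simplex of the 3-coskeleton of [T] is a map to [T] from the
   3-truncation of Δ[m]. *)
Record cosk_simplex (T : trunc3) (m : nat) := CoskSimplex {
  cosk0 : ordmap 1 m.+1 -> tr0 T;
  cosk1 : ordmap 2 m.+1 -> tr1 T;
  cosk2 : ordmap 3 m.+1 -> tr2 T;
  cosk3 : ordmap 4 m.+1 -> tr3 T;
  cosk_face1 : forall (i : 'I_2) f,
    face1 i (cosk1 f) = cosk0 (ordmap_comp f (coface i));
  cosk_face2 : forall (i : 'I_3) f,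
    face2 i (cosk2 f) = cosk1 (ordmap_comp f (coface i));
  cosk_face3 : forall (i : 'I_4) f,
    face3 i (cosk3 f) = cosk2 (ordmap_comp f (coface i));
  cosk_degen0 : forall (i : 'I_1) f,
    degen0 i (cosk0 f) = cosk1 (ordmap_comp f (codegen i));
  cosk_degen1 : forall (i : 'I_2) f,
    degen1 i (cosk1 f) = cosk2 (ordmap_comp f (codegen i));
  cosk_degen2 : forall (i : 'I_3) f,
    degen2 i (cosk2 f) = cosk3 (ordmap_comp f (codegen i)) }.

Lemma cosk_simplex_eq (T : trunc3) m (x y : cosk_simplex T m) :
  cosk0 x =1 cosk0 y -> cosk1 x =1 cosk1 y -> cosk2 x =1 cosk2 y ->
  cosk3 x =1 cosk3 y -> x = y.
Proof.
case: x y => [x0 x1 x2 x3 a1 a2 a3 b0 b1 b2] [y0 y1 y2 y3 c1 c2 c3 d0 d1 d2] /=.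
move=> /funext e0 /funext e1 /funext e2 /funext e3; subst.
by f_equal; apply: Prop_irrelevance.
Qed.

Section Coskeleton.
Context (T : trunc3).

Definition cosk_act m n (f : ordmap m.+1 n.+1) (x : cosk_simplex T n) :
    cosk_simplex T m.
Proof.
refine (@CoskSimplex T m
  (fun g => cosk0 x (ordmap_comp f g)) (fun g => cosk1 x (ordmap_comp f g))
  (fun g => cosk2 x (ordmap_comp f g)) (fun g => cosk3 x (ordmap_comp f g))
  _ _ _ _ _ _) => i g.
- exact: cosk_face1.
- exact: cosk_face2.
- exact: cosk_face3.
- exact: cosk_degen0.
- exact: cosk_degen1.
- exact: cosk_degen2.
Defined.

Definition cosk : sset.
Proof.
exists (cosk_simplex T) cosk_act.
- by move=> n x; apply: cosk_simplex_eq => g /=; congr (_ x _); apply: ordmap_eq.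
- by move=> m n p g f x; apply: cosk_simplex_eq.
Defined.
End Coskeleton.

Section Nerve.
Context {C : monoidal_category} (hC : balanced_calculus C).
Context (T : balanced_choice C).

Local Notation "M ⊗b N" := (btens_bimodule hC T M N)
  (at level 44, left associativity).

Record nerve1 := Nerve1 {
  n1A0 : monoid C; n1A1 : monoid C;
  n1M01 : bimodule n1A0 n1A1 }.

Record nerve2 := Nerve2 {
  n2A0 : monoid C; n2A1 : monoid C; n2A2 : monoid C;
  n2M01 : bimodule n2A0 n2A1;
  n2M02 : bimodule n2A0 n2A2;
  n2M12 : bimodule n2A1 n2A2;
  n2f012 : bimodule_map (n2M01 ⊗b n2M12) n2M02 }.

Record nerve3 := Nerve3 {
  n3A0 : monoid C; n3A1 : monoid C; n3A2 : monoid C; n3A3 : monoid C;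
  n3M01 : bimodule n3A0 n3A1;
  n3M02 : bimodule n3A0 n3A2;
  n3M03 : bimodule n3A0 n3A3;
  n3M12 : bimodule n3A1 n3A2;
  n3M13 : bimodule n3A1 n3A3;
  n3M23 : bimodule n3A2 n3A3;
  n3f012 : bimodule_map (n3M01 ⊗b n3M12) n3M02;
  n3f013 : bimodule_map (n3M01 ⊗b n3M13) n3M03;
  n3f023 : bimodule_map (n3M02 ⊗b n3M23) n3M03;
  n3f123 : bimodule_map (n3M12 ⊗b n3M23) n3M13;
  n3P : compatible n3f012 n3f023 n3f013 n3f123 }.

Definition nerve_face1 (i : 'I_2) (x : nerve1) : monoid C :=
  match nat_of_ord i with
  | 0 => n1A1 x
  | _ => n1A0 x
  end.

Definition nerve_face2 (i : 'I_3) (x : nerve2) : nerve1 :=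
  match nat_of_ord i with
  | 0 => Nerve1 (n2M12 x)
  | 1 => Nerve1 (n2M02 x)
  | _ => Nerve1 (n2M01 x)
  end.

Definition nerve_face3 (i : 'I_4) (x : nerve3) : nerve2 :=
  match nat_of_ord i with
  | 0 => Nerve2 (n3f123 x)
  | 1 => Nerve2 (n3f023 x)
  | 2 => Nerve2 (n3f013 x)
  | _ => Nerve2 (n3f012 x)
  end.

Definition nerve_degen0 (i : 'I_1) (A : monoid C) : nerve1 :=
  Nerve1 (monoid_bimodule A).

Definition nerve_degen1 (i : 'I_2) (x : nerve1) : nerve2 :=
  match nat_of_ord i with
  | 0 => Nerve2 (unitor_l hC T (n1M01 x))
  | _ => Nerve2 (unitor_r hC T (n1M01 x))
  end.

Definition nerve_degen2 (i : 'I_3) (x : nerve2) : nerve3 :=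
  match nat_of_ord i with
  | 0 => Nerve3 (compatible0 (n2f012 x))
  | 1 => Nerve3 (compatible1 (n2f012 x))
  | _ => Nerve3 (compatible2 (n2f012 x))
  end.

Lemma unitor_monoid (A : monoid C) :
  unitor_l hC T (monoid_bimodule A) = unitor_r hC T (monoid_bimodule A).
Proof.
by apply: bimodule_map_eq; apply: bproj_epi; rewrite unitor_l_bproj unitor_r_bproj.
Qed.

Lemma nerve3_eq A0 A1 A2 A3 (M01 : bimodule A0 A1) (M02 : bimodule A0 A2)
    (M03 : bimodule A0 A3) (M12 : bimodule A1 A2) (M13 : bimodule A1 A3)
    (M23 : bimodule A2 A3)
    (f012 g012 : bimodule_map (M01 ⊗b M12) M02)
    (f013 g013 : bimodule_map (M01 ⊗b M13) M03)
    (f023 g023 : bimodule_map (M02 ⊗b M23) M03)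
    (f123 g123 : bimodule_map (M12 ⊗b M23) M13)
    (fP : compatible f012 f023 f013 f123) (gP : compatible g012 g023 g013 g123) :
  f012 = g012 -> f013 = g013 -> f023 = g023 -> f123 = g123 ->
  Nerve3 fP = Nerve3 gP.
Proof.
by move=> e1 e2 e3 e4; subst; rewrite (Prop_irrelevance fP gP).
Qed.

Definition nerve_trunc : trunc3.
Proof.
refine (@Trunc3 (monoid C) nerve1 nerve2 nerve3 nerve_face1 nerve_face2
  nerve_face3 nerve_degen0 nerve_degen1 nerve_degen2 _ _ _ _ _ _ _ _ _ _ _).
- rewrite /nerve_face1 /nerve_face2.
  by case=> [[|[|i]] //= hi] [[|[|[|j]]] //= hj] x _; rewrite !inordK.
- rewrite /nerve_face2 /nerve_face3.
  by case=> [[|[|[|i]]] //= hi] [[|[|[|[|j]]]] //= hj] x _; rewrite !inordK.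
- by rewrite /nerve_face1; case=> [[|i] hi].
- rewrite /nerve_face1 /nerve_face2 /nerve_degen1.
  by case=> [[|[|i]] //= hi] [[|[|j]] //= hj] x _; rewrite !inordK.
- rewrite /nerve_face2 /nerve_degen1.
  by case=> [[|[|[|i]]] //= hi] [[|[|j]] //= hj] [A0 A1 M] //=.
- rewrite /nerve_face1 /nerve_face2 /nerve_degen1.
  by case=> [[|[|[|i]]] //= hi] [[|[|j]] //= hj] x _; rewrite !inordK.
- rewrite /nerve_face2 /nerve_face3 /nerve_degen2 /nerve_degen1.
  by case=> [[|[|[|i]]] //= hi] [[|[|[|j]]] //= hj] x _; rewrite !inordK.
- rewrite /nerve_face3 /nerve_degen2.
  by case=> [[|[|[|[|i]]]] //= hi] [[|[|[|j]]] //= hj] [A0 A1 A2 M N P f] //=.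
- rewrite /nerve_face2 /nerve_face3 /nerve_degen2 /nerve_degen1.
  by case=> [[|[|[|[|i]]]] //= hi] [[|[|[|j]]] //= hj] x _; rewrite !inordK.
- rewrite /nerve_degen1 /nerve_degen0 => i j x _.
  by rewrite (ord1 i) (ord1 j) !inordK //= unitor_monoid.
- rewrite /nerve_degen2 /nerve_degen1.
  case=> [[|[|i]] //= hi] [[|[|j]] //= hj] x _; rewrite !inordK //=;
    by apply: nerve3_eq; rewrite ?unitor_monoid.
Defined.

Definition monoidal_nerve : sset := cosk nerve_trunc.

Definition nerve_marked n (x : monoidal_nerve n.+1) : Prop :=
  match n return monoidal_nerve n.+1 -> Prop with
  | 0 => fun x => equivalence hC T (n1M01 (cosk1 x (ordmap_id 2)))
  | 1 => fun x => bimodule_iso (n2f012 (cosk2 x (ordmap_id 3)))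
  | _ => fun _ => True
  end x.

Lemma nerve_marked_degenerate n (x : monoidal_nerve n.+1) :
  degenerate x -> nerve_marked x.
Proof.
case: n x => [|[|n]] //= x [i [y ->]] /=.
- rewrite -[ordmap_comp _ _]/(ordmap_comp _ _).
  have -> : ordmap_comp (codegen i) (ordmap_id 2)
    = ordmap_comp (ordmap_id 1) (codegen i) by apply: ordmap_eq.
  by rewrite -cosk_degen0; apply: monoid_equivalence.
- have -> : ordmap_comp (codegen i) (ordmap_id 3)
    = ordmap_comp (ordmap_id 2) (codegen i) by apply: ordmap_eq.
  rewrite -cosk_degen1 /= /nerve_degen1.
  by case: (nat_of_ord i) => [|j] /=; [apply: unitor_l_iso|apply: unitor_r_iso].
Qed.

Definition marked_nerve : marked_sset :=
  MarkedSset nerve_marked_degenerate.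

End Nerve.

(* Main.v *)
(* The edges of the nerve are composed by the balanced tensor product, which is
   associative and unital up to isomorphism and functorial.

   Horns. A bimodule map out of [M ⊗b N] is the same as a bilinear morphism out
   of [M ⊗ N], and for bilinear morphisms the condition on a 3-simplex involves
   only the associator of the monoidal category. The missing face of a 3-horn is
   therefore obtained by inverting its marked face, and the pentagon axiom shows
   that four of the five faces of a 4-simplex commute only if the fifth does, up
   to a marked 2-simplex, which can be cancelled since tensoring preserves the
   coequalizers. Horns of dimension at least 5 contain the whole 3-skeleton.

   Saturation. In a 3-simplex with invertible faces, the edge 12 has a left and
   a right inverse as soon as 02 and 13 are equivalences; then all edges are
   equivalences. For a cone over such a 3-simplex, the face 124 is split mono
   after tensoring with the equivalence 01, hence split mono, and it is split
   epi; the other faces follow by cancellation, as tensoring with an equivalence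
   reflects isomorphisms.

   Simplices of the coskeleton are described by their values on increasing
   tuples of vertices: values on strictly increasing tuples extend uniquely by
   degeneracies to all tuples. *)

From Stdlib Require Import Eqdep.
From mathcomp Require Import all_boot boolp zify.
Require Import Defs.

Set Implicit Arguments.
Unset Strict Implicit.
Unset Printing Implicit Defensive.

(** * Bimodules and equivalences *)

Section Isomorphisms.
Context {C : monoidal_category}.
Implicit Types X Y Z : C.

Definition isom X Y (f : hom X Y) : Prop :=
  exists g : hom Y X, g ∘ f = idm X /\ f ∘ g = idm Y.

Lemma isom_id X : isom (idm X).
Proof. by exists (idm X); rewrite comp_idl. Qed.

Lemma isom_comp X Y Z (g : hom Y Z) (f : hom X Y) :
  isom g -> isom f -> isom (g ∘ f).
Proof.
move=> [g' [gl gr]] [f' [fl fr]]; exists (f' ∘ g'); split.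
  by rewrite -compA (precompK _ gl).
by rewrite -compA (precompK _ fr).
Qed.

Lemma isom_cancel_l X Y Z (g : hom Y Z) (f : hom X Y) :
  isom g -> isom (g ∘ f) -> isom f.
Proof.
move=> [g' [gl gr]] h; suff -> : f = g' ∘ (g ∘ f).
  by apply: isom_comp => //; exists g.
by rewrite (precompK _ gl).
Qed.

Lemma isom_cancel_r X Y Z (g : hom Y Z) (f : hom X Y) :
  isom f -> isom (g ∘ f) -> isom g.
Proof.
move=> [f' [fl fr]] h; suff -> : g = (g ∘ f) ∘ f'.
  by apply: isom_comp => //; exists f.
by rewrite -compA fr comp_idr.
Qed.

Lemma isom_split X Y (f : hom X Y) (l r : hom Y X) :
  l ∘ f = idm X -> f ∘ r = idm Y -> isom f.
Proof.
move=> lf fr; exists l; split=> //.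
suff -> : l = r by [].
by rewrite -[l]comp_idr -fr (precompK _ lf).
Qed.

Lemma isom_epi X Y Z (f : hom X Y) (g h : hom Y Z) :
  isom f -> g ∘ f = h ∘ f -> g = h.
Proof.
by move=> [f' [_ fr]] e; rewrite -[g]comp_idr -[h]comp_idr -fr !compA e.
Qed.

Lemma isom_rtens X Y Z (f : hom X Y) : isom f -> isom (f ▷ Z).
Proof.
by move=> [g [gl gr]]; exists (g ▷ Z); rewrite -!rtensD gl gr !tensm_id.
Qed.

Lemma isom_ltens X Y Z (f : hom X Y) : isom f -> isom (Z ◁ f).
Proof.
by move=> [g [gl gr]]; exists (Z ◁ g); rewrite -!ltensD gl gr !tensm_id.
Qed.

(** The inverse in [C] of a bimodule map is again a bimodule map ([bimodule_isoP]), so invertibility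
    can be tested in [C]. *)
Lemma bimodule_isoE A B (M N : bimodule A B) (f : bimodule_map M N) :
  bimodule_iso f <-> isom f.
Proof.
split=> [[g [gl gr]]|[g [gl gr]]]; first by exists g.
exact: bimodule_isoP gl gr.
Qed.

End Isomorphisms.

Section BimoduleMaps.
Context {C : monoidal_category}.

Lemma bimodule_comp_lact (A B : monoid C) (M N P : bimodule A B)
    (g : bimodule_map N P) (f : bimodule_map M N) :
  (g ∘ f) ∘ lact M = lact P ∘ A ◁ (g ∘ f).
Proof.
by rewrite -compA bmap_lact (precomp _ (bmap_lact g)) -ltensD.
Qed.

Lemma bimodule_comp_ract (A B : monoid C) (M N P : bimodule A B)
    (g : bimodule_map N P) (f : bimodule_map M N) :
  (g ∘ f) ∘ ract M = ract P ∘ (g ∘ f) ▷ B.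
Proof.
by rewrite -compA bmap_ract (precomp _ (bmap_ract g)) -rtensD.
Qed.

Definition bimodule_comp (A B : monoid C) (M N P : bimodule A B)
    (g : bimodule_map N P) (f : bimodule_map M N) : bimodule_map M P :=
  BimoduleMap (bimodule_comp_lact g f) (bimodule_comp_ract g f).

Lemma bimodule_isomorphic_refl (A B : monoid C) (M : bimodule A B) :
  bimodule_isomorphic M M.
Proof.
exists (bimodule_id M); apply/bimodule_isoE; exact: isom_id.
Qed.

Lemma bimodule_isomorphic_sym (A B : monoid C) (M N : bimodule A B) :
  bimodule_isomorphic M N -> bimodule_isomorphic N M.
Proof. by move=> [f [g [gl gr]]]; exists g, f. Qed.

Lemma bimodule_isomorphic_trans (A B : monoid C) (N M P : bimodule A B) :
  bimodule_isomorphic M N -> bimodule_isomorphic N P -> bimodule_isomorphic M P.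
Proof.
move=> [f /bimodule_isoE fi] [g /bimodule_isoE gi].
exists (bimodule_comp g f); apply/bimodule_isoE; exact: isom_comp.
Qed.

End BimoduleMaps.

(** * Functoriality and associativity of the balanced tensor product *)

Section Tensor.
Context {C : monoidal_category} (hC : balanced_calculus C).
Context (T : balanced_choice C).
Implicit Types A B D E : monoid C.

Local Notation pr M N := (bproj T M N).
Local Notation "M ⊗b N" := (btens_bimodule hC T M N)
  (at level 44, left associativity).

(** Conjugation by the associator reduces this to [lrtens_epi]. *)
Lemma lltens_epi X Y A B D (M : bimodule A B) (N : bimodule B D) Q
    (q : hom (M ⊗ N) Q) Z (f g : hom (X ⊗ (Q ⊗ Y)) Z) : balanced q ->
  f ∘ X ◁ (q ▷ Y) = g ∘ X ◁ (q ▷ Y) -> f = g.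
Proof.
move=> hq e; apply: assoc_epi; apply: (lrtens_epi hC hq).
by rewrite -!compA assoc_natm !compA e.
Qed.

Section Functor.
Context A B D (M M' : bimodule A B) (N N' : bimodule B D).
Context (f : bimodule_map M M') (g : bimodule_map N N').

Lemma btens_map_lact :
  btens_map T f g ∘ lact (M ⊗b N) = lact (M' ⊗b N') ∘ A ◁ btens_map T f g.
Proof.
apply: (ltens_epi hC (bprojP T M N)); apply: assoc_epi; rewrite -!compA /=.
rewrite btens_lactE' (precomp _ (btens_mapE _ _ _)) ltensDp btens_mapE.
rewrite ltensD -!compA -assoc_nat (precomp31 _ (btens_lactE' _ _ _ _)).
by rewrite -!compA -!tensm_comp bmap_lact comp_idl comp_idr.
Qed.

Lemma btens_map_ract :
  btens_map T f g ∘ ract (M ⊗b N) = ract (M' ⊗b N') ∘ btens_map T f g ▷ D.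
Proof.
apply: (rtens_epi hC (bprojP T M N)); rewrite -!compA /=.
rewrite btens_ractE (precomp _ (btens_mapE _ _ _)) -rtensD btens_mapE.
rewrite rtensD (precomp _ (btens_ractE _ _ _ _)) -!compA assoc_nat.
by rewrite !(compA _ _ (assoc _ _ _)) -!tensm_comp bmap_ract comp_idl comp_idr.
Qed.

Definition btens_bmap : bimodule_map (M ⊗b N) (M' ⊗b N') :=
  @BimoduleMap C A D (M ⊗b N) (M' ⊗b N') _ btens_map_lact btens_map_ract.

End Functor.

Lemma btens_bmap_id A B D (M : bimodule A B) (N : bimodule B D) :
  btens_bmap (bimodule_id M) (bimodule_id N) = bimodule_id (M ⊗b N).
Proof.
apply: bimodule_map_eq; apply: bproj_epi.
by rewrite /= btens_mapE tensm_id comp_idr comp_idl.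
Qed.

Lemma isom_btens_map A B D (M M' : bimodule A B) (N N' : bimodule B D)
    (f : bimodule_map M M') (g : bimodule_map N N') :
  isom f -> isom g -> isom (btens_map T f g).
Proof.
move=> /bimodule_isoE[f' [fl fr]] /bimodule_isoE[g' [gl gr]].
exists (btens_map T f' g'); split.
  apply: bproj_epi; rewrite -compA btens_mapE (precomp _ (btens_mapE _ _ _)).
  by rewrite -tensm_comp fl gl tensm_id comp_idl comp_idr.
apply: bproj_epi; rewrite -compA btens_mapE (precomp _ (btens_mapE _ _ _)).
by rewrite -tensm_comp fr gr tensm_id comp_idl comp_idr.
Qed.

Section Associator.
Context A B D E (M : bimodule A B) (N : bimodule B D) (P : bimodule D E).

Local Notation al := (btens_assoc hC T M N P).

(** First of the two descents that build the inverse of [btens_assoc]: along [M ◁ pr N P], a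
    coequalizer by preservation, and then, in [btens_associ_eq], along [pr M (N ⊗b P)]. *)
Lemma btens_associ_eq1 :
  (pr (M ⊗b N) P ∘ pr M N ▷ P ∘ associ M N P) ∘ M ◁ balanced_l N P
  = (pr (M ⊗b N) P ∘ pr M N ▷ P ∘ associ M N P) ∘ M ◁ balanced_r N P.
Proof.
apply: assoc_epi; apply: assocr_epi; rewrite /balanced_l /balanced_r.
rewrite ltensD -!compA pentagon (precomp _ (esym (assoc_natm _ _ _))).
rewrite (precomp _ (esym (assoc_natr _ _ _))) !(precompK _ (assocK _ _ _)).
rewrite (precomp _ (interchange _ _)) -assoc_natl.
rewrite (precomp3 _ (esym (bproj_eq _ (M ⊗b N) P))) -!rtensD /=.
by rewrite btens_ractE.
Qed.

Definition btens_associ1 : hom (M ⊗ btens T N P) (btens T (M ⊗b N) P) :=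
  coeq_desc (ltens_coeq hC M (bprojP T N P)) btens_associ_eq1.

Lemma btens_associ1E :
  btens_associ1 ∘ M ◁ pr N P = pr (M ⊗b N) P ∘ pr M N ▷ P ∘ associ M N P.
Proof. exact: coeq_descE. Qed.

Lemma btens_associ1E' :
  btens_associ1 ∘ M ◁ pr N P ∘ assoc M N P = pr (M ⊗b N) P ∘ pr M N ▷ P.
Proof. by rewrite compA btens_associ1E -!compA assocK comp_idr. Qed.

Lemma btens_associ_eq :
  btens_associ1 ∘ balanced_l M (N ⊗b P) = btens_associ1 ∘ balanced_r M (N ⊗b P).
Proof.
rewrite /balanced_l /balanced_r.
apply: (ltens_epi hC (bprojP T N P)); apply: assoc_epi; rewrite -!compA /=.
rewrite (precomp _ (interchange _ _)) -assoc_natl.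
rewrite (precomp31 _ btens_associ1E') -!compA -rtensD bproj_eq !rtensD.
rewrite (precomp _ (assoc_natr _ _ _)) -pentagon !ltensDp -?compA btens_lactE'.
rewrite ltensD -!compA -(precomp _ (assoc_natm _ _ _)).
by rewrite (precomp31 _ btens_associ1E') -!compA.
Qed.

Definition btens_associ : hom (btens T M (N ⊗b P)) (btens T (M ⊗b N) P) :=
  coeq_desc (bprojP T M (N ⊗b P)) btens_associ_eq.

Lemma btens_associE :
  btens_associ ∘ pr M (N ⊗b P) ∘ M ◁ pr N P ∘ assoc M N P
  = pr (M ⊗b N) P ∘ pr M N ▷ P.
Proof. by rewrite compA coeq_descE btens_associ1E'. Qed.

Lemma isom_btens_assoc : isom al.
Proof.
exists btens_associ; split.
  apply: bproj2_epi; rewrite -!compA btens_assocE btens_associE.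
  by rewrite comp_idl.
apply: bproj_epi; apply: (ltens_epi hC (bprojP T N P)); apply: assoc_epi.
by rewrite -!compA btens_associE btens_assocE comp_idl.
Qed.

(** Projections and associators compose to an epimorphism out of [((A ⊗ M) ⊗ N) ⊗ P]; after it both
    sides agree by naturality and the pentagon. *)
Lemma btens_assoc_lact :
  al ∘ lact (M ⊗b N ⊗b P) = lact (M ⊗b (N ⊗b P)) ∘ A ◁ al.
Proof.
apply: (ltens_epi hC (bprojP T (M ⊗b N) P)).
apply: (lltens_epi (bprojP T M N)); apply: assoc_epi; apply: assocr_epi.
rewrite -!compA /= !ltensDp btens_assocE !ltensD -!compA pentagon.
rewrite -(precomp _ (assoc_natr _ _ _)) (precomp31 _ (btens_lactE' _ _ _ _)).
rewrite -!compA -(precomp _ (assoc_natm _ _ _)).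
rewrite (precomp31 _ (btens_lactE' _ _ _ _)) -!compA -!rtensD btens_lactE'.
rewrite rtensD (precomp31 _ (btens_assocE _ _ _ _ _)) -!compA assoc_natl.
by rewrite (precomp _ (interchange _ _)).
Qed.

Lemma btens_assoc_ract :
  al ∘ ract (M ⊗b N ⊗b P) = ract (M ⊗b (N ⊗b P)) ∘ al ▷ E.
Proof.
apply: (rtens_epi hC (bprojP T (M ⊗b N) P)); apply: (rrtens_epi hC (bprojP T M N)).
rewrite -!compA /= (precomp _ (btens_ractE _ _ _ _)) -!compA assoc_natl.
rewrite -(precomp _ (interchange _ _)) (precomp31 _ (btens_assocE _ _ _ _ _)).
rewrite -!rtensD -!compA btens_assocE !rtensD.
rewrite (precomp _ (btens_ractE _ _ _ _)) -!compA.
rewrite (precomp _ (assoc_natr _ _ _)) (precomp _ (assoc_natm _ _ _)) -pentagon.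
by rewrite !ltensDp /= btens_ractE.
Qed.

Definition btens_assoc_bmap : bimodule_map (M ⊗b N ⊗b P) (M ⊗b (N ⊗b P)) :=
  @BimoduleMap C A E (M ⊗b N ⊗b P) (M ⊗b (N ⊗b P)) _
    btens_assoc_lact btens_assoc_ract.

End Associator.

Lemma btens_assoc_nat A B D E (M M' : bimodule A B) (N N' : bimodule B D)
    (P P' : bimodule D E) (f : bimodule_map M M') (g : bimodule_map N N')
    (h : bimodule_map P P') :
  btens_assoc hC T M' N' P' ∘ btens_map T (btens_bmap f g) h
  = btens_map T f (btens_bmap g h) ∘ btens_assoc hC T M N P.
Proof.
apply: bproj2_epi; rewrite -!compA btens_assocE (precomp _ (btens_mapE _ _ _)).
have e : (btens_bmap f g : hom _ _) ⊠ h ∘ pr M N ▷ P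
    = pr M' N' ▷ P' ∘ (f ⊠ g) ⊠ h.
  by rewrite -!tensm_comp /= btens_mapE comp_idl comp_idr.
have e' : (f : hom _ _) ⊠ btens_bmap g h ∘ M ◁ pr N P
    = M' ◁ pr N' P' ∘ f ⊠ (g ⊠ h).
  by rewrite -!tensm_comp /= btens_mapE comp_idl comp_idr.
rewrite e (precomp31 _ (btens_assocE _ _ _ _ _)) -!compA assoc_nat.
by rewrite (precomp _ (btens_mapE _ _ _)) (precomp _ e').
Qed.

Lemma unitor_l_nat A B (M N : bimodule A B) (f : bimodule_map M N) :
  unitor_l hC T N ∘ btens_map T (bimodule_id (monoid_bimodule A)) f
  = f ∘ unitor_l hC T M.
Proof.
apply: bproj_epi; rewrite -!compA btens_mapE unitor_l_bproj bmap_lact.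
by rewrite (precomp1 _ (unitor_l_bproj _ _ _)).
Qed.

(** The balanced morphism on [M ⊗ N] that [f] classifies. *)
Definition bilinear A B D (M : bimodule A B) (N : bimodule B D)
  (P : bimodule A D) (f : bimodule_map (M ⊗b N) P) : hom (M ⊗ N) P := f ∘ pr M N.

(** The map from [(M01 ⊗ M12) ⊗ M23] to the iterated balanced product is epi ([bproj2_epi]);
    precomposing with it turns the balanced associator into the associator of [C]. *)
Lemma compatibleP A0 A1 A2 A3 (M01 : bimodule A0 A1) (M02 : bimodule A0 A2)
    (M03 : bimodule A0 A3) (M12 : bimodule A1 A2) (M13 : bimodule A1 A3)
    (M23 : bimodule A2 A3)
    (f012 : bimodule_map (M01 ⊗b M12) M02) (f023 : bimodule_map (M02 ⊗b M23) M03)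
    (f013 : bimodule_map (M01 ⊗b M13) M03) (f123 : bimodule_map (M12 ⊗b M23) M13) :
  compatible f012 f023 f013 f123 <->
  bilinear f023 ∘ bilinear f012 ▷ M23
  = bilinear f013 ∘ M01 ◁ bilinear f123 ∘ assoc M01 M12 M23.
Proof.
have el : (f023 ∘ btens_map T f012 (bimodule_id M23)) ∘ pr (M01 ⊗b M12) M23
    ∘ pr M01 M12 ▷ M23 = bilinear f023 ∘ bilinear f012 ▷ M23.
  by rewrite -!compA (precomp _ (btens_mapE _ _ _)) -rtensD.
have er : (f013 ∘ btens_map T (bimodule_id M01) f123 ∘ btens_assoc hC T M01 M12 M23)
    ∘ pr (M01 ⊗b M12) M23 ∘ pr M01 M12 ▷ M23
    = bilinear f013 ∘ M01 ◁ bilinear f123 ∘ assoc M01 M12 M23.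
  rewrite -!compA btens_assocE (precomp _ (btens_mapE _ _ _)).
  by rewrite ltensDp.
rewrite -el -er; split=> [->//|]; exact: bproj2_epi.
Qed.

End Tensor.

(** * Equivalence bimodules: composition, cancellation, reflection of isomorphisms *)

Section Equivalences.
Context {C : monoidal_category} (hC : balanced_calculus C).
Context (T : balanced_choice C).
Implicit Types A B D : monoid C.

Local Notation "M ⊗b N" := (btens_bimodule hC T M N)
  (at level 44, left associativity).
Local Notation "M ≃ N" := (bimodule_isomorphic M N) (at level 70).
Local Notation Id A := (monoid_bimodule A).

Lemma iso_btens A B D (M M' : bimodule A B) (N N' : bimodule B D) :
  M ≃ M' -> N ≃ N' -> M ⊗b N ≃ M' ⊗b N'.
Proof.
move=> [f /bimodule_isoE fi] [g /bimodule_isoE gi].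
exists (btens_bmap hC T f g); apply/bimodule_isoE; exact: isom_btens_map.
Qed.

Lemma iso_btens_l A B D (M : bimodule A B) (N N' : bimodule B D) :
  N ≃ N' -> M ⊗b N ≃ M ⊗b N'.
Proof. exact/iso_btens/bimodule_isomorphic_refl. Qed.

Lemma iso_btens_r A B D (M M' : bimodule A B) (N : bimodule B D) :
  M ≃ M' -> M ⊗b N ≃ M' ⊗b N.
Proof. by move=> h; apply: iso_btens h (bimodule_isomorphic_refl N). Qed.

Lemma iso_assoc A B D E (M : bimodule A B) (N : bimodule B D)
    (P : bimodule D E) : M ⊗b N ⊗b P ≃ M ⊗b (N ⊗b P).
Proof.
exists (btens_assoc_bmap hC T M N P); apply/bimodule_isoE.
exact: isom_btens_assoc.
Qed.

Lemma iso_unit_l A B (M : bimodule A B) : Id A ⊗b M ≃ M.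
Proof. by exists (unitor_l hC T M); apply: unitor_l_iso. Qed.

Lemma iso_unit_r A B (M : bimodule A B) : M ⊗b Id B ≃ M.
Proof. by exists (unitor_r hC T M); apply: unitor_r_iso. Qed.

Lemma iso_cancel_mid A B D E (M : bimodule A B) (N : bimodule B D)
    (N' : bimodule D B) (P : bimodule B E) :
  N ⊗b N' ≃ Id B -> (M ⊗b N) ⊗b (N' ⊗b P) ≃ M ⊗b P.
Proof.
move=> h; apply: bimodule_isomorphic_trans (iso_assoc _ _ _) _.
apply: iso_btens_l.
apply: bimodule_isomorphic_trans (bimodule_isomorphic_sym (iso_assoc _ _ _)) _.
exact: bimodule_isomorphic_trans (iso_btens_r _ h) (iso_unit_l _).
Qed.

Lemma equivalence_iso A B (M N : bimodule A B) :
  M ≃ N -> equivalence hC T M -> equivalence hC T N.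
Proof.
move=> /bimodule_isomorphic_sym h [M' [hl hr]]; exists M'; split.
  exact: bimodule_isomorphic_trans (iso_btens_r _ h) hl.
exact: bimodule_isomorphic_trans (iso_btens_l _ h) hr.
Qed.

(** [L ≅ L ⊗ (M ⊗ R) ≅ (L ⊗ M) ⊗ R ≅ R], so [L] is also a right inverse of [M]. *)
Lemma equivalence_of_inverses A B (M : bimodule A B) (L R : bimodule B A) :
  L ⊗b M ≃ Id B -> M ⊗b R ≃ Id A -> equivalence hC T M.
Proof.
move=> hl hr; exists L; split=> //.
have LR : L ≃ R.
  apply: bimodule_isomorphic_trans (bimodule_isomorphic_sym (iso_unit_r L)) _.
  apply: bimodule_isomorphic_trans
    (iso_btens_l L (bimodule_isomorphic_sym hr)) _.
  apply: bimodule_isomorphic_trans (bimodule_isomorphic_sym (iso_assoc _ _ _)) _.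
  exact: bimodule_isomorphic_trans (iso_btens_r R hl) (iso_unit_l R).
exact: bimodule_isomorphic_trans (iso_btens_l M LR) hr.
Qed.

Lemma equivalence_btens A B D (M : bimodule A B) (N : bimodule B D) :
  equivalence hC T M -> equivalence hC T N -> equivalence hC T (M ⊗b N).
Proof.
move=> [M' [Ml Mr]] [N' [Nl Nr]]; exists (N' ⊗b M'); split.
  exact: bimodule_isomorphic_trans (iso_cancel_mid _ _ Nl) Ml.
exact: bimodule_isomorphic_trans (iso_cancel_mid _ _ Mr) Nr.
Qed.

(** [N] is isomorphic to [M' ⊗ (M ⊗ N)], and the inverse [M'] of an equivalence is an
    equivalence. *)
Lemma equivalence_cancel_l A B D (M : bimodule A B) (N : bimodule B D) :
  equivalence hC T M -> equivalence hC T (M ⊗b N) -> equivalence hC T N.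
Proof.
move=> [M' [Ml Mr]] h; apply: (equivalence_iso _ (equivalence_btens _ h)).
  apply: bimodule_isomorphic_trans (bimodule_isomorphic_sym (iso_assoc M' _ _)) _.
  exact: bimodule_isomorphic_trans (iso_btens_r N Mr) (iso_unit_l N).
by exists M.
Qed.

Lemma equivalence_cancel_r A B D (M : bimodule A B) (N : bimodule B D) :
  equivalence hC T N -> equivalence hC T (M ⊗b N) -> equivalence hC T M.
Proof.
move=> [N' [Nl Nr]] h; apply: (equivalence_iso _ (equivalence_btens h _)).
  apply: bimodule_isomorphic_trans (iso_assoc _ _ N') _.
  exact: bimodule_isomorphic_trans (iso_btens_l M Nl) (iso_unit_r M).
by exists N.
Qed.

(** An inverse [L] of [M ⊗ N] yields the left inverse [L ⊗ M] of [N]; an inverse [R] of [N ⊗ P]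
    yields the right inverse [P ⊗ R]. *)
Lemma equivalence_two_of_six A B D E (M : bimodule A B) (N : bimodule B D)
    (P : bimodule D E) :
  equivalence hC T (M ⊗b N) -> equivalence hC T (N ⊗b P) -> equivalence hC T N.
Proof.
move=> [L [_ Lr]] [R [Rl _]].
apply: (@equivalence_of_inverses _ _ N (L ⊗b M) (P ⊗b R)).
  exact: bimodule_isomorphic_trans (iso_assoc _ _ _) Lr.
exact: bimodule_isomorphic_trans (bimodule_isomorphic_sym (iso_assoc _ _ _)) Rl.
Qed.

Section Reflection.
Context A B D (M : bimodule A B) (N N' : bimodule B D) (f : bimodule_map N N').
Hypothesis M_eq : equivalence hC T M.

(** For [M'] inverse to [M], the functor [M' ⊗ (M ⊗ -)] is naturally isomorphic to the identity;
    only the naturality square at [f] is recorded. *)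
Lemma btens_retract : exists (M' : bimodule B A)
    (t : bimodule_map (M' ⊗b (M ⊗b N)) N) (t' : bimodule_map (M' ⊗b (M ⊗b N')) N'),
  [/\ isom t, isom t' &
    t' ∘ btens_map T (bimodule_id M') (btens_bmap hC T (bimodule_id M) f) = f ∘ t].
Proof.
have [M' [_ [e ei]]] := M_eq; exists M'.
(* [M' ⊗ M ⊗ P ≅ Id B ⊗ P ≅ P], the first isomorphism induced by [e]. *)
pose b (P : bimodule B D) := bimodule_comp (unitor_l hC T P) (btens_bmap hC T e (bimodule_id P))
  : bimodule_map (M' ⊗b M ⊗b P) P.
have bi (P : bimodule B D) : isom (b P).
  apply: isom_comp; first exact/bimodule_isoE/unitor_l_iso.
  by apply: isom_btens_map; [apply/bimodule_isoE|exact: isom_id].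
have ai (P : bimodule B D) : bimodule_iso (btens_assoc_bmap hC T M' M P).
  apply/bimodule_isoE; exact: isom_btens_assoc.
have bn : b N' ∘ btens_map T (bimodule_id (M' ⊗b M)) f = f ∘ b N.
  rewrite /= -!compA -/(unitor_l hC T N) (precomp1 _ (esym (unitor_l_nat _ _ _))).
  rewrite -!compA; congr (_ ∘ _); apply: bproj_epi.
  rewrite -!compA !btens_mapE !(precomp _ (btens_mapE _ _ _)).
  by rewrite -!tensm_comp /= !comp_idl !comp_idr.
have [a [al ar]] := ai N; have [a' [al' ar']] := ai N'.
exists (bimodule_comp (b N) a), (bimodule_comp (b N') a'); split.
- by apply: isom_comp => //; exists (btens_assoc_bmap hC T M' M N).
- by apply: isom_comp => //; exists (btens_assoc_bmap hC T M' M N').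
(* [a] inverts the associator, so precomposing with the latter and using its naturality leaves
   [bn]. *)
apply: (isom_epi (f := btens_assoc hC T M' M N)); first exact: isom_btens_assoc.
rewrite /= -!compA -btens_assoc_nat (precompK _ al').
have al1 : a ∘ btens_assoc hC T M' M N = idm _ by exact: al.
rewrite btens_bmap_id al1 comp_idr.
by move: bn; rewrite /= -!compA.
Qed.

(** Tensoring with [M'] turns [g] into a retraction of [M' ⊗ (M ⊗ f)], which is conjugate to [f] by
    [btens_retract]. *)
Lemma equivalence_split_mono (g : bimodule_map (M ⊗b N') (M ⊗b N)) :
  g ∘ btens_map T (bimodule_id M) f = idm _ ->
  exists h : bimodule_map N' N, h ∘ f = idm N.
Proof.
move=> gf; have [M' [t [t' [ti t'i nat]]]] := btens_retract.
have /bimodule_isoE[s [sl sr]] := t'i.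
exists (bimodule_comp t (bimodule_comp (btens_bmap hC T (bimodule_id M') g) s)).
apply: (isom_epi ti); rewrite -!compA -nat (precompK _ sl) comp_idl /=.
suff -> : btens_map T (bimodule_id M') g
    ∘ btens_map T (bimodule_id M') (btens_bmap hC T (bimodule_id M) f) = idm _.
  by rewrite comp_idr.
apply: bproj_epi; rewrite -!compA !btens_mapE (precomp _ (btens_mapE _ _ _)).
by rewrite -tensm_comp /= gf comp_idl tensm_id comp_idr comp_idl.
Qed.

(** By [btens_retract], [f ∘ t] is [t'] after [M' ⊗ (M ⊗ f)], a composite of isomorphisms. *)
Lemma equivalence_reflects_iso :
  isom (btens_map T (bimodule_id M) f) -> isom f.
Proof.
move=> h; have [M' [t [t' [ti t'i nat]]]] := btens_retract.
apply: (isom_cancel_r ti); rewrite -nat; apply: isom_comp => //.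
by apply: isom_btens_map => //; exact: isom_id.
Qed.

End Reflection.

End Equivalences.

(** * Simplices of the nerve *)

(** Equal records with dependent fields give equal dependent pairs; [inj_pair2], a form of
    uniqueness of identity proofs, extracts the second components. *)
Ltac simplify_existT :=
  repeat match goal with
  | H : existT _ _ _ = existT _ _ _ |- _ => apply inj_pair2 in H
  end; subst.

Section NerveSimplices.
Context {C : monoidal_category} (hC : balanced_calculus C).
Context (T : balanced_choice C).

Local Notation "M ⊗b N" := (btens_bimodule hC T M N)
  (at level 44, left associativity).
Local Notation nerve2 := (@Defs.nerve2 C hC T).
Local Notation nerve3 := (@Defs.nerve3 C hC T).

(** Coskeletal data come as records related by equations between faces, so incidence is stated by
    such equations; [edgeP], [triangleP] and [tetrahedronP] convert it back into typed bimodules and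
    maps. *)
Definition edge (a b : monoid C) (e : @nerve1 C) : Prop :=
  nerve_face1 (inord 1) e = a /\ nerve_face1 (inord 0) e = b.

Definition triangle_on (e01 e02 e12 : @nerve1 C) (x : nerve2) : Prop :=
  [/\ nerve_face2 (inord 2) x = e01, nerve_face2 (inord 1) x = e02
    & nerve_face2 (inord 0) x = e12].

Definition tetrahedron_on (x012 x013 x023 x123 : nerve2) (w : nerve3) : Prop :=
  [/\ nerve_face3 (inord 3) w = x012, nerve_face3 (inord 2) w = x013,
      nerve_face3 (inord 1) w = x023 & nerve_face3 (inord 0) w = x123].

Definition tetrahedron x012 x013 x023 x123 : Prop :=
  exists w, tetrahedron_on x012 x013 x023 x123 w.

Lemma edgeP a b e : edge a b e -> exists M : bimodule a b, e = Nerve1 M.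
Proof.
rewrite /edge /nerve_face1 !inordK //; case: e => A0 A1 M /= [<- <-].
by exists M.
Qed.

Lemma triangleP A0 A1 A2 (M01 : bimodule A0 A1) (M02 : bimodule A0 A2)
    (M12 : bimodule A1 A2) x :
  triangle_on (Nerve1 M01) (Nerve1 M02) (Nerve1 M12) x ->
  exists f : bimodule_map (M01 ⊗b M12) M02, x = Nerve2 f.
Proof.
rewrite /triangle_on /nerve_face2 !inordK //.
case: x => B0 B1 B2 N01 N02 N12 f /=.
case=> e01 e02 e12.
case: e01 => ? ?; subst => ?; simplify_existT.
case: e02 => ?; subst => ?; simplify_existT.
case: e12 => ?; simplify_existT.
by exists f.
Qed.

Lemma triangle_on_nerve2 A0 A1 A2 (M01 : bimodule A0 A1) (M02 : bimodule A0 A2)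
    (M12 : bimodule A1 A2) (f : bimodule_map (M01 ⊗b M12) M02) :
  triangle_on (Nerve1 M01) (Nerve1 M02) (Nerve1 M12) (Nerve2 f).
Proof. by split; rewrite /nerve_face2 inordK. Qed.

Section Tetrahedra.
Context (A0 A1 A2 A3 : monoid C) (M01 : bimodule A0 A1) (M02 : bimodule A0 A2)
  (M03 : bimodule A0 A3) (M12 : bimodule A1 A2) (M13 : bimodule A1 A3)
  (M23 : bimodule A2 A3).
Context (f012 : bimodule_map (M01 ⊗b M12) M02)
  (f013 : bimodule_map (M01 ⊗b M13) M03)
  (f023 : bimodule_map (M02 ⊗b M23) M03)
  (f123 : bimodule_map (M12 ⊗b M23) M13).

Lemma tetrahedronP :
  tetrahedron (Nerve2 f012) (Nerve2 f013) (Nerve2 f023) (Nerve2 f123) <->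
  compatible f012 f023 f013 f123.
Proof.
split=> [[w]|P]; last first.
  by exists (Nerve3 P); split; rewrite /nerve_face3 inordK.
case: w => B0 B1 B2 B3 N01 N02 N03 N12 N13 N23 g012 g013 g023 g123 P.
rewrite /tetrahedron_on /nerve_face3 !inordK //=.
case=> e012 e013 e023 e123.
injection e012; intros; subst; simplify_existT.
injection e013; intros; subst; simplify_existT.
injection e023; intros; subst; simplify_existT.
injection e123; intros; subst; simplify_existT.
exact: P.
Qed.

End Tetrahedra.

Definition invertible (x : nerve2) : Prop := bimodule_iso (n2f012 x).

Definition equivalence_edge (e : @nerve1 C) : Prop :=
  equivalence hC T (n1M01 e).

Lemma equivalence_edge_comp x :
  invertible x -> equivalence_edge (nerve_face2 (inord 2) x) ->
  equivalence_edge (nerve_face2 (inord 0) x) ->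
  equivalence_edge (nerve_face2 (inord 1) x).
Proof.
rewrite /nerve_face2 !inordK // /equivalence_edge.
case: x => A0 A1 A2 M01 M02 M12 f /= fi h1 h2.
by apply: (equivalence_iso _ (equivalence_btens h1 h2)); exists f.
Qed.

Section FourVertices.
Context (a0 a1 a2 a3 : monoid C) (e01 e02 e03 e12 e13 e23 : @nerve1 C).
Hypotheses (h01 : edge a0 a1 e01) (h02 : edge a0 a2 e02) (h03 : edge a0 a3 e03)
  (h12 : edge a1 a2 e12) (h13 : edge a1 a3 e13) (h23 : edge a2 a3 e23).

(** The missing edge is the balanced tensor product itself, and the filler is its identity. *)
Lemma fill_triangle : 
  exists2 x, invertible x & exists2 e02, edge a0 a2 e02 & triangle_on e01 e02 e12 x.
Proof.
have [M01 E01] := edgeP h01; have [M12 E12] := edgeP h12.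
exists (Nerve2 (bimodule_id (M01 ⊗b M12))).
  by apply/bimodule_isoE; exact: isom_id.
exists (Nerve1 (M01 ⊗b M12)).
  by split; rewrite /nerve_face1 inordK.
by rewrite E01 E12; exact: triangle_on_nerve2.
Qed.

(** Solving the compatibility equation gives [f023 = f013 ∘ (M01 ⊗ f123) ∘ α ∘ (f012⁻¹ ⊗ M23)]. *)
Lemma fill_tetrahedron1 x012 x013 x123 :
  triangle_on e01 e02 e12 x012 -> triangle_on e01 e03 e13 x013 ->
  triangle_on e12 e13 e23 x123 -> invertible x012 ->
  exists2 x023, triangle_on e02 e03 e23 x023 & tetrahedron x012 x013 x023 x123.
Proof.
have [M01 E01] := edgeP h01; have [M02 E02] := edgeP h02.
have [M03 E03] := edgeP h03; have [M12 E12] := edgeP h12.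
have [M13 E13] := edgeP h13; have [M23 E23] := edgeP h23.
rewrite E01 E02 E03 E12 E13 E23.
move=> /triangleP[f012 ->] /triangleP[f013 ->] /triangleP[f123 ->] [g [gl gr]].
pose f023 := bimodule_comp f013 (bimodule_comp
  (btens_bmap hC T (bimodule_id M01) f123) (bimodule_comp
  (btens_assoc_bmap hC T M01 M12 M23) (btens_bmap hC T g (bimodule_id M23)))).
exists (Nerve2 f023); first exact: triangle_on_nerve2.
apply/tetrahedronP; rewrite /compatible /= -!compA.
have -> : btens_map T g (bimodule_id M23) ∘ btens_map T f012 (bimodule_id M23)
    = idm _.
  apply: bproj_epi; rewrite -!compA btens_mapE (precomp _ (btens_mapE _ _ _)).
  by rewrite -tensm_comp /= [bmap g ∘ _]gl !comp_idl tensm_id comp_idr.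
by rewrite comp_idr.
Qed.

(** Solving the compatibility equation gives [f013 = f023 ∘ (f012 ⊗ M23) ∘ α⁻¹ ∘ (M01 ⊗ f123⁻¹)]. *)
Lemma fill_tetrahedron2 x012 x023 x123 :
  triangle_on e01 e02 e12 x012 -> triangle_on e02 e03 e23 x023 ->
  triangle_on e12 e13 e23 x123 -> invertible x123 ->
  exists2 x013, triangle_on e01 e03 e13 x013 & tetrahedron x012 x013 x023 x123.
Proof.
have [M01 E01] := edgeP h01; have [M02 E02] := edgeP h02.
have [M03 E03] := edgeP h03; have [M12 E12] := edgeP h12.
have [M13 E13] := edgeP h13; have [M23 E23] := edgeP h23.
rewrite E01 E02 E03 E12 E13 E23.
move=> /triangleP[f012 ->] /triangleP[f023 ->] /triangleP[f123 ->] [g [gl gr]].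
have /bimodule_isoE[a [al ar]] : isom (btens_assoc_bmap hC T M01 M12 M23).
  exact: isom_btens_assoc.
pose f013 := bimodule_comp f023 (bimodule_comp
  (btens_bmap hC T f012 (bimodule_id M23)) (bimodule_comp a
  (btens_bmap hC T (bimodule_id M01) g))).
exists (Nerve2 f013); first exact: triangle_on_nerve2.
apply/tetrahedronP; rewrite /compatible /= -!compA.
have gK : btens_map T (bimodule_id M01) g ∘ btens_map T (bimodule_id M01) f123
    = idm _.
  apply: bproj_epi; rewrite -!compA btens_mapE (precomp _ (btens_mapE _ _ _)).
  by rewrite -tensm_comp /= [bmap g ∘ _]gl !comp_idl tensm_id comp_idr.
have al' : a ∘ btens_assoc hC T M01 M12 M23 = idm _ by exact: al.
by rewrite (precompK _ gK) al' comp_idr.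
Qed.

Context (x012 x013 x023 x123 : nerve2).
Hypotheses (t012 : triangle_on e01 e02 e12 x012)
  (t013 : triangle_on e01 e03 e13 x013) (t023 : triangle_on e02 e03 e23 x023)
  (t123 : triangle_on e12 e13 e23 x123).
Hypothesis x0123 : tetrahedron x012 x013 x023 x123.

Lemma tetrahedron_explicit :
  exists (M01 : bimodule a0 a1) (M02 : bimodule a0 a2) (M03 : bimodule a0 a3)
    (M12 : bimodule a1 a2) (M13 : bimodule a1 a3) (M23 : bimodule a2 a3)
    (f012 : bimodule_map (M01 ⊗b M12) M02) (f013 : bimodule_map (M01 ⊗b M13) M03)
    (f023 : bimodule_map (M02 ⊗b M23) M03) (f123 : bimodule_map (M12 ⊗b M23) M13),
  [/\ [/\ e01 = Nerve1 M01, e02 = Nerve1 M02 & e03 = Nerve1 M03],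
      [/\ e12 = Nerve1 M12, e13 = Nerve1 M13 & e23 = Nerve1 M23],
      [/\ x012 = Nerve2 f012, x013 = Nerve2 f013, x023 = Nerve2 f023
        & x123 = Nerve2 f123]
    & compatible f012 f023 f013 f123].
Proof.
have [M01 E01] := edgeP h01; have [M02 E02] := edgeP h02.
have [M03 E03] := edgeP h03; have [M12 E12] := edgeP h12.
have [M13 E13] := edgeP h13; have [M23 E23] := edgeP h23.
move: t012 t013 t023 t123 x0123; rewrite E01 E02 E03 E12 E13 E23.
move=> /triangleP[f012 ->] /triangleP[f013 ->] /triangleP[f023 ->].
move=> /triangleP[f123 ->] /tetrahedronP P.
by exists M01, M02, M03, M12, M13, M23, f012, f013, f023, f123.
Qed.

(** Every factor of the compatibility equation other than [f023] is invertible, hence so is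
    [f023]. *)
Lemma invertible_face1 :
  invertible x012 -> invertible x013 -> invertible x123 -> invertible x023.
Proof.
have [M01 [M02 [M03 [M12 [M13 [M23 [f012 [f013 [f023 [f123 [_ _]]]]]]]]]]] :=
  tetrahedron_explicit.
case=> -> -> -> -> e /bimodule_isoE i012 /bimodule_isoE i013 /bimodule_isoE i123.
apply/bimodule_isoE; move: e; rewrite /compatible /=.
set g := btens_map _ _ _ => e; apply: (@isom_cancel_r _ _ _ _ _ g).
  by apply: isom_btens_map => //; exact: isom_id.
rewrite e; apply: isom_comp => //; apply: isom_comp; last exact: isom_btens_assoc.
by apply: isom_btens_map => //; exact: isom_id.
Qed.

Lemma invertible_face2 :
  invertible x012 -> invertible x023 -> invertible x123 -> invertible x013.
Proof.
have [M01 [M02 [M03 [M12 [M13 [M23 [f012 [f013 [f023 [f123 [_ _]]]]]]]]]]] :=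
  tetrahedron_explicit.
case=> -> -> -> -> e /bimodule_isoE i012 /bimodule_isoE i023 /bimodule_isoE i123.
apply/bimodule_isoE; move: e; rewrite /compatible /=.
set g := btens_map T (bimodule_id _) _ => e.
apply: (@isom_cancel_r _ _ _ _ _ (g ∘ btens_assoc hC T M01 M12 M23)).
  apply: isom_comp; last exact: isom_btens_assoc.
  by apply: isom_btens_map => //; exact: isom_id.
rewrite -e; apply: isom_comp => //.
by apply: isom_btens_map => //; exact: isom_id.
Qed.

(** The faces give [M02 ≅ M01 ⊗ M12] and [M13 ≅ M12 ⊗ M23]. Two-out-of-six yields [M12],
    cancellation [M01] and [M23], and composition [M03 ≅ M01 ⊗ M13]. *)
Lemma equivalence_two_of_six_edges :
  invertible x012 -> invertible x013 -> invertible x023 -> invertible x123 ->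
  equivalence_edge e02 -> equivalence_edge e13 ->
  [/\ equivalence_edge e01, equivalence_edge e12, equivalence_edge e23
    & equivalence_edge e03].
Proof.
have [M01 [M02 [M03 [M12 [M13 [M23 [f012 [f013 [f023 [f123 [+ +]]]]]]]]]]] :=
  tetrahedron_explicit.
move=> [-> -> ->] [-> -> ->] [-> -> -> ->] _ /= i012 i013 i023 i123.
rewrite /equivalence_edge /= => q02 q13.
have r012 : equivalence hC T (M01 ⊗b M12).
  by apply: equivalence_iso q02; apply: bimodule_isomorphic_sym; exists f012.
have r123 : equivalence hC T (M12 ⊗b M23).
  by apply: equivalence_iso q13; apply: bimodule_isomorphic_sym; exists f123.
have q12 := equivalence_two_of_six r012 r123.
have q01 := equivalence_cancel_r q12 r012.
split=> //; first exact: equivalence_cancel_l q12 r123.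
by apply: (equivalence_iso _ (equivalence_btens q01 q13)); exists f013.
Qed.

End FourVertices.

(* The two-sided composites around the pentagon of a 4-simplex, as morphisms out
   of [((M01 ⊗ M12) ⊗ M23) ⊗ M34]. *)
Section Pentagon.
Context (M01 M02 M03 M04 M12 M13 M14 M23 M24 M34 : C).
Context (u012 : hom (M01 ⊗ M12) M02) (u013 : hom (M01 ⊗ M13) M03)
  (u014 : hom (M01 ⊗ M14) M04) (u023 : hom (M02 ⊗ M23) M03)
  (u024 : hom (M02 ⊗ M24) M04) (u034 : hom (M03 ⊗ M34) M04)
  (u123 : hom (M12 ⊗ M23) M13) (u124 : hom (M12 ⊗ M24) M14)
  (u134 : hom (M13 ⊗ M34) M14) (u234 : hom (M23 ⊗ M34) M24).

Local Notation p0 := (u034 ∘ u023 ▷ M34 ∘ u012 ▷ M23 ▷ M34).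
Local Notation p1 :=
  (u034 ∘ u013 ▷ M34 ∘ (M01 ◁ u123) ▷ M34 ∘ assoc M01 M12 M23 ▷ M34).
Local Notation p2 := (u014 ∘ M01 ◁ u134 ∘ assoc M01 M13 M34
  ∘ (M01 ◁ u123) ▷ M34 ∘ assoc M01 M12 M23 ▷ M34).
Local Notation p3 := (u014 ∘ M01 ◁ u124 ∘ assoc M01 M12 M24
  ∘ (M01 ⊗ M12) ◁ u234 ∘ assoc (M01 ⊗ M12) M23 M34).
Local Notation p4 := (u024 ∘ u012 ▷ M24
  ∘ (M01 ⊗ M12) ◁ u234 ∘ assoc (M01 ⊗ M12) M23 M34).

Let t0123 : Prop := u023 ∘ u012 ▷ M23 = u013 ∘ M01 ◁ u123 ∘ assoc M01 M12 M23.
Let t0124 : Prop := u024 ∘ u012 ▷ M24 = u014 ∘ M01 ◁ u124 ∘ assoc M01 M12 M24.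
Let t0134 : Prop := u034 ∘ u013 ▷ M34 = u014 ∘ M01 ◁ u134 ∘ assoc M01 M13 M34.
Let t0234 : Prop := u034 ∘ u023 ▷ M34 = u024 ∘ M02 ◁ u234 ∘ assoc M02 M23 M34.
Let t1234 : Prop := u134 ∘ u123 ▷ M34 = u124 ∘ M12 ◁ u234 ∘ assoc M12 M23 M34.

Lemma pentagon_p01 : t0123 -> p0 = p1.
Proof. by move=> e; rewrite -!rtensD e. Qed.

Lemma pentagon_p12 : t0134 -> p1 = p2.
Proof. by move=> e; rewrite (precomp _ e) -!compA. Qed.

(** The one comparison among the composites that uses the pentagon axiom. *)
Lemma pentagon_p23 : t1234 -> p2 = p3.
Proof.
move=> e; rewrite (precomp _ (assoc_natm _ _ _)) ltensDp e !ltensD -!compA.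
by rewrite pentagon (precomp _ (assoc_natr _ _ _)).
Qed.

Lemma pentagon_p34 : t0124 -> p4 = p3.
Proof. by move=> e; rewrite (precomp _ e) -!compA. Qed.

Lemma pentagon_p4 :
  p4 = (u024 ∘ M02 ◁ u234 ∘ assoc M02 M23 M34) ∘ u012 ▷ M23 ▷ M34.
Proof. by rewrite -!compA assoc_natl (precomp _ (interchange _ _)). Qed.

(** The faces give [p0 = p1] (0123), [p1 = p2] (0134), [p2 = p3] (1234), [p4 = p3] (0124) and
    [p0 = p4] (0234). Four of these imply the fifth, which is the missing condition precomposed with
    [u012 ▷ M23 ▷ M34]; [epi] cancels that factor. *)
Lemma pentagon_t0234 :
  (forall Z (f g : hom (M02 ⊗ M23 ⊗ M34) Z),
    f ∘ u012 ▷ M23 ▷ M34 = g ∘ u012 ▷ M23 ▷ M34 -> f = g) ->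
  t0123 -> t0124 -> t0134 -> t1234 -> t0234.
Proof.
move=> epi /pentagon_p01 e0 /pentagon_p34 e3 /pentagon_p12 e1 /pentagon_p23 e2.
by apply: epi; rewrite -pentagon_p4 -compA e0 e1 e2 e3.
Qed.

(** The missing equation is [p1 = p2], where [u123] and an associator have to be cancelled. *)
Lemma pentagon_t0134 :
  (forall Z (f g : hom (M01 ⊗ M13 ⊗ M34) Z),
    f ∘ (M01 ◁ u123) ▷ M34 = g ∘ (M01 ◁ u123) ▷ M34 -> f = g) ->
  t0123 -> t0124 -> t0234 -> t1234 -> t0134.
Proof.
move=> epi /pentagon_p01 e0 /pentagon_p34 e3 e4 /pentagon_p23 e2.
apply: epi; apply: assocr_epi; rewrite -!compA -e0 e2 -e3 pentagon_p4 -e4.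
by rewrite -!compA.
Qed.

(** The missing equation is [p4 = p3], where [u234] and an associator have to be cancelled. *)
Lemma pentagon_t0124 :
  (forall Z (f g : hom (M01 ⊗ M12 ⊗ M24) Z),
    f ∘ (M01 ⊗ M12) ◁ u234 = g ∘ (M01 ⊗ M12) ◁ u234 -> f = g) ->
  t0123 -> t0134 -> t0234 -> t1234 -> t0124.
Proof.
move=> epi /pentagon_p01 e0 /pentagon_p12 e1 e4 /pentagon_p23 e2.
apply: epi; apply: assoc_epi; rewrite -!compA -e2 -e1 -e0 pentagon_p4 -e4.
by rewrite -!compA.
Qed.

End Pentagon.

(** * Boundaries of 4-simplices in the nerve *)

Section FiveVertices.
Context (V0 : nat -> monoid C) (V1 : nat -> nat -> @nerve1 C)
  (V2 : nat -> nat -> nat -> nerve2).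
Hypothesis hV1 : forall a b, a < b < 5 -> edge (V0 a) (V0 b) (V1 a b).
Hypothesis hV2 : forall a b c, a < b < c -> c < 5 ->
  triangle_on (V1 a b) (V1 a c) (V1 b c) (V2 a b c).

Definition V_tetrahedron a b c d : Prop :=
  tetrahedron (V2 a b c) (V2 a b d) (V2 a c d) (V2 b c d).

Section Choices.
Context (a b c d : nat) (ab : a < b < 5) (bc : b < c < 5) (cd : c < d < 5)
  (ac : a < c < 5) (bd : b < d < 5) (ad : a < d < 5).

(** One typed bimodule is chosen per edge, so that all the maps [V_map] share their domains and
    codomains. The choice depends on the proof [ij], hence the fixed proofs [e01] to [e34] below. *)
Definition V_bimodule i j (ij : i < j < 5) : bimodule (V0 i) (V0 j) :=
  projT1 (cid (edgeP (hV1 ij))).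

Lemma V_bimoduleE i j (ij : i < j < 5) : V1 i j = Nerve1 (V_bimodule ij).
Proof. by rewrite /V_bimodule; case: cid. Qed.

Lemma V_map_ex : exists f : bimodule_map (V_bimodule ab ⊗b V_bimodule bc)
  (V_bimodule ac), V2 a b c = Nerve2 f.
Proof.
apply: triangleP; rewrite -!V_bimoduleE; apply: hV2.
  by move/andP: ab bc => [-> _] /andP[].
by move/andP: bc => [].
Qed.

Definition V_map := projT1 (cid V_map_ex).

Lemma V_mapE : V2 a b c = Nerve2 V_map.
Proof. by rewrite /V_map; case: cid. Qed.

End Choices.

Lemma V_tetrahedronP a b c d (ab : a < b < 5) (bc : b < c < 5) (cd : c < d < 5)
    (ac : a < c < 5) (bd : b < d < 5) (ad : a < d < 5) :
  V_tetrahedron a b c d <->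
  compatible (V_map ab bc ac) (V_map ac cd ad) (V_map ab bd ad) (V_map bc cd bd).
Proof.
rewrite /V_tetrahedron (V_mapE ab bc ac) (V_mapE ac cd ad) (V_mapE ab bd ad).
by rewrite (V_mapE bc cd bd); exact: tetrahedronP.
Qed.

Local Notation e01 := (isT : 0 < 1 < 5).
Local Notation e02 := (isT : 0 < 2 < 5).
Local Notation e03 := (isT : 0 < 3 < 5).
Local Notation e04 := (isT : 0 < 4 < 5).
Local Notation e12 := (isT : 1 < 2 < 5).
Local Notation e13 := (isT : 1 < 3 < 5).
Local Notation e14 := (isT : 1 < 4 < 5).
Local Notation e23 := (isT : 2 < 3 < 5).
Local Notation e24 := (isT : 2 < 4 < 5).
Local Notation e34 := (isT : 3 < 4 < 5).

Let t0123 := V_tetrahedronP e01 e12 e23 e02 e13 e03.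
Let t0124 := V_tetrahedronP e01 e12 e24 e02 e14 e04.
Let t0134 := V_tetrahedronP e01 e13 e34 e03 e14 e04.
Let t0234 := V_tetrahedronP e02 e23 e34 e03 e24 e04.
Let t1234 := V_tetrahedronP e12 e23 e34 e13 e24 e14.

(** [bilinear f012] is an isomorphism after a projection, and both remain epi after tensoring on the
    right; this is the cancellation that [pentagon_t0234] requires. *)
Lemma fill_face1 : invertible (V2 0 1 2) -> V_tetrahedron 0 1 2 3 ->
  V_tetrahedron 0 1 2 4 -> V_tetrahedron 0 1 3 4 -> V_tetrahedron 1 2 3 4 ->
  V_tetrahedron 0 2 3 4.
Proof.
rewrite (V_mapE e01 e12 e02) => /bimodule_isoE i012.
move=> /t0123/compatibleP c0123 /t0124/compatibleP c0124.
move=> /t0134/compatibleP c0134 /t1234/compatibleP c1234.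
apply/t0234/compatibleP.
apply: pentagon_t0234 c0123 c0124 c0134 c1234 => Z f g.
rewrite !rtensD !compA => /(rrtens_epi hC (bprojP T _ _)).
exact/isom_epi/isom_rtens/isom_rtens.
Qed.

Lemma fill_face2 : invertible (V2 1 2 3) -> V_tetrahedron 0 1 2 3 ->
  V_tetrahedron 0 1 2 4 -> V_tetrahedron 0 2 3 4 -> V_tetrahedron 1 2 3 4 ->
  V_tetrahedron 0 1 3 4.
Proof.
rewrite (V_mapE e12 e23 e13) => /bimodule_isoE i123.
move=> /t0123/compatibleP c0123 /t0124/compatibleP c0124.
move=> /t0234/compatibleP c0234 /t1234/compatibleP c1234.
apply/t0134/compatibleP.
apply: pentagon_t0134 c0123 c0124 c0234 c1234 => Z f g.
rewrite ltensD !rtensD !compA => /(lrtens_epi hC (bprojP T _ _)).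
exact/isom_epi/isom_rtens/isom_ltens.
Qed.

Lemma fill_face3 : invertible (V2 2 3 4) -> V_tetrahedron 0 1 2 3 ->
  V_tetrahedron 0 1 3 4 -> V_tetrahedron 0 2 3 4 -> V_tetrahedron 1 2 3 4 ->
  V_tetrahedron 0 1 2 4.
Proof.
rewrite (V_mapE e23 e34 e24) => /bimodule_isoE i234.
move=> /t0123/compatibleP c0123 /t0134/compatibleP c0134.
move=> /t0234/compatibleP c0234 /t1234/compatibleP c1234.
apply/t0124/compatibleP.
apply: pentagon_t0124 c0123 c0134 c0234 c1234 => Z f g.
rewrite ltensD !compA => /(ltens_epi hC (bprojP T _ _)).
exact/isom_epi/isom_ltens.
Qed.

(** The conditions on 0124 and 1234 make [f014 ∘ (M01 ⊗ f124)] and [f124 ∘ (M12 ⊗ f234)] invertible.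
    So [M01 ⊗ f124] is split mono, hence so is [f124], which is split epi as well; the other faces
    follow by cancellation. *)
Lemma two_of_six_cone :
  V_tetrahedron 0 1 2 4 -> V_tetrahedron 0 1 3 4 -> V_tetrahedron 1 2 3 4 ->
  equivalence_edge (V1 0 1) -> equivalence_edge (V1 1 2) ->
  invertible (V2 0 1 2) -> invertible (V2 0 1 3) -> invertible (V2 1 2 3) ->
  invertible (V2 0 2 4) -> invertible (V2 1 3 4) ->
  [/\ invertible (V2 0 1 4), invertible (V2 1 2 4), invertible (V2 2 3 4)
    & invertible (V2 0 3 4)].
Proof.
move=> /t0124 c0124 /t0134 c0134 /t1234 c1234.
rewrite /equivalence_edge (V_bimoduleE e01) (V_bimoduleE e12) /= => q01 q12.
rewrite (V_mapE e01 e12 e02) (V_mapE e01 e13 e03) (V_mapE e12 e23 e13).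
rewrite (V_mapE e02 e24 e04) (V_mapE e13 e34 e14) (V_mapE e01 e14 e04).
rewrite (V_mapE e12 e24 e14) (V_mapE e23 e34 e24) (V_mapE e03 e34 e04).
rewrite /invertible /= => /bimodule_isoE i012 /bimodule_isoE i013.
move=> /bimodule_isoE i123 /bimodule_isoE i024 /bimodule_isoE i134.
move: c0124 c0134 c1234; rewrite /compatible.
set f012 := V_map e01 e12 e02 in i012 *.
set f013 := V_map e01 e13 e03 in i013 *.
set f014 := V_map e01 e14 e04.
set f024 := V_map e02 e24 e04 in i024 *.
set f034 := V_map e03 e34 e04.
set f123 := V_map e12 e23 e13 in i123 *.
set f124 := V_map e12 e24 e14.
set f134 := V_map e13 e34 e14 in i134 *.
set f234 := V_map e23 e34 e24.
move=> c0124 c0134 c1234.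
have ri A B D (M M' : bimodule A B) (N : bimodule B D) (f : bimodule_map M M') :
    isom f -> isom (btens_map T f (bimodule_id N)).
  by move=> fi; apply: isom_btens_map => //; exact: isom_id.
have li A B D (M : bimodule A B) (N N' : bimodule B D) (f : bimodule_map N N') :
    isom f -> isom (btens_map T (bimodule_id M) f).
  by move=> fi; apply: isom_btens_map => //; exact: isom_id.
have i0124 : isom (f014 ∘ btens_map T (bimodule_id _) f124).
  apply: (isom_cancel_r (isom_btens_assoc hC T _ _ _)).
  by rewrite -compA -c0124; apply: isom_comp => //; exact: ri.
have i1234 : isom (f124 ∘ btens_map T (bimodule_id _) f234).
  apply: (isom_cancel_r (isom_btens_assoc hC T _ _ _)).
  by rewrite -compA -c1234; apply: isom_comp => //; exact: ri.
have i124 : isom f124.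
  have /bimodule_isoE[k [kl _]] :
      isom (bimodule_comp f014 (btens_bmap hC T (bimodule_id _) f124)) by [].
  (* [k] inverts [f014 ∘ (M01 ⊗ f124)], so [k ∘ f014] is a retraction of [M01 ⊗ f124]. *)
  have kl' : bimodule_comp k f014 ∘ btens_map T (bimodule_id _) f124 = idm _.
    by rewrite -[LHS]compA.
  have [h hl] := equivalence_split_mono q01 kl'.
  have [r [_ rr]] := i1234.
  apply: (@isom_split _ _ _ _ h (btens_map T (bimodule_id _) f234 ∘ r)) => //.
  by rewrite compA.
have i014 : isom f014 by apply: isom_cancel_r i0124; exact: li.
have i234 : isom f234.
  apply: (equivalence_reflects_iso q12); exact: isom_cancel_l i1234.
split; apply/bimodule_isoE => //.
(* Only [f034] remains: [c0134] writes [f034 ∘ (f013 ⊗ M34)] as a composite of isomorphisms. *)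
apply: (@isom_cancel_r _ _ _ _ _ (btens_map T f013 (bimodule_id _))).
  exact: ri.
rewrite c0134; apply: isom_comp => //; apply: isom_comp; first exact: li.
exact: isom_btens_assoc.
Qed.

End FiveVertices.
End NerveSimplices.

(** * Simplices of the coskeleton *)

Section OrdmapOfSeq.
Context (n m : nat).
Implicit Types s : seq nat.

(** Vertex lists of simplices of Δ[m]; [n] is the number of vertices, not the dimension. *)
Definition chain s : bool :=
  [&& sorted leq s, all (fun a => a <= m) s & size s == n].

Definition chain_fun s (i : 'I_n) : 'I_m.+1 :=
  if chain s then inord (nth 0 s i) else ord0.

Lemma chain_funE s i : chain s -> chain_fun s i = nth 0 s i :> nat.
Proof.
rewrite /chain_fun => h; rewrite h inordK // ltnS.
case/and3P: h => _ /(all_nthP 0) h /eqP sn; apply: h.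
by rewrite sn.
Qed.

Lemma chain_fun_homo s (i j : 'I_n) :
  i <= j -> chain_fun s i <= chain_fun s j.
Proof.
move=> ij; case h: (chain s); last by rewrite /chain_fun h.
rewrite !chain_funE //; case/and3P: h => h _ /eqP sn.
by apply: (sorted_leq_nth leq_trans leqnn 0 h) => //; rewrite inE sn.
Qed.

(* The map of ordinals with values [s]; junk unless [chain s]. *)
Definition ordmap_of s : ordmap n m.+1 := Ordmap (@chain_fun_homo s).

Lemma ordmap_ofE s i : chain s -> ordmap_of s i = nth 0 s i :> nat.
Proof. exact: chain_funE. Qed.

End OrdmapOfSeq.

Arguments chain n m s : clear implicits.
Arguments ordmap_of n m s : clear implicits.

Lemma chain_seq2 m a b : a < b <= m -> chain 2 m [:: a; b].
Proof. by rewrite /chain /=; lia. Qed.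

Lemma chain_seq3 m a b c : a < b -> b < c <= m -> chain 3 m [:: a; b; c].
Proof. by rewrite /chain /=; lia. Qed.

Lemma chain_seq4 m a b c d : a < b -> b < c -> c < d <= m ->
  chain 4 m [:: a; b; c; d].
Proof. by rewrite /chain /=; lia. Qed.

Lemma lift_inord n i j : i <= n.+1 -> j <= n ->
  lift (inord i : 'I_n.+2) (inord j : 'I_n.+1) = inord (bump i j).
Proof.
move=> hi hj; apply: val_inj; rewrite /= !inordK //.
by rewrite ltnS /bump -add1n leq_add // leq_b1.
Qed.

Lemma ord_inord n (i : 'I_n.+1) : exists2 k, k <= n & i = inord k.
Proof. by exists i; rewrite ?inord_val // -ltnS. Qed.

Lemma coface_inord n m (x : ordmap n.+2 m) i j : i <= n.+1 -> j <= n ->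
  ordmap_comp x (coface (inord i)) (inord j) = x (inord (bump i j)).
Proof. by move=> hi hj; rewrite /= lift_inord. Qed.

Lemma codegen_inord n m (x : ordmap n.+1 m) i j : i <= n -> j <= n.+1 ->
  ordmap_comp x (codegen (inord i)) (inord j) = x (inord (unbump i j)).
Proof.
move=> hi hj /=; congr (x _); apply: val_inj; rewrite /= !inordK //.
rewrite /unbump; lia.
Qed.

(** Off [k], [bump k] undoes [unbump k]; at [k] the composite is [k.+1], where [x] takes the same
    value. *)
Lemma ordmap_degenerate n m (x : ordmap n.+2 m.+1) k :
  k <= n -> x (inord k) = x (inord k.+1) :> nat ->
  ordmap_comp (ordmap_comp x (coface (inord k))) (codegen (inord k)) = x.
Proof.
move=> kn xk; apply: ordmap_eq => i; have [j hj {i}->] := ord_inord i.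
have hu : unbump k j <= n by rewrite /unbump; lia.
rewrite codegen_inord // coface_inord //; last by lia.
have [->|jk] := eqVneq j k.
  by apply: val_inj; rewrite /= [RHS]xk /unbump /bump ltnn subn0 leqnn.
by rewrite unbumpK // inE.
Qed.

Lemma ordmap_inord_le n m (x : ordmap n.+1 m.+1) i j : i <= j <= n ->
  x (inord i) <= x (inord j) <= m.
Proof.
case/andP=> ij jn; rewrite -[_ <= m]ltnS ltn_ord andbT.
by apply: ordfun_homo; rewrite !inordK // ltnS // (leq_trans ij).
Qed.

Lemma ordmap_chain n m (x : ordmap n.+1 m.+1) :
  chain n.+1 m (mkseq (fun i => x (inord i) : nat) n.+1).
Proof.
apply/and3P; split; last by rewrite size_mkseq.
  apply/(sortedP 0) => i; rewrite size_mkseq => hi.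
  rewrite !nth_mkseq ?(ltnW hi) //; apply: ordfun_homo.
  by rewrite !inordK // ltnW.
by apply/allP => a /mapP[i _ ->]; rewrite -ltnS.
Qed.

Lemma ordmap_eta n m (x : ordmap n.+1 m.+1) :
  x = ordmap_of n.+1 m (mkseq (fun i => x (inord i) : nat) n.+1).
Proof.
apply: ordmap_eq => i; apply: val_inj; have h := ordmap_chain x.
by rewrite /= chain_funE // nth_mkseq // inord_val.
Qed.

Lemma ordmap_of_coface n m k s : k <= n.+1 -> chain n.+2 m s ->
  ordmap_comp (ordmap_of n.+2 m s) (coface (inord k))
  = ordmap_of n.+1 m (take k s ++ drop k.+1 s).
Proof.
move=> kn h; case/and3P: (h) => h1 h2 /eqP h3.
have sub : subseq (take k s ++ drop k.+1 s) s.
  rewrite -{3}(cat_take_drop k s) cat_subseq //.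
  by rewrite -[k.+1]add1n -drop_drop; exact: drop_subseq.
have h' : chain n.+1 m (take k s ++ drop k.+1 s).
  apply/and3P; split.
  - exact: (subseq_sorted leq_trans sub).
  - by apply/allP => a /(mem_subseq sub); move/allP: h2; apply.
  - by rewrite size_cat size_take size_drop h3 ltnS kn subSS addnC subnK.
apply: ordmap_eq => i; apply: val_inj; rewrite /= !chain_funE //= inordK //.
rewrite nth_cat size_take nth_drop h3 ltnS kn /bump.
case: leqP => ki; last by rewrite nth_take.
by rewrite (_ : k.+1 + (i - k) = 1 + i) //; lia.
Qed.

Section NatIdentities.
Context {T : trunc3}.

Lemma face2_degen1_eq i j (x : tr1 T) : j <= 1 -> j <= i <= j.+1 ->
  face2 (inord i) (degen1 (inord j) x) = x.
Proof. by move=> hj hij; apply: face_degen1_eq; rewrite !inordK; lia. Qed.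

Lemma face2_degen1_lt i j (x : tr1 T) : j <= 1 -> i < j ->
  face2 (inord i) (degen1 (inord j) x)
  = degen0 (inord j.-1) (face1 (inord i) x).
Proof. by move=> hj hij; rewrite face_degen1_lt; rewrite !inordK //; lia. Qed.

Lemma face2_degen1_gt i j (x : tr1 T) : i <= 2 -> j.+1 < i ->
  face2 (inord i) (degen1 (inord j) x)
  = degen0 (inord j) (face1 (inord i.-1) x).
Proof. by move=> hj hij; rewrite face_degen1_gt; rewrite !inordK //; lia. Qed.

Lemma face3_degen2_eq i j (x : tr2 T) : j <= 2 -> j <= i <= j.+1 ->
  face3 (inord i) (degen2 (inord j) x) = x.
Proof. by move=> hj hij; apply: face_degen2_eq; rewrite !inordK; lia. Qed.

Lemma face3_degen2_lt i j (x : tr2 T) : j <= 2 -> i < j ->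
  face3 (inord i) (degen2 (inord j) x)
  = degen1 (inord j.-1) (face2 (inord i) x).
Proof. by move=> hj hij; rewrite face_degen2_lt; rewrite !inordK //; lia. Qed.

Lemma face3_degen2_gt i j (x : tr2 T) : i <= 3 -> j.+1 < i ->
  face3 (inord i) (degen2 (inord j) x)
  = degen1 (inord j) (face2 (inord i.-1) x).
Proof. by move=> hj hij; rewrite face_degen2_gt; rewrite !inordK //; lia. Qed.

Lemma degen2_degen1 i j (x : tr1 T) : i <= j -> j <= 1 ->
  degen2 (inord i) (degen1 (inord j) x)
  = degen2 (inord j.+1) (degen1 (inord i) x).
Proof.
move=> ij j1; have := @degen_degen1 T (inord i) (inord j) x.
by rewrite !inordK; [apply|lia..].
Qed.

End NatIdentities.

(** * Simplices of the coskeleton from values on strictly increasing tuples *)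

Section CoskeletonExtension.
Context (T : trunc3) (m : nat).
Context (V0 : nat -> tr0 T) (V1 : nat -> nat -> tr1 T)
  (V2 : nat -> nat -> nat -> tr2 T) (V3 : nat -> nat -> nat -> nat -> tr3 T).

(* The degeneracy is taken at the first repetition, so that only the simplicial
   identities between degeneracies are needed to treat the other ones. *)
Definition W1 a b := if a == b then degen0 (inord 0) (V0 b) else V1 a b.

Definition W2 a b c :=
  if a == b then degen1 (inord 0) (W1 b c)
  else if b == c then degen1 (inord 1) (W1 a c) else V2 a b c.

Definition W3 a b c d :=
  if a == b then degen2 (inord 0) (W2 b c d)
  else if b == c then degen2 (inord 1) (W2 a c d)
  else if c == d then degen2 (inord 2) (W2 a b d) else V3 a b c d.

Lemma W1_degen a : W1 a a = degen0 (inord 0) (V0 a).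
Proof. by rewrite /W1 eqxx. Qed.

Lemma W2_degen0 a b : W2 a a b = degen1 (inord 0) (W1 a b).
Proof. by rewrite /W2 eqxx. Qed.

(** Only [a = b] needs an argument: there the definition uses the first repetition, and the identity
    [s0 s0 = s1 s0] turns it into the second. *)
Lemma W2_degen1 a b : W2 a b b = degen1 (inord 1) (W1 a b).
Proof.
rewrite /W2 eqxx; case: eqP => // <-; rewrite W1_degen.
by have := @degen_degen0 T (inord 0) (inord 0) (V0 a); rewrite !inordK //; apply.
Qed.

Lemma W3_degen0 a b c : W3 a a b c = degen2 (inord 0) (W2 a b c).
Proof. by rewrite /W3 eqxx. Qed.

Lemma W3_degen1 a b c : W3 a b b c = degen2 (inord 1) (W2 a b c).
Proof.
rewrite /W3 eqxx; case: eqP => // <-.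
by rewrite W2_degen0 degen2_degen1.
Qed.

Lemma W3_degen2 a b c : W3 a b c c = degen2 (inord 2) (W2 a b c).
Proof.
rewrite /W3 eqxx; case: eqP => [<-|ab].
  by rewrite W2_degen1 W2_degen0 degen2_degen1.
case: eqP => // <-.
by rewrite W2_degen1 degen2_degen1.
Qed.

Hypothesis V1_face : forall a b, a < b <= m ->
  face1 (inord 0) (V1 a b) = V0 b /\ face1 (inord 1) (V1 a b) = V0 a.
Hypothesis V2_face : forall a b c, a < b -> b < c <= m ->
  [/\ face2 (inord 0) (V2 a b c) = V1 b c, face2 (inord 1) (V2 a b c) = V1 a c
    & face2 (inord 2) (V2 a b c) = V1 a b].
Hypothesis V3_face : forall a b c d, a < b -> b < c -> c < d <= m ->
  [/\ face3 (inord 0) (V3 a b c d) = V2 b c d,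
      face3 (inord 1) (V3 a b c d) = V2 a c d,
      face3 (inord 2) (V3 a b c d) = V2 a b d
    & face3 (inord 3) (V3 a b c d) = V2 a b c].

Lemma W1_face a b : a <= b <= m ->
  face1 (inord 0) (W1 a b) = V0 b /\ face1 (inord 1) (W1 a b) = V0 a.
Proof.
case/andP; rewrite leq_eqVlt => /orP[/eqP->|ab] bm.
  by rewrite W1_degen !face_degen0.
by rewrite /W1 ltn_eqF //; apply: V1_face; rewrite ab.
Qed.

Lemma W2_face a b c : a <= b -> b <= c <= m ->
  [/\ face2 (inord 0) (W2 a b c) = W1 b c, face2 (inord 1) (W2 a b c) = W1 a c
    & face2 (inord 2) (W2 a b c) = W1 a b].
Proof.
move=> ab /andP[bc cm].
move: ab bc; rewrite leq_eqVlt => /orP[/eqP<-|ab] bc.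
  have [e0 e1] := W1_face (introT andP (conj bc cm)).
  rewrite W2_degen0; split; try by rewrite face2_degen1_eq.
  by rewrite face2_degen1_gt //= e1 W1_degen.
move: bc; rewrite leq_eqVlt => /orP[/eqP ebc|bc].
  rewrite -{}ebc in cm *; have [|e0 e1] := @W1_face a b.
    by rewrite (ltnW ab).
  rewrite W2_degen1; split; try by rewrite face2_degen1_eq.
  by rewrite face2_degen1_lt //= e0 W1_degen.
by rewrite /W2 /W1 !ltn_eqF // ?(ltn_trans ab) //; apply: V2_face; rewrite ?bc.
Qed.

(** Case split at the leftmost repetition: strict tuples are covered by [V3_face], the others by the
    identities between faces and degeneracies. *)
Lemma W3_face a b c d : a <= b -> b <= c -> c <= d <= m ->
  [/\ face3 (inord 0) (W3 a b c d) = W2 b c d,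
      face3 (inord 1) (W3 a b c d) = W2 a c d,
      face3 (inord 2) (W3 a b c d) = W2 a b d
    & face3 (inord 3) (W3 a b c d) = W2 a b c].
Proof.
move=> ab bc /andP[cd dm]; have cm := leq_trans cd dm.
move: ab bc; rewrite leq_eqVlt => /orP[/eqP<-|ab] bc.
  have [||e0 e1 e2] := @W2_face a c d => //; first by rewrite cd.
  rewrite W3_degen0; split; try by rewrite face3_degen2_eq.
    by rewrite face3_degen2_gt //= e1 W2_degen0.
  by rewrite face3_degen2_gt //= e2 W2_degen0.
move: bc cd; rewrite leq_eqVlt => /orP[/eqP ebc|bc].
  rewrite -{}ebc in cm *; move=> bd; have [|e0 e1 e2] := @W2_face a b d (ltnW ab).
    by rewrite bd.
  rewrite W3_degen1; split; try by rewrite face3_degen2_eq.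
    by rewrite face3_degen2_lt //= e0 W2_degen0.
  by rewrite face3_degen2_gt //= e2 W2_degen1.
rewrite leq_eqVlt => /orP[/eqP ecd|cd].
  rewrite -{}ecd in dm *; have [|e0 e1 e2] := @W2_face a b c (ltnW ab).
    by rewrite (ltnW bc).
  rewrite W3_degen2; split; try by rewrite face3_degen2_eq.
    by rewrite face3_degen2_lt //= e0 W2_degen1.
  by rewrite face3_degen2_lt //= e1 W2_degen1.
have ac := ltn_trans ab bc; have bd := ltn_trans bc cd.
rewrite /W3 /W2 !ltn_eqF //; apply: V3_face => //.
by rewrite cd.
Qed.

Definition cosk_of_nat : cosk_simplex T m.
Proof.
refine (@CoskSimplex T m
  (fun x => V0 (x (inord 0)))
  (fun x => W1 (x (inord 0)) (x (inord 1)))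
  (fun x => W2 (x (inord 0)) (x (inord 1)) (x (inord 2)))
  (fun x => W3 (x (inord 0)) (x (inord 1)) (x (inord 2)) (x (inord 3)))
  _ _ _ _ _ _) => i x; have [k hk {i}->] := ord_inord i.
- have [e0 e1] := W1_face (ordmap_inord_le x (isT : 0 <= 1 <= 1)).
  by case: k hk => [|[|k]] // _; rewrite coface_inord.
- have [|e0 e1 e2] := @W2_face (x (inord 0)) (x (inord 1)) (x (inord 2)) _
    (ordmap_inord_le x (isT : 1 <= 2 <= 2)).
    by case/andP: (ordmap_inord_le x (isT : 0 <= 1 <= 2)).
  by case: k hk => [|[|[|k]]] // _; rewrite !coface_inord.
- have [||e0 e1 e2 e3] := @W3_face (x (inord 0)) (x (inord 1)) (x (inord 2))
    (x (inord 3)) _ _ (ordmap_inord_le x (isT : 2 <= 3 <= 3)).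
  + by case/andP: (ordmap_inord_le x (isT : 0 <= 1 <= 3)).
  + by case/andP: (ordmap_inord_le x (isT : 1 <= 2 <= 3)).
  by case: k hk => [|[|[|[|k]]]] // _; rewrite !coface_inord.
- case: k hk => [|k] // _; rewrite !codegen_inord //=.
  by rewrite W1_degen.
- case: k hk => [|[|k]] // _; rewrite !codegen_inord //=.
    by rewrite W2_degen0.
  by rewrite W2_degen1.
- case: k hk => [|[|[|k]]] // _; rewrite !codegen_inord //=.
  + by rewrite W3_degen0.
  + by rewrite W3_degen1.
  + by rewrite W3_degen2.
Defined.

End CoskeletonExtension.

(** * Maps into the coskeleton and their extension from subcomplexes of a simplex *)

Section Evaluation.
Context (T : trunc3) (A : sset) (f : smap A (cosk T)).

(** By naturality these values, in dimensions at most 3, determine a map into [cosk T]; [cosk0_eval]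
    to [cosk3_eval] recover all its components. *)
Definition eval0 (a : A 0) : tr0 T := cosk0 (f 0 a) (ordmap_id 1).
Definition eval1 (a : A 1) : tr1 T := cosk1 (f 1 a) (ordmap_id 2).
Definition eval2 (a : A 2) : tr2 T := cosk2 (f 2 a) (ordmap_id 3).
Definition eval3 (a : A 3) : tr3 T := cosk3 (f 3 a) (ordmap_id 4).

Lemma cosk0_eval n (a : A n) h : cosk0 (f n a) h = eval0 (sact h a).
Proof.
by rewrite /eval0 sfun_nat /=; congr cosk0; apply: ordmap_eq.
Qed.

Lemma cosk1_eval n (a : A n) h : cosk1 (f n a) h = eval1 (sact h a).
Proof.
by rewrite /eval1 sfun_nat /=; congr cosk1; apply: ordmap_eq.
Qed.

Lemma cosk2_eval n (a : A n) h : cosk2 (f n a) h = eval2 (sact h a).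
Proof.
by rewrite /eval2 sfun_nat /=; congr cosk2; apply: ordmap_eq.
Qed.

Lemma cosk3_eval n (a : A n) h : cosk3 (f n a) h = eval3 (sact h a).
Proof.
by rewrite /eval3 sfun_nat /=; congr cosk3; apply: ordmap_eq.
Qed.

Lemma eval_face1 i (a : A 1) : face1 i (eval1 a) = eval0 (sact (coface i) a).
Proof.
by rewrite cosk_face1 -cosk0_eval; congr cosk0; apply: ordmap_eq.
Qed.

Lemma eval_face2 i (a : A 2) : face2 i (eval2 a) = eval1 (sact (coface i) a).
Proof.
by rewrite cosk_face2 -cosk1_eval; congr cosk1; apply: ordmap_eq.
Qed.

Lemma eval_face3 i (a : A 3) : face3 i (eval3 a) = eval2 (sact (coface i) a).
Proof.
by rewrite cosk_face3 -cosk2_eval; congr cosk2; apply: ordmap_eq.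
Qed.

Lemma eval_degen0 i (a : A 0) : degen0 i (eval0 a) = eval1 (sact (codegen i) a).
Proof.
by rewrite cosk_degen0 -cosk1_eval; congr cosk1; apply: ordmap_eq.
Qed.

Lemma eval_degen1 i (a : A 1) : degen1 i (eval1 a) = eval2 (sact (codegen i) a).
Proof.
by rewrite cosk_degen1 -cosk2_eval; congr cosk2; apply: ordmap_eq.
Qed.

Lemma eval_degen2 i (a : A 2) : degen2 i (eval2 a) = eval3 (sact (codegen i) a).
Proof.
by rewrite cosk_degen2 -cosk3_eval; congr cosk3; apply: ordmap_eq.
Qed.

End Evaluation.

Section SubsimplexExtension.
Context (T : trunc3) (m : nat) (E : marking (simplex m.+1)).
Context (P : forall n, mark E n -> Prop) (hP : subsset_closed P).
Context (f : smap (subsset hP) (cosk T)).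
Context (V0 : nat -> tr0 T) (V1 : nat -> nat -> tr1 T)
  (V2 : nat -> nat -> nat -> tr2 T) (V3 : nat -> nat -> nat -> nat -> tr3 T).

Local Notation "x @ i" := (nat_of_ord (ordfun x (inord i))) (at level 20).

Hypothesis V0_eval : forall (x : ordmap 1 m.+1) (hx : P (n := 0) x),
  V0 (x @ 0) = eval0 f (exist (@P 0) x hx).
Hypothesis V1_eval : forall (x : ordmap 2 m.+1) (hx : P (n := 1) x),
  x @ 0 < x @ 1 -> V1 (x @ 0) (x @ 1) = eval1 f (exist (@P 1) x hx).
Hypothesis V2_eval : forall (x : ordmap 3 m.+1) (hx : P (n := 2) x),
  x @ 0 < x @ 1 -> x @ 1 < x @ 2 ->
  V2 (x @ 0) (x @ 1) (x @ 2) = eval2 f (exist (@P 2) x hx).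
Hypothesis V3_eval : forall (x : ordmap 4 m.+1) (hx : P (n := 3) x),
  x @ 0 < x @ 1 -> x @ 1 < x @ 2 -> x @ 2 < x @ 3 ->
  V3 (x @ 0) (x @ 1) (x @ 2) (x @ 3) = eval3 f (exist (@P 3) x hx).

(** With a repeated vertex, [x] is a degeneracy of one of its faces, which lies in [P] since [P] is
    closed under faces. *)
Lemma W1_eval (x : ordmap 2 m.+1) (hx : P (n := 1) x) :
  W1 V0 V1 (x @ 0) (x @ 1) = eval1 f (exist (@P 1) x hx).
Proof.
rewrite /W1; case: eqP => [e01|/eqP n01]; last first.
  by apply: V1_eval; rewrite ltn_neqAle n01 (ordfun_homo x) // !inordK.
have hx' := hP (coface (inord 0)) hx.
have := V0_eval hx'; rewrite coface_inord //= => ->.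
rewrite eval_degen0; congr eval1; apply: eq_exist => /=.
exact: ordmap_degenerate.
Qed.

Lemma W2_eval (x : ordmap 3 m.+1) (hx : P (n := 2) x) :
  W2 V0 V1 V2 (x @ 0) (x @ 1) (x @ 2) = eval2 f (exist (@P 2) x hx).
Proof.
rewrite /W2; case: eqP => [e01|/eqP n01].
  have hx' := hP (coface (inord 0)) hx.
  have := W1_eval hx'; rewrite !coface_inord //= => ->.
  rewrite eval_degen1; congr eval2; apply: eq_exist => /=.
  exact: ordmap_degenerate.
case: eqP => [e12|/eqP n12].
  have hx' := hP (coface (inord 1)) hx.
  have := W1_eval hx'; rewrite !coface_inord //= => ->.
  rewrite eval_degen1; congr eval2; apply: eq_exist => /=.
  exact: ordmap_degenerate.
by apply: V2_eval; rewrite ltn_neqAle ?n01 ?n12 (ordfun_homo x) // !inordK.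
Qed.

Lemma W3_eval (x : ordmap 4 m.+1) (hx : P (n := 3) x) :
  W3 V0 V1 V2 V3 (x @ 0) (x @ 1) (x @ 2) (x @ 3) = eval3 f (exist (@P 3) x hx).
Proof.
rewrite /W3; case: eqP => [e01|/eqP n01].
  have hx' := hP (coface (inord 0)) hx.
  have := W2_eval hx'; rewrite !coface_inord //= => ->.
  rewrite eval_degen2; congr eval3; apply: eq_exist => /=.
  exact: ordmap_degenerate.
case: eqP => [e12|/eqP n12].
  have hx' := hP (coface (inord 1)) hx.
  have := W2_eval hx'; rewrite !coface_inord //= => ->.
  rewrite eval_degen2; congr eval3; apply: eq_exist => /=.
  exact: ordmap_degenerate.
case: eqP => [e23|/eqP n23].
  have hx' := hP (coface (inord 2)) hx.
  have := W2_eval hx'; rewrite !coface_inord //= => ->.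
  rewrite eval_degen2; congr eval3; apply: eq_exist => /=.
  exact: ordmap_degenerate.
by apply: V3_eval; rewrite ltn_neqAle ?n01 ?n12 ?n23 (ordfun_homo x) // !inordK.
Qed.

Hypothesis V1_face : forall a b, a < b <= m ->
  face1 (inord 0) (V1 a b) = V0 b /\ face1 (inord 1) (V1 a b) = V0 a.
Hypothesis V2_face : forall a b c, a < b -> b < c <= m ->
  [/\ face2 (inord 0) (V2 a b c) = V1 b c, face2 (inord 1) (V2 a b c) = V1 a c
    & face2 (inord 2) (V2 a b c) = V1 a b].
Hypothesis V3_face : forall a b c d, a < b -> b < c -> c < d <= m ->
  [/\ face3 (inord 0) (V3 a b c d) = V2 b c d,
      face3 (inord 1) (V3 a b c d) = V2 a c d,
      face3 (inord 2) (V3 a b c d) = V2 a b d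
    & face3 (inord 3) (V3 a b c d) = V2 a b c].

(** Agreement on strictly increasing tuples suffices, since degeneracies force the other values. The
    second conclusion gives access to the nondegenerate triangles of [y], whose marking matters when
    a 2-horn is filled. *)
Lemma cosk_extension : exists y : cosk_simplex T m,
  (forall n (a : subsset hP n), cosk_act (sval a) y = f n a) /\
  (forall a b c (x : ordmap 3 m.+1), a < b -> b < c ->
        x @ 0 = a -> x @ 1 = b -> x @ 2 = c -> cosk2 y x = V2 a b c).
Proof.
exists (cosk_of_nat V1_face V2_face V3_face); split.
- move=> n [x hx]; apply: cosk_simplex_eq => h /=.
  + rewrite cosk0_eval; apply: etrans (V0_eval (hP h hx)) _.
    by congr eval0; apply: eq_exist.
  + rewrite cosk1_eval; apply: etrans (W1_eval (hP h hx)) _.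
    by congr eval1; apply: eq_exist.
  + rewrite cosk2_eval; apply: etrans (W2_eval (hP h hx)) _.
    by congr eval2; apply: eq_exist.
  + rewrite cosk3_eval; apply: etrans (W3_eval (hP h hx)) _.
    by congr eval3; apply: eq_exist.
- by move=> a b c x ab bc xa xb xc /=; rewrite xa xb xc /W2 !ltn_eqF.
Qed.

End SubsimplexExtension.

(** * Lifting properties *)

Section PartialValues.
Context (T : trunc3) (m : nat) (E : marking (simplex m.+1)).
Context (P : forall n, mark E n -> Prop) (hP : subsset_closed P).
Context (f : smap (subsset hP) (cosk T)).

Let Ps n s : Prop := @P n (ordmap_of n.+1 m s).

(** The value of [f] where the simplex lies in [P], and a filler [t] elsewhere. A single filler per
    dimension is enough for horns, which miss only one face and the top simplex. *)
Definition value0 t a : tr0 T :=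
  if pselect (Ps 0 [:: a]) is left h then eval0 f (exist (@P 0) _ h) else t.
Definition value1 t a b : tr1 T :=
  if pselect (Ps 1 [:: a; b]) is left h then eval1 f (exist (@P 1) _ h) else t.
Definition value2 t a b c : tr2 T :=
  if pselect (Ps 2 [:: a; b; c]) is left h then eval2 f (exist (@P 2) _ h)
  else t.
Definition value3 t a b c d : tr3 T :=
  if pselect (Ps 3 [:: a; b; c; d]) is left h then eval3 f (exist (@P 3) _ h)
  else t.

Lemma value0E t a (h : Ps 0 [:: a]) : value0 t a = eval0 f (exist (@P 0) _ h).
Proof.
rewrite /value0; case: pselect => // h'.
by congr eval0; apply: eq_exist.
Qed.

Lemma value1E t a b (h : Ps 1 [:: a; b]) :
  value1 t a b = eval1 f (exist (@P 1) _ h).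
Proof.
rewrite /value1; case: pselect => // h'.
by congr eval1; apply: eq_exist.
Qed.

Lemma value2E t a b c (h : Ps 2 [:: a; b; c]) :
  value2 t a b c = eval2 f (exist (@P 2) _ h).
Proof.
rewrite /value2; case: pselect => // h'.
by congr eval2; apply: eq_exist.
Qed.

Lemma value3E t a b c d (h : Ps 3 [:: a; b; c; d]) :
  value3 t a b c d = eval3 f (exist (@P 3) _ h).
Proof.
rewrite /value3; case: pselect => // h'.
by congr eval3; apply: eq_exist.
Qed.

Lemma value1_out t a b : ~ Ps 1 [:: a; b] -> value1 t a b = t.
Proof. by rewrite /value1; case: pselect. Qed.

Lemma value2_out t a b c : ~ Ps 2 [:: a; b; c] -> value2 t a b c = t.
Proof. by rewrite /value2; case: pselect. Qed.

Lemma value3_out t a b c d : ~ Ps 3 [:: a; b; c; d] -> value3 t a b c d = t.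
Proof. by rewrite /value3; case: pselect. Qed.

Lemma Ps_face n s k : k <= n.+1 -> chain n.+2 m s -> Ps n.+1 s ->
  Ps n (take k s ++ drop k.+1 s).
Proof.
by move=> kn hs /(hP (coface (inord k))); rewrite /= ordmap_of_coface.
Qed.

Lemma value1_face t t' a b : a < b <= m -> Ps 1 [:: a; b] ->
  face1 (inord 0) (value1 t a b) = value0 t' b /\
  face1 (inord 1) (value1 t a b) = value0 t' a.
Proof.
move=> hab h; have hs := chain_seq2 hab.
rewrite (value1E _ h) !eval_face1.
rewrite (value0E t' (Ps_face (isT : 0 <= 1) hs h)).
rewrite (value0E t' (Ps_face (isT : 1 <= 1) hs h)).
by split; congr eval0; apply: eq_exist; rewrite /= ordmap_of_coface.
Qed.

Lemma value2_face t t' a b c : a < b -> b < c <= m -> Ps 2 [:: a; b; c] ->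
  [/\ face2 (inord 0) (value2 t a b c) = value1 t' b c,
      face2 (inord 1) (value2 t a b c) = value1 t' a c
    & face2 (inord 2) (value2 t a b c) = value1 t' a b].
Proof.
move=> hab hbc h; have hs := chain_seq3 hab hbc.
rewrite (value2E _ h) !eval_face2.
rewrite (value1E t' (Ps_face (isT : 0 <= 2) hs h)).
rewrite (value1E t' (Ps_face (isT : 1 <= 2) hs h)).
rewrite (value1E t' (Ps_face (isT : 2 <= 2) hs h)).
by split; congr eval1; apply: eq_exist; rewrite /= ordmap_of_coface.
Qed.

Lemma value3_face t t' a b c d : a < b -> b < c -> c < d <= m ->
  Ps 3 [:: a; b; c; d] ->
  [/\ face3 (inord 0) (value3 t a b c d) = value2 t' b c d,
      face3 (inord 1) (value3 t a b c d) = value2 t' a c d,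
      face3 (inord 2) (value3 t a b c d) = value2 t' a b d
    & face3 (inord 3) (value3 t a b c d) = value2 t' a b c].
Proof.
move=> hab hbc hcd h.
have hs := chain_seq4 hab hbc hcd.
rewrite (value3E _ h) !eval_face3.
rewrite (value2E t' (Ps_face (isT : 0 <= 3) hs h)).
rewrite (value2E t' (Ps_face (isT : 1 <= 3) hs h)).
rewrite (value2E t' (Ps_face (isT : 2 <= 3) hs h)).
rewrite (value2E t' (Ps_face (isT : 3 <= 3) hs h)).
by split; congr eval2; apply: eq_exist; rewrite /= ordmap_of_coface.
Qed.

Context (t0 : tr0 T) (t1 : tr1 T) (t2 : tr2 T) (t3 : tr3 T).
Hypothesis t1_face : forall a b, a < b <= m -> ~ Ps 1 [:: a; b] ->
  face1 (inord 0) t1 = value0 t0 b /\ face1 (inord 1) t1 = value0 t0 a.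
Hypothesis t2_face : forall a b c, a < b -> b < c <= m -> ~ Ps 2 [:: a; b; c] ->
  [/\ face2 (inord 0) t2 = value1 t1 b c, face2 (inord 1) t2 = value1 t1 a c
    & face2 (inord 2) t2 = value1 t1 a b].
Hypothesis t3_face : forall a b c d, a < b -> b < c -> c < d <= m ->
  ~ Ps 3 [:: a; b; c; d] ->
  [/\ face3 (inord 0) t3 = value2 t2 b c d, face3 (inord 1) t3 = value2 t2 a c d,
      face3 (inord 2) t3 = value2 t2 a b d & face3 (inord 3) t3 = value2 t2 a b c].

(** Simplices of [P] have their faces in [P], so incidence has to be assumed only for the
    fillers. *)
Lemma partial_extension : exists y : cosk_simplex T m,
  (forall n (a : subsset hP n), cosk_act (sval a) y = f n a) /\
  (forall a b c (x : ordmap 3 m.+1), a < b -> b < c ->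
        x (inord 0) = a :> nat -> x (inord 1) = b :> nat ->
        x (inord 2) = c :> nat -> cosk2 y x = value2 t2 a b c).
Proof.
apply: (cosk_extension (V0 := value0 t0) (V1 := value1 t1) (V3 := value3 t3)).
- move=> x hx; have e := ordmap_eta x.
  have h : Ps 0 [:: x (inord 0) : nat] by rewrite /Ps -[ordmap_of _ _ _]e.
  by rewrite (value0E _ h); congr eval0; apply: eq_exist; rewrite [RHS]e.
- move=> x hx _; have e := ordmap_eta x.
  have h : Ps 1 [:: x (inord 0) : nat; x (inord 1) : nat].
    by rewrite /Ps -[ordmap_of _ _ _]e.
  by rewrite (value1E _ h); congr eval1; apply: eq_exist; rewrite [RHS]e.
- move=> x hx _ _; have e := ordmap_eta x.
  have h : Ps 2 [:: x (inord 0) : nat; x (inord 1) : nat; x (inord 2) : nat].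
    by rewrite /Ps -[ordmap_of _ _ _]e.
  by rewrite (value2E _ h); congr eval2; apply: eq_exist; rewrite [RHS]e.
- move=> x hx _ _ _; have e := ordmap_eta x.
  have h : Ps 3 [:: x (inord 0) : nat; x (inord 1) : nat; x (inord 2) : nat;
      x (inord 3) : nat].
    by rewrite /Ps -[ordmap_of _ _ _]e.
  by rewrite (value3E _ h); congr eval3; apply: eq_exist; rewrite [RHS]e.
- move=> a b ab; have [h|h] := pselect (Ps 1 [:: a; b]).
    exact: value1_face.
  by rewrite value1_out //; exact: t1_face.
- move=> a b c ab bc; have [h|h] := pselect (Ps 2 [:: a; b; c]).
    exact: value2_face.
  by rewrite value2_out //; exact: t2_face.
- move=> a b c d ab bc cd; have [h|h] := pselect (Ps 3 [:: a; b; c; d]).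
    exact: value3_face.
  by rewrite value3_out //; exact: t3_face.
Qed.

End PartialValues.

(** * Inner horns *)

Section Horns.
Context {C : monoidal_category} (hC : balanced_calculus C).
Context (T : balanced_choice C) (k m : nat).
Hypothesis km : 0 < k < m.

Local Notation X := (marked_nerve hC T).

(** Boolean form of [in_horn], which computes on concrete [m], [k] and vertex lists. *)
Definition horn_seq (s : seq nat) : bool :=
  has (fun j => (j != k) && (j \notin s)) (iota 0 m.+1).

Lemma in_hornP n s : chain n.+1 m s ->
  reflect (@in_horn k m n (ordmap_of n.+1 m s)) (horn_seq s).
Proof.
move=> hs; case/and3P: (hs) => _ _ /eqP sn; apply: (iffP hasP).
  move=> [j]; rewrite mem_iota => /andP[_ jm] /andP[jk js].
  exists (Ordinal jm); split; first exact/eqP.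
  move=> i /(congr1 (@nat_of_ord _)); rewrite ordmap_ofE // => e.
  by move/negP: js; apply; rewrite -[j]e mem_nth // sn.
move=> [j [jk hj]]; exists (val j); first by rewrite mem_iota ltn_ord.
apply/andP; split; first exact/eqP.
apply/negP => /(nthP 0)[i]; rewrite sn => hi e.
by apply: (hj (Ordinal hi)); apply: val_inj; rewrite /= chain_funE.
Qed.

(** Pigeonhole: there are [m] vertices other than [k], and a list shorter than [m] misses one of
    them. *)
Lemma horn_seq_size s : size s < m -> horn_seq s.
Proof.
move=> sm; apply: contraLR sm => /hasPn h; rewrite -leqNgt.
have : {subset iota 0 m.+1 <= k :: s}.
  move=> j /h; rewrite negb_and negbK inE => /orP[->//|].
  by rewrite negbK => ->; rewrite orbT.
by move/(uniq_leq_size (iota_uniq _ _)); rewrite size_iota.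
Qed.

Context (f : mmap (submarked (@in_horn_closed k m)) X).

Definition horn_fillable : Prop :=
  exists g : mmap (mark (Delta_k_marking k m)) X,
    forall n (a : submarked (@in_horn_closed k m) n), g n (horn_incl k m n a) = f n a.

(** Degenerate simplices on the unit monoid, as placeholders for the filler wherever [f] supplies
    all the values that matter. *)
Local Notation D0 := (@unit_monoid C).
Local Notation D1 := (Nerve1 (monoid_bimodule D0)).
Local Notation D2 := (Nerve2 (unitor_l hC T (monoid_bimodule D0))).
Local Notation D3 :=
  (Nerve3 (compatible0 (unitor_l hC T (monoid_bimodule D0)))).
Local Notation V0 := (value0 f D0).
Local Notation V1 t := (value1 f t).
Local Notation V2 t := (value2 f t).
Local Notation V3 t := (value3 f t).

Lemma V1_in t t' a b : a < b <= m -> horn_seq [:: a; b] -> V1 t a b = V1 t' a b.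
Proof. by move=> ab /(in_hornP (chain_seq2 ab)) h; rewrite !(value1E f _ h). Qed.

Lemma V1_out t a b : a < b <= m -> ~~ horn_seq [:: a; b] -> V1 t a b = t.
Proof.
by move=> ab h; rewrite value1_out // => /(in_hornP (chain_seq2 ab)); apply/negP.
Qed.

Lemma V2_in t t' a b c : a < b -> b < c <= m -> horn_seq [:: a; b; c] ->
  V2 t a b c = V2 t' a b c.
Proof. by move=> ab bc /(in_hornP (chain_seq3 ab bc)) h; rewrite !(value2E f _ h). Qed.

Lemma V2_out t a b c : a < b -> b < c <= m -> ~~ horn_seq [:: a; b; c] ->
  V2 t a b c = t.
Proof.
move=> ab bc h; rewrite value2_out // => /(in_hornP (chain_seq3 ab bc)).
exact/negP.
Qed.

Lemma V2_marked t a b c : a < b -> b < c <= m -> horn_seq [:: a; b; c] ->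
  (forall v, k <= v.+1 -> v <= k.+1 -> v \in [:: a; b; c]) ->
  invertible (V2 t a b c).
Proof.
move=> ab bc /(in_hornP (chain_seq3 ab bc)) h hv; rewrite (value2E f _ h).
apply: (@mfun_marked _ _ f 1 (exist _ _ h)); right => v kv vk /=.
have /(nthP 0)[i hi e] := hv v kv vk; exists (Ordinal hi).
by apply: val_inj; rewrite /= chain_funE //; apply: chain_seq3.
Qed.

Lemma horn_edge t a b : a < b <= m -> horn_seq [:: a; b] ->
  edge (V0 a) (V0 b) (V1 t a b).
Proof.
move=> ab /(in_hornP (chain_seq2 ab)) h.
by have [] := value1_face f t D0 ab h.
Qed.

Lemma horn_triangle t t' a b c : a < b -> b < c <= m ->
  horn_seq [:: a; b; c] ->
  triangle_on (V1 t' a b) (V1 t' a c) (V1 t' b c) (V2 t a b c).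
Proof.
move=> ab bc /(in_hornP (chain_seq3 ab bc)) h.
by have [] := value2_face f t t' ab bc h.
Qed.

Lemma horn_tetrahedron t' a b c d : a < b -> b < c -> c < d <= m ->
  horn_seq [:: a; b; c; d] ->
  tetrahedron (V2 t' a b c) (V2 t' a b d) (V2 t' a c d) (V2 t' b c d).
Proof.
move=> ab bc cd /(in_hornP (chain_seq4 ab bc cd)) h.
by have [] := value3_face f D3 t' ab bc cd h; exists (V3 D3 a b c d).
Qed.

(** Besides incidence of the fillers, a marking has to be checked only for [m = 2]: in higher horns
    the marked edges and triangles already lie in the horn. *)
Lemma horn_extension t1 t2 t3 :
  (forall a b, a < b <= m -> ~~ horn_seq [:: a; b] -> edge (V0 a) (V0 b) t1) ->
  (forall a b c, a < b -> b < c <= m -> ~~ horn_seq [:: a; b; c] ->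
    triangle_on (V1 t1 a b) (V1 t1 a c) (V1 t1 b c) t2) ->
  (forall a b c d, a < b -> b < c -> c < d <= m ->
    ~~ horn_seq [:: a; b; c; d] ->
    tetrahedron_on (V2 t2 a b c) (V2 t2 a b d) (V2 t2 a c d) (V2 t2 b c d) t3) ->
  (m = 2 -> invertible t2) ->
  horn_fillable.
Proof.
move=> h1 h2 h3 h4.
have [||| y [yf y2]] := @partial_extension (nerve_trunc hC T) m _ _ _ f D0 t1 t2 t3.
- move=> a b ab hn; have [|] := h1 a b ab => //.
  by apply/negP => /(in_hornP (chain_seq2 ab)).
- move=> a b c ab bc hn; have [|] := h2 a b c ab bc => //.
  by apply/negP => /(in_hornP (chain_seq3 ab bc)).
- move=> a b c d ab bc cd hn; have [|] := h3 a b c d ab bc cd => //.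
  by apply/negP => /(in_hornP (chain_seq4 ab bc cd)).
have nat_g n p (h : ordmap n.+1 p.+1) (x : ordmap p.+1 m.+1) :
    cosk_act (ordmap_comp x h) y = cosk_act h (cosk_act x y) by [].
pose G := @Smap (mark (Delta_k_marking k m)) X (fun n x => cosk_act x y) nat_g.
suff Gm n (x : mark (Delta_k_marking k m) n.+1) : marked x -> marked (G n.+1 x).
  by exists (Mmap Gm) => n a; exact: yf.
case=> [[i [z ->]]|hx].
  by apply: marked_degenerate; exists i, (G n z); rewrite sfun_nat.
have [xh|xh] := pselect (in_horn x).
  have -> : G n.+1 x = f n.+1 (exist _ x xh) by rewrite -yf.
  by apply: mfun_marked; right.
have hv v : k <= v.+1 -> v <= k.+1 -> exists2 i, i <= n.+1 & x (inord i) = v :> nat.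
  move=> kv vk; have vm : v < m.+1 by case/andP: km; lia.
  have [i xi] := hx (Ordinal vm) kv vk; have [j hj e] := ord_inord i.
  by exists j => //; rewrite -e xi.
(* Above dimension 2 everything is marked, and an edge cannot contain the three vertices [k - 1],
   [k] and [k + 1]. *)
case: n x hx xh hv => [|[|n]] x hx xh hv //=.
  case/andP: km => k0 _.
  have [[|[|i]] // _ ei] := hv k.-1 ltac:(lia) ltac:(lia);
  have [[|[|j]] // _ ej] := hv k ltac:(lia) ltac:(lia);
  have [[|[|l]] // _ el] := hv k.+1 ltac:(lia) ltac:(lia); lia.
have xhs : ~~ horn_seq (mkseq (fun i => x (inord i) : nat) 3).
  apply/negP => h; apply: xh; rewrite [x]ordmap_eta.
  exact/(in_hornP (ordmap_chain x)).
have [x01 _] := andP (ordmap_inord_le x (isT : 0 <= 1 <= 2)).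
have [x12 _] := andP (ordmap_inord_le x (isT : 1 <= 2 <= 2)).
have [k0 lkm] := andP km.
have [e0 e1 e2] : [/\ x (inord 0) = k.-1 :> nat, x (inord 1) = k :> nat
    & x (inord 2) = k.+1 :> nat].
  by have [[|[|[|i]]] // _ ei] := hv k.-1 ltac:(lia) ltac:(lia);
  have [[|[|[|j]]] // _ ej] := hv k ltac:(lia) ltac:(lia);
  have [[|[|[|l]]] // _ el] := hv k.+1 ltac:(lia) ltac:(lia); split; lia.
(* Outside the horn, the triangle meets all [m] vertices other than [k], but it has only two such
   vertices. *)
have m2 : m = 2.
  have [m3|m3|m3] := ltngtP m 3; first by lia.
    by move: xhs; rewrite horn_seq_size.
  by move: xhs; rewrite /mkseq [map _ _]/= e0 e1 e2 /horn_seq m3 /= !inE; lia.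
rewrite (_ : ordmap_comp x (ordmap_id 3) = x); last exact: ordmap_eq.
have xb : x (inord 1) < x (inord 2) <= m by rewrite e1 e2 ltnS leqnn.
have xa : x (inord 0) < x (inord 1) by rewrite e0 e1; lia.
rewrite (y2 _ _ _ x xa (proj1 (andP xb)) erefl erefl erefl) value2_out.
  exact: h4.
by move/(in_hornP (chain_seq3 xa xb)); apply/negP.
Qed.

Lemma horn2 : m = 2 -> horn_fillable.
Proof.
move=> m2; have k1 : k = 1 by lia.
have h01 : 0 < 1 <= m by rewrite m2.
have h12 : 1 < 2 <= m by rewrite m2.
have h02 : 0 < 2 <= m by rewrite m2.
have s01 : horn_seq [:: 0; 1] by rewrite /horn_seq m2 k1.
have s12 : horn_seq [:: 1; 2] by rewrite /horn_seq m2 k1.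
have s02 : ~~ horn_seq [:: 0; 2] by rewrite /horn_seq m2 k1.
have [t2 t2i [t1 t1e tri]] :=
  fill_triangle hC T (horn_edge D1 h01 s01) (horn_edge D1 h12 s12).
apply: (@horn_extension t1 t2 D3) => //.
- move=> a b ab nh; have [-> ->] // : a = 0 /\ b = 2.
  by move: nh; rewrite /horn_seq m2 k1 /= !inE; lia.
- move=> a b c ab bc _; have [-> [-> ->]] : a = 0 /\ b = 1 /\ c = 2 by lia.
  by rewrite (V1_in t1 D1 h01) // (V1_in t1 D1 h12) // (V1_out t1 h02).
- by move=> a b c d; lia.
Qed.

(** For [k = 1] the face 023 is missing and 012 is marked; for [k = 2] the face 013 is missing and
    123 is marked. *)
Lemma horn3 : m = 3 -> horn_fillable.
Proof.
move=> m3; have e a b : a < b <= m -> edge (V0 a) (V0 b) (V1 D1 a b).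
  by move=> ab; apply: horn_edge => //; apply: horn_seq_size; rewrite m3.
have h01 : 0 < 1 <= m by rewrite m3.
have h02 : 0 < 2 <= m by rewrite m3.
have h03 : 0 < 3 <= m by rewrite m3.
have h12 : 1 < 2 <= m by rewrite m3.
have h13 : 1 < 3 <= m by rewrite m3.
have h23 : 2 < 3 <= m by rewrite m3.
have [k1|k2] : k = 1 \/ k = 2 by lia.
- have s012 : horn_seq [:: 0; 1; 2] by rewrite /horn_seq m3 k1.
  have s013 : horn_seq [:: 0; 1; 3] by rewrite /horn_seq m3 k1.
  have s123 : horn_seq [:: 1; 2; 3] by rewrite /horn_seq m3 k1.
  have s023 : ~~ horn_seq [:: 0; 2; 3] by rewrite /horn_seq m3 k1.
  have i012 : invertible (V2 D2 0 1 2).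
    by apply: V2_marked => // v; rewrite k1 !inE; lia.
  have [t2 tri [t3 tet]] := fill_tetrahedron1 (e _ _ h01) (e _ _ h02) (e _ _ h03)
    (e _ _ h12) (e _ _ h13) (e _ _ h23)
    (@horn_triangle D2 D1 0 1 2 isT h12 s012) (@horn_triangle D2 D1 0 1 3 isT h13 s013)
    (@horn_triangle D2 D1 1 2 3 isT h23 s123) i012.
  apply: (@horn_extension D1 t2 t3); last by lia.
  + by move=> a b ab /negP[]; apply: horn_seq_size; rewrite m3.
  + move=> a b c ab bc nh.
    have [-> [-> ->]] // : a = 0 /\ b = 2 /\ c = 3.
    by move: nh; rewrite /horn_seq m3 k1 /= !inE; lia.
  + move=> a b c d ab bc cd _.
    have [-> [-> [-> ->]]] : a = 0 /\ b = 1 /\ c = 2 /\ d = 3 by lia.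
    rewrite (V2_in t2 D2 (isT : 0 < 1) h12) // (V2_in t2 D2 (isT : 0 < 1) h13) //.
    by rewrite (V2_in t2 D2 (isT : 1 < 2) h23) // (V2_out t2 (isT : 0 < 2) h23).
- have s012 : horn_seq [:: 0; 1; 2] by rewrite /horn_seq m3 k2.
  have s023 : horn_seq [:: 0; 2; 3] by rewrite /horn_seq m3 k2.
  have s123 : horn_seq [:: 1; 2; 3] by rewrite /horn_seq m3 k2.
  have s013 : ~~ horn_seq [:: 0; 1; 3] by rewrite /horn_seq m3 k2.
  have i123 : invertible (V2 D2 1 2 3).
    by apply: V2_marked => // v; rewrite k2 !inE; lia.
  have [t2 tri [t3 tet]] := fill_tetrahedron2 (e _ _ h01) (e _ _ h02) (e _ _ h03)
    (e _ _ h12) (e _ _ h13) (e _ _ h23)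
    (@horn_triangle D2 D1 0 1 2 isT h12 s012) (@horn_triangle D2 D1 0 2 3 isT h23 s023)
    (@horn_triangle D2 D1 1 2 3 isT h23 s123) i123.
  apply: (@horn_extension D1 t2 t3); last by lia.
  + by move=> a b ab /negP[]; apply: horn_seq_size; rewrite m3.
  + move=> a b c ab bc nh.
    have [-> [-> ->]] // : a = 0 /\ b = 1 /\ c = 3.
    by move: nh; rewrite /horn_seq m3 k2 /= !inE; lia.
  + move=> a b c d ab bc cd _.
    have [-> [-> [-> ->]]] : a = 0 /\ b = 1 /\ c = 2 /\ d = 3 by lia.
    rewrite (V2_in t2 D2 (isT : 0 < 1) h12) // (V2_in t2 D2 (isT : 0 < 2) h23) //.
    by rewrite (V2_in t2 D2 (isT : 1 < 2) h23) // (V2_out t2 (isT : 0 < 1) h13).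
Qed.

Lemma horn_extension3 t3 : 3 < m ->
  (forall a b c d, a < b -> b < c -> c < d <= m ->
    ~~ horn_seq [:: a; b; c; d] ->
    tetrahedron_on (V2 D2 a b c) (V2 D2 a b d) (V2 D2 a c d) (V2 D2 b c d) t3) ->
  horn_fillable.
Proof.
move=> m3 h; apply: (@horn_extension D1 D2 t3) => //; last by lia.
- by move=> a b ab /negP[]; apply: horn_seq_size; exact: ltn_trans m3.
- by move=> a b c ab bc /negP[]; apply: horn_seq_size.
Qed.

(** For [k = 1, 2, 3] the missing face is 0234, 0134, 0124, and the marked triangle to be cancelled
    is 012, 123, 234. *)
Lemma horn4 : m = 4 -> horn_fillable.
Proof.
move=> m4; have e a b : a < b < 5 -> edge (V0 a) (V0 b) (V1 D1 a b).
  rewrite -m4 => ab; apply: horn_edge => //; apply: horn_seq_size.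
  by rewrite m4.
have tr a b c : a < b < c -> c < 5 ->
    triangle_on (V1 D1 a b) (V1 D1 a c) (V1 D1 b c) (V2 D2 a b c).
  move=> /andP[ab bc] c5; apply: horn_triangle; rewrite // ?bc ?m4 //.
  by apply: horn_seq_size; rewrite m4.
have te a b c d : a < b -> b < c -> c < d < 5 -> horn_seq [:: a; b; c; d] ->
    V_tetrahedron (V2 D2) a b c d.
  by move=> ab bc cd; apply: horn_tetrahedron; rewrite // m4.
have i a b c : a < b -> b < c < 5 ->
    (forall v, k <= v.+1 -> v <= k.+1 -> v \in [:: a; b; c]) ->
    invertible (V2 D2 a b c).
  move=> ab bc; apply: V2_marked; rewrite // ?m4 //.
  by apply: horn_seq_size; rewrite m4.
suff [t3 ht3] : exists t3, forall a b c d, a < b -> b < c -> c < d <= m ->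
    ~~ horn_seq [:: a; b; c; d] ->
    tetrahedron_on (V2 D2 a b c) (V2 D2 a b d) (V2 D2 a c d) (V2 D2 b c d) t3.
  by apply: (horn_extension3 _ ht3); rewrite m4.
have [k1|[k2|k3]] : k = 1 \/ k = 2 \/ k = 3 by lia.
- have [||||| t3 ht3] := fill_face1 e tr;
    try by apply: te; rewrite // /horn_seq m4 k1.
    by apply: i => // v; rewrite k1 !inE; lia.
  exists t3 => a b c d ab bc cd nh.
  have [-> [-> [-> ->]]] // : a = 0 /\ b = 2 /\ c = 3 /\ d = 4.
  by move: nh; rewrite /horn_seq m4 k1 /= !inE; lia.
- have [||||| t3 ht3] := fill_face2 e tr;
    try by apply: te; rewrite // /horn_seq m4 k2.
    by apply: i => // v; rewrite k2 !inE; lia.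
  exists t3 => a b c d ab bc cd nh.
  have [-> [-> [-> ->]]] // : a = 0 /\ b = 1 /\ c = 3 /\ d = 4.
  by move: nh; rewrite /horn_seq m4 k2 /= !inE; lia.
- have [||||| t3 ht3] := fill_face3 e tr;
    try by apply: te; rewrite // /horn_seq m4 k3.
    by apply: i => // v; rewrite k3 !inE; lia.
  exists t3 => a b c d ab bc cd nh.
  have [-> [-> [-> ->]]] // : a = 0 /\ b = 1 /\ c = 2 /\ d = 4.
  by move: nh; rewrite /horn_seq m4 k3 /= !inE; lia.
Qed.

Lemma horn_lifting : horn_fillable.
Proof.
(* From dimension 5 on, the horn contains the whole 3-skeleton and no filler is required. *)
have [m5|] := ltnP 4 m.
  apply: (@horn_extension3 D3) => [|a b c d _ _ _ /negP[]]; first exact: ltnW.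
  exact: horn_seq_size.
rewrite leq_eqVlt => /orP[/eqP|]; first exact: horn4.
rewrite ltnS leq_eqVlt => /orP[/eqP|m3]; first exact: horn3.
by apply: horn2; lia.
Qed.

End Horns.

(** Both sides have the same underlying simplicial set, so the lift is [f] itself and only the added
    markings have to be checked. *)
Lemma entire_lifting (Y : sset) (E F : marking Y) (EF : submarking E F)
    (X : marked_sset) (f : mmap (mark E) X) :
  (forall n (x : Y n.+1), F n x -> marked (f n.+1 x)) ->
  exists g : mmap (mark F) X, forall n (a : mark E n), g n (entire_map EF n a) = f n a.
Proof.
move=> h; pose G := @Smap (mark F) X (mfun f) (@sfun_nat _ _ f).
suff Gm n (x : mark F n.+1) : marked x -> marked (G n.+1 x) by exists (Mmap Gm).
case=> [d|]; last exact: h.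
by apply: (mfun_marked f); left.
Qed.

Section SimplexValues.
Context {C : monoidal_category} (hC : balanced_calculus C).
Context (T : balanced_choice C) (m : nat) (E : marking (simplex m.+1)).
Context (f : mmap (mark E) (marked_nerve hC T)).

(** Counterparts of [value0] to [value3] for a map defined on the whole simplex, where no filler
    occurs. *)
Definition U0 a : monoid C := eval0 f (ordmap_of 1 m [:: a]).
Definition U1 a b : nerve1 := eval1 f (ordmap_of 2 m [:: a; b]).
Definition U2 a b c : nerve2 hC T := eval2 f (ordmap_of 3 m [:: a; b; c]).
Definition U3 a b c d : nerve3 hC T := eval3 f (ordmap_of 4 m [:: a; b; c; d]).

Lemma U_edge a b : a < b <= m -> edge (U0 a) (U0 b) (U1 a b).
Proof.
move=> ab; have hs := chain_seq2 ab.
have fa := @eval_face1 (nerve_trunc hC T) _ f (inord 1) (ordmap_of 2 m [:: a; b]).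
have fb := @eval_face1 (nerve_trunc hC T) _ f (inord 0) (ordmap_of 2 m [:: a; b]).
by split; [apply: etrans fa _|apply: etrans fb _]; congr eval0;
  rewrite /= ordmap_of_coface.
Qed.

Lemma U_triangle a b c : a < b -> b < c <= m ->
  triangle_on (U1 a b) (U1 a c) (U1 b c) (U2 a b c).
Proof.
move=> ab bc; have hs := chain_seq3 ab bc.
pose F i := @eval_face2 (nerve_trunc hC T) _ f (inord i) (ordmap_of 3 m [:: a; b; c]).
by split; [apply: etrans (F 2) _|apply: etrans (F 1) _|apply: etrans (F 0) _];
  congr eval1; rewrite /= ordmap_of_coface.
Qed.

Lemma U_tetrahedron a b c d : a < b -> b < c -> c < d <= m ->
  tetrahedron (U2 a b c) (U2 a b d) (U2 a c d) (U2 b c d).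
Proof.
move=> ab bc cd; have hs := chain_seq4 ab bc cd; exists (U3 a b c d).
pose F i := @eval_face3 (nerve_trunc hC T) _ f (inord i)
  (ordmap_of 4 m [:: a; b; c; d]).
by split; [apply: etrans (F 3) _|apply: etrans (F 2) _|apply: etrans (F 1) _
  |apply: etrans (F 0) _]; congr eval2; rewrite /= ordmap_of_coface.
Qed.

Lemma U1_marked a b : E (n := 0) (ordmap_of 2 m [:: a; b]) ->
  equivalence_edge hC T (U1 a b).
Proof. by move=> h; apply: (@mfun_marked _ _ f 0); right. Qed.

Lemma U2_marked a b c : E (n := 1) (ordmap_of 3 m [:: a; b; c]) ->
  invertible (U2 a b c).
Proof. by move=> h; apply: (@mfun_marked _ _ f 1); right. Qed.

End SimplexValues.

(** * Marking the k-th face *)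

Section FaceMarking.
Context {C : monoidal_category} (hC : balanced_calculus C).
Context (T : balanced_choice C).
Local Notation X := (marked_nerve hC T).

(** For [m = 2] equivalences compose; for [m = 3] invertibility of three faces of a tetrahedron
    passes to the fourth; for larger [m] the face has dimension above 2. *)
Lemma Delta_k_face_marked k m (f : mmap (mark (Delta_k'_marking k m)) X) :
  0 < k < m -> forall n (x : ordmap n.+2 m.+1),
  is_face k x -> @marked X n (f n.+1 x).
Proof.
move=> km [|[|n]] x [] // em xk; rewrite -em in km f x xk *.
- have k1 : k = 1 by lia.
  rewrite k1 in f xk *.
  have -> : x = ordmap_of 2 2 [:: 0; 2].
    by rewrite [x]ordmap_eta /mkseq [map _ _]/= !xk !inordK.
  have [e01 e02 e12] := U_triangle f (isT : 0 < 1) (isT : 1 < 2 <= 2).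
  suff : equivalence_edge hC T (U1 f 0 2) by [].
  rewrite -e02; apply: equivalence_edge_comp.
  + apply: U2_marked; left=> v _ _; exists v; apply: val_inj.
    by rewrite /= chain_funE //; case: v => [[|[|[|v]]]].
  + rewrite e01; apply: U1_marked; right; exists ord_max; split; first by right.
    split=> // i; rewrite chain_funE //.
    by case: i => [[|[|i]]].
  + rewrite e12; apply: U1_marked; right; exists ord0; split; first by left.
    split=> // i; rewrite chain_funE //.
    by case: i => [[|[|i]]].
- have e01 := U_edge f (isT : 0 < 1 <= 3).
  have e02 := U_edge f (isT : 0 < 2 <= 3).
  have e03 := U_edge f (isT : 0 < 3 <= 3).
  have e12 := U_edge f (isT : 1 < 2 <= 3).
  have e13 := U_edge f (isT : 1 < 3 <= 3).
  have e23 := U_edge f (isT : 2 < 3 <= 3).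
  have t012 := U_triangle f (isT : 0 < 1) (isT : 1 < 2 <= 3).
  have t013 := U_triangle f (isT : 0 < 1) (isT : 1 < 3 <= 3).
  have t023 := U_triangle f (isT : 0 < 2) (isT : 2 < 3 <= 3).
  have t123 := U_triangle f (isT : 1 < 2) (isT : 2 < 3 <= 3).
  have te := U_tetrahedron f (isT : 0 < 1) (isT : 1 < 2) (isT : 2 < 3 <= 3).
  (* [face] uses the additionally marked faces [k - 1] and [k + 1]; [mid] uses the triangle that
     contains [k - 1], [k] and [k + 1]. *)
  have face (j : 'I_4) a b c : a < b -> b < c <= 3 -> j.+1 = k \/ j = k.+1 :> nat ->
      (j : nat) \notin [:: a; b; c] -> invertible (U2 f a b c).
    move=> ab bc jk js; apply: U2_marked; right; exists j; split=> //; split=> // i.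
    rewrite chain_funE; last exact: chain_seq3.
    move: js; rewrite !inE; case: j {jk} => j /= hj.
    by case: i => [[|[|[|i]]]] //=; rewrite /bump; lia.
  have mid a b c : a < b -> b < c <= 3 ->
      (forall v, k <= v.+1 -> v <= k.+1 -> v \in [:: a; b; c]) ->
      invertible (U2 f a b c).
    move=> ab bc hv; apply: U2_marked; left => v kv vk.
    have /(nthP 0)[i hi e] := hv v kv vk; exists (Ordinal hi).
    by apply: val_inj; rewrite /= chain_funE //; apply: chain_seq3.
  have [k1|k2] : k = 1 \/ k = 2 by lia.
  + have -> : x = ordmap_of 3 3 [:: 0; 2; 3].
      by rewrite [x]ordmap_eta /mkseq [map _ _]/= !xk !inordK // k1.
    suff : invertible (U2 f 0 2 3) by [].
    apply: (invertible_face1 e01 e02 e03 e12 e13 e23 t012 t013 t023 t123 te).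
    * by apply: mid => // v; rewrite k1 !inE; lia.
    * by apply: (face (inord 2)); rewrite ?inordK // k1; right.
    * by apply: (face ord0); rewrite // k1; left.
  + have -> : x = ordmap_of 3 3 [:: 0; 1; 3].
      by rewrite [x]ordmap_eta /mkseq [map _ _]/= !xk !inordK // k2.
    suff : invertible (U2 f 0 1 3) by [].
    apply: (invertible_face2 e01 e02 e03 e12 e13 e23 t012 t013 t023 t123 te).
    * by apply: (face ord_max); rewrite // k2; right.
    * by apply: (face (inord 1)); rewrite ?inordK // k2; left.
    * by apply: mid => // v; rewrite k2 !inE; lia.
Qed.

End FaceMarking.

(** The empty factor of a join; it exists also for [M = 0]. *)
Definition empty_ordmap M : ordmap 0 M.
Proof. by exists (fun i : 'I_0 => False_rect 'I_M (notF (ltn_ord i))) => -[]. Defined.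

(** * Saturation: joins of Δ[3]^eq with a simplex *)

Section JoinMarking.
Context {C : monoidal_category} (hC : balanced_calculus C).
Context (T : balanced_choice C) (l : nat).
Local Notation X := (marked_nerve hC T).
Context (f : mmap (mark (join_marking Delta3_eq_marking l)) X).

Lemma marked_triangle a b c : a < b -> b < c < 4 -> invertible (U2 (m := l.+3) f a b c).
Proof.
move=> ab bc; apply: U2_marked.
have h3 : chain 3 3 [:: a; b; c] by exact: chain_seq3.
have hl : chain 3 l.+3 [:: a; b; c] by apply: chain_seq3; lia.
exists 3, 0, (ordmap_of 3 3 [:: a; b; c]), (empty_ordmap l); split; last first.
  by left; right; apply: Or31.
split=> // [i j ij|[]//]; by rewrite !chain_funE // ij.
Qed.

Lemma marked_edge a b : a = 0 /\ b = 2 \/ a = 1 /\ b = 3 ->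
  equivalence_edge hC T (U1 (m := l.+3) f a b).
Proof.
move=> ab; apply: U1_marked.
have h3 : chain 2 3 [:: a; b] by apply: chain_seq2; lia.
have hl : chain 2 l.+3 [:: a; b] by apply: chain_seq2; lia.
exists 2, 0, (ordmap_of 2 3 [:: a; b]), (empty_ordmap l); split; last first.
  left; right; case: ab => [[-> ->]|[-> ->]].
    by apply: Or32; rewrite !chain_funE.
  by apply: Or33; rewrite !chain_funE.
split=> // [i j ij|[]//]; by rewrite !chain_funE // ij.
Qed.

Lemma marked_cone a b v : a = 0 /\ b = 2 \/ a = 1 /\ b = 3 -> 4 <= v < 4 + l ->
  invertible (U2 (m := l.+3) f a b v).
Proof.
move=> ab /andP[v4 vl]; apply: U2_marked.
have h3 : chain 2 3 [:: a; b] by apply: chain_seq2; lia.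
have hl : chain 3 l.+3 [:: a; b; v] by apply: chain_seq3; lia.
(* The first four vertices come from Δ[3], so [v - 4] is the position of [v] in the second
   factor. *)
have hz : v - 4 < l by lia.
exists 2, 1, (ordmap_of 2 3 [:: a; b]), (@Ordmap 1 l (fun=> Ordinal hz) (fun _ _ _ => leqnn _)).
split; last first.
  left; right; case: ab => [[-> ->]|[-> ->]].
    by apply: Or32; rewrite !chain_funE.
  by apply: Or33; rewrite !chain_funE.
split=> // [i j ij|i j ij]; rewrite chain_funE // ij.
  by rewrite chain_funE //; case: i {ij} => [[|[|i]]].
by rewrite (ord1 i) /=; lia.
Qed.

(** Two-out-of-six applies: all triangles on 0, 1, 2, 3 are invertible, and 02 and 13 are
    equivalences. *)
Lemma all_edges a b : a < b < 4 -> equivalence_edge hC T (U1 (m := l.+3) f a b).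
Proof.
have e01 := @U_edge _ _ _ l.+3 _ f 0 1 isT.
have e02 := @U_edge _ _ _ l.+3 _ f 0 2 isT.
have e03 := @U_edge _ _ _ l.+3 _ f 0 3 isT.
have e12 := @U_edge _ _ _ l.+3 _ f 1 2 isT.
have e13 := @U_edge _ _ _ l.+3 _ f 1 3 isT.
have e23 := @U_edge _ _ _ l.+3 _ f 2 3 isT.
have t012 := @U_triangle _ _ _ l.+3 _ f 0 1 2 isT isT.
have t013 := @U_triangle _ _ _ l.+3 _ f 0 1 3 isT isT.
have t023 := @U_triangle _ _ _ l.+3 _ f 0 2 3 isT isT.
have t123 := @U_triangle _ _ _ l.+3 _ f 1 2 3 isT isT.
have te := @U_tetrahedron _ _ _ l.+3 _ f 0 1 2 3 isT isT isT.
have q02 := @marked_edge 0 2 (or_introl (conj erefl erefl)).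
have q13 := @marked_edge 1 3 (or_intror (conj erefl erefl)).
have [q01 q12 q23 q03] := equivalence_two_of_six_edges
  e01 e02 e03 e12 e13 e23 t012 t013 t023 t123 te
  (@marked_triangle 0 1 2 isT isT) (@marked_triangle 0 1 3 isT isT)
  (@marked_triangle 0 2 3 isT isT) (@marked_triangle 1 2 3 isT isT) q02 q13.
by case/andP; case: a b => [|[|[|a]]] [|[|[|[|b]]]].
Qed.

(* The cone over the 3-simplex 0123 is renumbered as a 4-simplex, 4 standing
   for the apex. *)
Lemma all_cones a b v : a < b < 4 -> 4 <= v < 4 + l ->
  invertible (U2 (m := l.+3) f a b v).
Proof.
move=> ab vl; pose g i := if i < 4 then i else v.
have g_le i j : i < j < 5 -> g i < g j <= l.+3.
  by rewrite /g; case: ifP; case: ifP; lia.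
have e i j (ij : i < j < 5) := @U_edge _ _ _ l.+3 _ f _ _ (g_le i j ij).
have tr i j h (ij : i < j < h) (h5 : h < 5) :
    triangle_on (U1 (m := l.+3) f (g i) (g j)) (U1 f (g i) (g h))
    (U1 f (g j) (g h)) (U2 f (g i) (g j) (g h)).
  case/andP: ij => ij jh; apply: U_triangle; last by apply: g_le; rewrite jh.
  by have /andP[] : g i < g j <= l.+3 by apply: g_le; lia.
have te i j h p : i < j -> j < h -> h < p < 5 ->
    V_tetrahedron (fun i j h => U2 (m := l.+3) f (g i) (g j) (g h)) i j h p.
  move=> ij jh hp; apply: U_tetrahedron; last exact: g_le.
    by have /andP[] : g i < g j <= l.+3 by apply: g_le; lia.
  by have /andP[] : g j < g h <= l.+3 by apply: g_le; lia.
have [||||||||||c014 c124 c234 c034] := two_of_six_cone e tr;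
  try exact: te; try exact: all_edges; try exact: marked_triangle.
- by apply: marked_cone => //; left.
- by apply: marked_cone => //; right.
have c024 : invertible (U2 (m := l.+3) f 0 2 v) by apply: marked_cone => //; left.
have c134 : invertible (U2 (m := l.+3) f 1 3 v) by apply: marked_cone => //; right.
by case/andP: ab; case: a b => [|[|[|a]]] [|[|[|[|b]]]].
Qed.

(** Up to degeneracy, the newly marked simplices of dimension at most 2 are the edges on 0, 1, 2, 3
    and the cones on them. Triangles on these vertices, and joins with a degenerate second factor,
    are marked in the source. *)
Lemma join_marked n (x : ordmap n.+2 (4 + l)) :
  join_marking (full_marking (simplex 4)) l x -> @marked X n (f n.+1 x).
Proof.
move=> [p [q [y [z [yzx []]]]]]; last first.
  move=> hz; apply: (mfun_marked f); right.
  by exists p, q, y, z; split=> //; right.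
have degx k : k <= n -> x (inord k) = x (inord k.+1) :> nat -> @marked X n (f n.+1 x).
  move=> kn e; apply: (mfun_marked f); left; exists (inord k).
  exists (ordmap_comp x (coface (inord k))).
  exact: esym (@ordmap_degenerate n l.+3 x k kn e).
(* Since [y] has at least two vertices, what survives is an edge for [n = 0], and for [n = 1] a
   triangle of Δ[3] or an edge joined with one vertex. *)
case: n x yzx degx => [|[|n]] x yzx degx //; case: p y yzx => [|[|p]] y // [pq xy xz] _.
- have [p0 q0] : p = 0 /\ q = 0 by lia.
  subst p q.
  have e0 := xy (inord 0) (inord 0) erefl; have e1 := xy (inord 1) (inord 1) erefl.
  have := ordfun_homo y (_ : inord 0 <= inord 1); rewrite !inordK // => /(_ isT).
  rewrite leq_eqVlt => /orP[/eqP ey|ly]; first by apply: (degx 0); rewrite // e0 e1.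
  rewrite [x](@ordmap_eta 1 l.+3) /mkseq [map _ _]/= e0 e1.
  by apply: all_edges; rewrite ly ltn_ord.
have [[p1 q0]|[p0 q1]] : (p = 1 /\ q = 0) \/ (p = 0 /\ q = 1) by lia.
  subst p q; apply: (mfun_marked f); right.
  by exists 3, 0, y, z; split=> //; left; right; apply: Or31.
subst p q.
have e0 := xy (inord 0) (inord 0); have e1 := xy (inord 1) (inord 1).
have e2 := xz ord0 (inord 2); rewrite !inordK // in e0 e1 e2.
have := ordfun_homo y (_ : inord 0 <= inord 1); rewrite !inordK // => /(_ isT).
rewrite leq_eqVlt => /orP[/eqP ey|ly].
  by apply: (degx 0); rewrite // e0 // e1.
rewrite [x](@ordmap_eta 2 l.+3) /mkseq [map _ _]/= e0 // e1 // e2 //.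
by apply: all_cones; rewrite ?ly ?ltn_ord //= ltn_add2l ltn_ord.
Qed.

End JoinMarking.

Theorem theorem3p10 (C : monoidal_category) (hC : balanced_calculus C)
    (T : balanced_choice C) :
  two_complicial (marked_nerve hC T).
Proof.
split.
- by move=> k m _ km f; exact: horn_lifting.
- move=> k m m2 km f; apply: entire_lifting => n x [h|[j [jk xj]]].
    by apply: (mfun_marked f); right.
  by apply: (Delta_k_face_marked f km); rewrite -jk.
(* The top simplex has dimension above 2, where the nerve marks everything. *)
- move=> m m2 f; apply: entire_lifting => n x [em _].
  by rewrite -em in m2; case: n {em} x m2 => [|[|n]].
- move=> l f; apply: entire_lifting => n x; exact: join_marked.
Qed.
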